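(* Let $p\ge 1$ be an integer and let $$f_0(p) = \max\{p+1,\ 3\lfloor p/2\rfloor\},\quad f_1(p)=\max\{2p-\lfloor p/2\rfloor,\ 2p-2\lfloor p/2\rfloor+1\},\quad f_2(p)=\max\{p+1,\ p+2\lceil p/2\rceil\}.$$ Let $i\in\{0,1,2\}$, let $n\ge f_i(p)$, and let $\mathscr{B}_{p,i}$ be a basis of the $n$-dimensional spline space $\mathbb{S}_{p,i}$ belonging to the family $\mathfrak{F}_{p,i}$. Then the mass matrix $M_{\mathscr{B}_{p,i}}$ and the stiffness matrix $K_{\mathscr{B}_{p,i}}$ have the same spectra as the matrices $M_{\mathscr{E}_{p,i}}$ and $K_{\mathscr{E}_{p,i}}$, respectively, where $\mathscr{E}_{p,i}$ is the reference basis of $\mathbb{S}_{p,i}$. In particular, $\mathscr{B}_{p,i}$ is an outlier-free basis. (All objects, including the notion of outlier-free basis, are defined in the context.)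
   Context: Bases are ordered and identified with column vectors of functions, so for a matrix $A$ and a column vector of functions $\mathscr{B}$, the $k$-th entry of $A\mathscr{B}$ is $\sum_j A_{k,j}\mathscr{B}_j$. Splines. For a partition $\boldsymbol\tau=\{0=\tau_1<\dots<\tau_{m+1}=1\}$, let $\mathbb{S}_{p,\boldsymbol\tau}$ be the space of $s\in C^{p-1}([0,1])$ whose restriction to each $[\tau_k,\tau_{k+1}]$, $k=1,\dots,m$, is a polynomial of degree at most $p$; it has dimension $m+p$. Its open-knot B-spline basis $\mathscr{B}_{p,\boldsymbol\tau}$ consists of the $m+p$ standard (Cox--de Boor, partition-of-unity normalized) B-splines of degree $p$, in left-to-right order, on the knot sequence in which $\tau_1$ and $\tau_{m+1}$ are repeated $p+1$ times and $\tau_2,\dots,\tau_m$ appear once. The cardinal B-spline is defined by $\mathcal N_0=1$ on $[0,1)$ and $0$ elsewhere, $\mathcal N_p(x)=\frac{x}{p}\mathcal N_{p-1}(x)+\frac{p+1-x}{p}\mathcal N_{p-1}(x-1)$; and $\mathcal N_{t,p}(x)=\mathcal N_p(x-t)$. Optimal spaces (dimension $n$; $\partial^\alpha$ is the $\alpha$-th derivative, one-sided at the end points). - $\mathbb{S}_{p,0}=\{s\in\mathbb{S}_{p,\boldsymbol\tau_{p,0}}:\partial^\alpha s(0)=\partial^\alpha s(1)=0,\ 0\le\alpha\le p,\ \alpha\text{ even}\}$, with $\boldsymbol\tau_{p,0}=\{0,\frac1{n+1},\frac2{n+1},\dots,\frac n{n+1},1\}$ for $p$ odd and $\{0,\frac{1/2}{n+1},\frac{3/2}{n+1},\dots,\frac{n+1/2}{n+1},1\}$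 for $p$ even. - $\mathbb{S}_{p,1}=\{s\in\mathbb{S}_{p,\boldsymbol\tau_{p,1}}:\partial^\alpha s(0)=\partial^\alpha s(1)=0,\ 0\le\alpha\le p,\ \alpha\text{ odd}\}$, with $\boldsymbol\tau_{p,1}=\{0,\frac{1/2}{n},\frac{3/2}{n},\dots,\frac{n-1/2}{n},1\}$ for $p$ odd and $\{0,\frac1n,\frac2n,\dots,\frac{n-1}n,1\}$ for $p$ even. - $\mathbb{S}_{p,2}=\{s\in\mathbb{S}_{p,\boldsymbol\tau_{p,2}}:\partial^{\alpha_0}s(0)=\partial^{\alpha_1}s(1)=0,\ 0\le\alpha_0,\alpha_1\le p,\ \alpha_0\text{ even},\ \alpha_1\text{ odd}\}$, with $\boldsymbol\tau_{p,2}=\{0,\frac2{2n+1},\frac4{2n+1},\dots,\frac{2n}{2n+1},1\}$ for $p$ odd and $\{0,\frac1{2n+1},\frac3{2n+1},\dots,\frac{2n-1}{2n+1},1\}$ for $p$ even. Reference bases $\mathscr{E}_{p,i}=(\mathcal E_{1,p,i},\dots,\mathcal E_{n,p,i})^T$ of $\mathbb{S}_{p,i}$ (functions of $x\in[0,1]$). Put $q=\lfloor p/2\rfloor-p$. - $i=0$: with $y=(n+1)x$ for $p$ odd, $y=(n+1)x+\frac12$ for $p$ even: $\mathcal E_{j,p,0}(x)=-\mathcal N_{q-j,p}(y)+\mathcal N_{q+j,p}(y)$ for $1\le j\le\lfloor p/2\rfloor$; $\mathcal N_{q+j,p}(y)$ for $\lfloor p/2\rfloor+1\le j\le n-\lfloor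 p/2\rfloor$; $\mathcal N_{q+j,p}(y)-\mathcal N_{q+2(n+1)-j,p}(y)$ for $n+1-\lfloor p/2\rfloor\le j\le n$. - $i=1$: with $y=nx+\frac12$ for $p$ odd, $y=nx$ for $p$ even: $\mathcal E_{j,p,1}(x)=\mathcal N_{-\lfloor p/2\rfloor-j,p}(y)+\mathcal N_{-\lfloor p/2\rfloor+j-1,p}(y)$ for $1\le j\le -q$; $\mathcal N_{-\lfloor p/2\rfloor+j-1,p}(y)$ for $-q+1\le j\le n+q$; $\mathcal N_{-\lfloor p/2\rfloor+j-1,p}(y)+\mathcal N_{-\lfloor p/2\rfloor+2n-j,p}(y)$ for $n+q+1\le j\le n$. - $i=2$: with $y=\frac{2n+1}2x$ for $p$ odd, $y=\frac{2n+1}2x+\frac12$ for $p$ even: $\mathcal E_{j,p,2}(x)=\mathcal N_{q+j,p}(y)-\mathcal N_{q-j,p}(y)$ for $1\le j\le\lfloor p/2\rfloor$; $\mathcal N_{q+j,p}(y)$ for $\lfloor p/2\rfloor+1\le j\le n+q$; $\mathcal N_{q+j,p}(y)+\mathcal N_{q+2n+1-j,p}(y)$ for $n+q+1\le j\le n$. Mass and stiffness matrices. For a basis $\mathscr{B}=(\varphi_1,\dots,\varphi_n)^T$: $(M_{\mathscr B})_{k,l}=\int_0^1\varphi_l\varphi_k\,dx$, $(K_{\mathscr B})_{k,l}=\int_0^1\varphi_l'\varphi_k'\,dx$. Family $\mathfrak F_{p,i}$: the set of bases $\mathscr{B}_{p,i}$ of $\mathbb{S}_{p,i}$ such that (1)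 $\mathscr{B}_{p,i}=A_{\mathscr{B}_{p,i}}\mathscr{B}_{p,\boldsymbol\tau_{p,i}}$ with $A_{\mathscr{B}_{p,i}}$ block diagonal of the form $\mathrm{diag}(A_{11},I_{r_i\times r_i},A_{33})$, $A_{11}\in\mathbb{R}^{d_{1,i}\times d_{2,i}}$, $A_{33}\in\mathbb{R}^{d_{3,i}\times d_{4,i}}$, $r_i=n-d_{1,i}-d_{3,i}$, where for $p$ odd: $i=0$: $d_{1,0}=d_{3,0}=\lfloor p/2\rfloor$, $d_{2,0}=d_{4,0}=p$; $i=1$: $d_{1,1}=d_{3,1}=\lceil p/2\rceil$, $d_{2,1}=d_{4,1}=p+1$; $i=2$: $d_{1,2}=\lfloor p/2\rfloor$, $d_{3,2}=\lceil p/2\rceil$, $d_{2,2}=p$, $d_{4,2}=p+1$; for $p$ even: $i=0$: $d_{1,0}=d_{3,0}=p/2$, $d_{2,0}=d_{4,0}=p+1$; $i=1$: $d_{1,1}=d_{3,1}=p/2$, $d_{2,1}=d_{4,1}=p$; $i=2$: $d_{1,2}=d_{3,2}=p/2$, $d_{2,2}=p+1$, $d_{4,2}=p$; (2) $M_{\mathscr{B}_{p,i}}K_{\mathscr{B}_{p,i}}-K_{\mathscr{B}_{p,i}}M_{\mathscr{B}_{p,i}}=0$. The matrix $A_{\mathscr{E}_{p,i}}$ with $\mathscr{E}_{p,i}=A_{\mathscr{E}_{p,i}}\mathscr{B}_{p,\boldsymbol\tau_{p,i}}$ also has the block form in (1), with full-rank blocks $A_{11}$, $A_{33}$. Outlier-free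 basis. For $r=0,1$ and $\theta\in[0,\pi]$ let $g_p^r(\theta)=(-1)^r\mathcal N_{2p+1}^{(2r)}(p+1)+2(-1)^r\sum_{k=1}^p\mathcal N_{2p+1}^{(2r)}(p+1-k)\cos(k\theta)$, where $\mathcal N^{(2r)}_{2p+1}$ is the $2r$-th derivative. A basis $\mathscr B$ of $\mathbb{S}_{p,i}$ is called outlier-free if all eigenvalues of $M_{\mathscr B}$ and $K_{\mathscr B}$ are known samples, up to scaling, of $g_p^0$ and $g_p^1$ respectively; explicitly, the eigenvalues (with multiplicity) of $M_{\mathscr B}$ are $\nu_i^{-1}g_p^0(\theta_{j,i})$ and those of $K_{\mathscr B}$ are $\nu_i\,g_p^1(\theta_{j,i})$, $j=1,\dots,n$, where $\nu_0=n+1$, $\theta_{j,0}=\frac{j\pi}{n+1}$; $\nu_1=n$, $\theta_{j,1}=\frac{(j-1)\pi}{n}$; $\nu_2=\frac{2n+1}{2}$, $\theta_{j,2}=\frac{(2j-1)\pi}{2n+1}$. It is a known earlier result that $\mathscr{E}_{p,i}$ is outlier-free in this sense for the values of $n$ considered. *)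

(* Defs.v *)
From HB Require Import structures.
From mathcomp Require Export all_boot all_order all_algebra.
From mathcomp Require Export all_classical all_reals all_analysis.
Export Order.TTheory GRing.Theory Num.Theory.
Export numFieldNormedType.Exports.

Set Implicit Arguments.
Unset Strict Implicit.
Unset Printing Implicit Defensive.

Local Open Scope classical_set_scope.
Local Open Scope ring_scope.

(* A function on [0,1] is a total function R -> R of which only the values on
   [0,1] matter: every notion below (derivatives, smoothness, spline spaces,
   bases, integrals) depends on those values only. *)

Section Calculus01.
Context {R : realType}.
Implicit Types (f : R -> R) (x : R) (k : nat).

Definition quot01 f x : set_system R :=
  (fun y => (f y - f x) / (y - x)) @ within `[0, 1] x^'.

(* Derivative of the restriction of f to [0,1]: two-sided at interior points,
   one-sided at 0 and 1. It has an unspecified value where the limit does not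
   exist (for splines, at most at the knots). *)
Definition D01 f : R -> R := fun x => lim (quot01 f x).

Definition D01n k f : R -> R := iter k D01 f.

Definition C01 k f : Prop :=
  (forall j, (j < k)%N -> forall x, x \in `[0, 1] -> cvg (quot01 (D01n j f) x))
  /\ {within `[0, 1], continuous (D01n k f)}.

End Calculus01.

Section Splines.
Context {R : realType}.
Variables (p m : nat) (tau : nat -> R).

(* The breakpoints 0 = tau 0 < ... < tau m = 1 are indexed from 0. *)
Definition spline (s : R -> R) : Prop :=
  C01 p.-1 s /\
  forall k, (k < m)%N -> exists P : {poly R},
    (size P <= p.+1)%N /\ forall x, x \in `[tau k, tau k.+1] -> s x = P.[x].

(* Open knot sequence, indexed from 0: both subtractions are truncated, so
   tau 0 occurs for j = 0..p and tau m for j = m+p..m+2p. *)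
Definition open_knot (j : nat) : R := tau (minn (j - p) m).

(* Cox--de Boor recursion; 0/0 = 0 since 0^-1 = 0. The last nondegenerate knot
   interval is closed at 1, so that the B-splines sum to 1 on all of [0,1]. *)
Fixpoint bspline (xi : nat -> R) (d j : nat) (x : R) : R :=
  match d with
  | 0 =>
      if (xi j <= x < xi j.+1) || [&& xi j < xi j.+1, xi j.+1 == 1 & x == 1]
      then 1 else 0
  | d'.+1 =>
      (x - xi j) / (xi (j + d)%N - xi j) * bspline xi d' j x
      + (xi (j + d).+1 - x) / (xi (j + d).+1 - xi j.+1) * bspline xi d' j.+1 x
  end.

Definition open_bspline (j : 'I_(m + p)) : R -> R := bspline open_knot p j.

End Splines.

Section Cardinal.
Context {R : realType}.

Fixpoint cardB (p : nat) (x : R) : R :=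
  match p with
  | 0 => if 0 <= x < 1 then 1 else 0
  | q.+1 => x / p%:R * cardB q x + (p.+1%:R - x) / p%:R * cardB q (x - 1)
  end.

Definition cardBt (t : int) (p : nat) (x : R) : R := cardB p (x - t%:~R).

Definition gsym (p r : nat) (theta : R) : R :=
  let N2r := derive1n (2 * r) (cardB (2 * p).+1) in
  (-1) ^+ r * N2r p.+1%:R
  + 2 * (-1) ^+ r * \sum_(1 <= k < p.+1) N2r (p.+1%:R - k%:R) * cos (k%:R * theta).

End Cardinal.

(* The index i of the space is 0, 1, or 2 (the default branch of each match). *)

Section OptimalSpaces.
Context {R : realType}.
Variables (p i n : nat).

(* The partition tau_{p,i} has n_int + 1 points. *)
Definition n_int : nat :=
  match i with
  | 0 => if odd p then n.+1 else n.+2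
  | 1 => if odd p then n.+1 else n
  | _ => n.+1
  end.

Definition inner_break (k : nat) : R :=
  match i with
  | 0 => if odd p then k%:R / n.+1%:R else (k%:R - 2^-1) / n.+1%:R
  | 1 => if odd p then (k%:R - 2^-1) / n%:R else k%:R / n%:R
  | _ => if odd p then (2 * k)%:R / (2 * n).+1%:R
         else (2 * k%:R - 1) / (2 * n).+1%:R
  end.

Definition break (k : nat) : R :=
  if k == 0%N then 0 else if (k < n_int)%N then inner_break k else 1.

Definition bc_left (a : nat) : bool := if i == 1%N then odd a else ~~ odd a.
Definition bc_right (a : nat) : bool := if i == 0%N then ~~ odd a else odd a.

Definition optimal_space : set (R -> R) := [set s |
  [/\ spline p n_int break s,
      forall a, (a <= p)%N -> bc_left a -> D01n a s 0 = 0 &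
      forall a, (a <= p)%N -> bc_right a -> D01n a s 1 = 0]].

Definition ref_var (x : R) : R :=
  match i with
  | 0 => n.+1%:R * x + (if odd p then 0 else 2^-1)
  | 1 => n%:R * x + (if odd p then 2^-1 else 0)
  | _ => (2 * n).+1%:R / 2 * x + (if odd p then 0 else 2^-1)
  end.

(* j ranges over 1..n; the shifts of the cardinal B-spline are integers, and
   - q = p - h and n + q = n - (p - h) in the conditions on j. *)
Definition ref_fun (j : nat) (x : R) : R :=
  let h := p./2 in
  let q : int := h%:Z - p%:Z in
  let N (t : int) := cardBt t p (ref_var x) in
  match i with
  | 0 =>
      if (j <= h)%N then - N (q - j%:Z) + N (q + j%:Z)
      else if (j <= n - h)%N then N (q + j%:Z)
      else N (q + j%:Z) - N (q + (2 * n.+1)%:Z - j%:Z)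
  | 1 =>
      if (j <= p - h)%N then N (- h%:Z - j%:Z) + N (- h%:Z + j%:Z - 1)
      else if (j <= n - (p - h))%N then N (- h%:Z + j%:Z - 1)
      else N (- h%:Z + j%:Z - 1) + N (- h%:Z + (2 * n)%:Z - j%:Z)
  | _ =>
      if (j <= h)%N then N (q + j%:Z) - N (q - j%:Z)
      else if (j <= n - (p - h))%N then N (q + j%:Z)
      else N (q + j%:Z) + N (q + (2 * n).+1%:Z - j%:Z)
  end.

Definition ref_basis (k : 'I_n) : R -> R := ref_fun k.+1.

End OptimalSpaces.

Section Bases.
Context {R : realType}.

Definition is_basis (S : set (R -> R)) n (b : 'I_n -> R -> R) : Prop :=
  [/\ forall k, S (b k),
      forall c : 'I_n -> R,
        (forall x, x \in `[0, 1] -> \sum_k c k * b k x = 0) -> forall k, c k = 0 &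
      forall s, S s -> exists c : 'I_n -> R,
        forall x, x \in `[0, 1] -> s x = \sum_k c k * b k x].

Definition mass n (b : 'I_n -> R -> R) : 'M[R]_n :=
  \matrix_(k, l) \int[lebesgue_measure]_(x in `[0, 1]) (b l x * b k x).

Definition stiffness n (b : 'I_n -> R -> R) : 'M[R]_n :=
  \matrix_(k, l) \int[lebesgue_measure]_(x in `[0, 1]) (D01 (b l) x * D01 (b k) x).

End Bases.

Section Family.
Context {R : realType}.
Variables (p i n : nat).

Definition d1 : nat :=
  match i with 0 => p./2 | 1 => uphalf p | _ => p./2 end.
Definition d2 : nat :=
  match i with
  | 0 => if odd p then p else p.+1
  | 1 => if odd p then p.+1 else p
  | _ => if odd p then p else p.+1
  end.
Definition d3 : nat :=
  match i with 0 => p./2 | 1 => uphalf p | _ => uphalf p end.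
Definition d4 : nat :=
  match i with
  | 0 => if odd p then p else p.+1
  | 1 => if odd p then p.+1 else p
  | _ => if odd p then p.+1 else p
  end.
Definition r_id : nat := (n - d1 - d3)%N.

(* The equations between dimensions in e hold as soon as d1 + d3 <= n. *)
Definition block_form (A : 'M[R]_(n, n_int p i n + p)) : Prop :=
  exists (A11 : 'M[R]_(d1, d2)) (A33 : 'M[R]_(d3, d4))
         (e : (d1 + (r_id + d3) = n)%N * (d2 + (r_id + d4) = n_int p i n + p)%N),
    A = castmx e (block_mx A11 0 0 (block_mx 1%:M 0 0 A33)).

Definition family (b : 'I_n -> R -> R) : Prop :=
  [/\ is_basis (optimal_space p i n) b,
      exists A : 'M[R]_(n, n_int p i n + p), block_form A /\
        forall k x, x \in `[0, 1] ->
          b k x = \sum_j A k j * open_bspline (break p i n) j x &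
      mass b *m stiffness b - stiffness b *m mass b = 0].

End Family.

Section Spectra.
Context {R : realType}.

(* Spectrum as a multiset: the algebraic multiplicity of a as an eigenvalue of
   A, 0 if a is not an eigenvalue. It is used for real symmetric matrices only,
   which have no nonreal eigenvalue. *)
Definition spectrum n (A : 'M[R]_n) (a : R) : nat := mup a (char_poly A).

Definition multiset_of n (v : 'I_n -> R) (a : R) : nat := #|[pred j | v j == a]|.

Variables (p i n : nat).

Definition nu : R :=
  match i with 0 => n.+1%:R | 1 => n%:R | _ => (2 * n).+1%:R / 2 end.

(* k : 'I_n stands for j = k + 1. *)
Definition theta (k : 'I_n) : R :=
  match i with
  | 0 => k.+1%:R * pi / n.+1%:R
  | 1 => k%:R * pi / n%:R
  | _ => (2 * k).+1%:R * pi / (2 * n).+1%:R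
  end.

Definition outlier_free (b : 'I_n -> R -> R) : Prop :=
  [/\ is_basis (optimal_space p i n) b,
      spectrum (mass b) =1 multiset_of (fun k => nu^-1 * gsym p 0 (theta k)) &
      spectrum (stiffness b) =1 multiset_of (fun k => nu * gsym p 1 (theta k))].

End Spectra.

Definition f_bound (p i : nat) : nat :=
  match i with
  | 0 => maxn p.+1 (3 * p./2)
  | 1 => maxn (2 * p - p./2) (2 * p - 2 * p./2 + 1)
  | _ => maxn p.+1 (p + 2 * uphalf p)
  end.

(* Main.v *)
(** Folding cardinal B-splines by the reflections at 0 and 1 that belong to the
    boundary conditions gives the reference basis E. Sampled sines or cosines have
    the same symmetries, hence they are eigenvectors of the mass and stiffness
    matrices of E, with eigenvalues given by the symbols g^0 and g^1 at the
    theta_j; they are also the eigenvectors of a tridiagonal matrix T with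
    off-diagonal entries 1.

    Let E = C B for a basis B of the family. The block form and the linear
    independence of p + 1 truncated powers show that C is block diagonal with a
    nonempty identity block in the middle. The quotient g^1 / g^0 is strictly
    increasing on [0, pi], so M_B K_B = K_B M_B forces C C^T to commute with T.
    The shape of T and the identity block then give C C^T = 1, so that M_E and
    K_E are orthogonally similar to M_B and K_B.

    For the quotient: g^0 and g^1 / 4 are forms in cos(theta/2)^2 and
    sin(theta/2)^2 whose coefficients are those of the polynomials S_(2p+2) and
    S_(2p), where S_1 = x and S_(m+1) = (1 + x^2) S_m' / m. The quotients of the
    coefficients of S_(m+2) and S_m are monotone, and the recursion preserves this. *)

From HB Require Import structures.
Require Import Defs.
From mathcomp Require Import measurable_realfun ring lra zify.

Set Implicit Arguments.
Unset Strict Implicit.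
Unset Printing Implicit Defensive.

Local Open Scope classical_set_scope.
Local Open Scope ring_scope.

(** Expressing one basis by another changes a Gram matrix by a congruence, which in general
    preserves no spectrum; only an orthogonal change of basis does, and nothing in the block form
    says that it is one. The commutation hypothesis has to supply this. A matrix commuting with [T],
    whose eigenvalues are simple, is a polynomial in [T], so few entries decide it: one identity row
    and the block shape suffice. In the coordinate where the interior knots are integers, the ends
    of the domain are integers or half-integers, depending on [i] and on the parity of [p]. Cells of
    length 1/2, and two booleans [e0], [e1] that tell at which ends the reflection is odd, treat all
    six cases at once. The polynomials S_m come from the identity, for m at least 2, that S_m(cot
    phi) is the sum over all integers k of (phi + k pi)^(-m); differentiating it gives their
    recursion. For even m, sin(phi)^m times this sum is, by Poisson summation, the symbol made of
    the values of the B-spline of degree m - 1 at the integers. The recursion replaces the series,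
    so no Fourier analysis is needed. *)

Local Notation hE :=
  (hornerD, hornerN, hornerM, hornerZ, hornerC, hornerX, horner0).

(** * Polynomial identities *)

Lemma poly_eq_oo (R : realType) (P Q : {poly R}) (a b : R) : a < b ->
  (forall x, a < x < b -> P.[x] = Q.[x]) -> P = Q.
Proof.
move=> ab PQ; apply/eqP; rewrite -subr_eq0; apply/eqP.
set N := (size (P - Q)).+1.
pose s := [seq a + (b - a) * (i.+1%:R / N.+1%:R) | i <- iota 0 N].
apply: (@roots_geq_poly_eq0 _ _ s).
- apply/allP => x /mapP[i]; rewrite mem_iota /= => iN ->.
  rewrite rootE hornerD hornerN subr_eq0 PQ ?eqxx //.
  have : 0 < (i.+1%:R / N.+1%:R : R) by rewrite divr_gt0 ?ltr0n.
  have : (i.+1%:R / N.+1%:R : R) < 1 by rewrite ltr_pdivrMr ?ltr0n // mul1r ltr_nat.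
  move: (_ / _) => f f1 f0; have ba : 0 < b - a by rewrite subr_gt0.
  by rewrite ltrDl mulr_gt0 //= -ltrBrDl -[ltRHS]mulr1 ltr_pM2l.
- rewrite map_inj_uniq ?iota_uniq // => i j /addrI /mulfI.
  rewrite subr_eq0 gt_eqF // => /(_ isT).
  have nz : (N.+1%:R^-1 : R) != 0 by rewrite invr_neq0 // pnatr_eq0.
  by move=> /(mulIf nz) /eqP; rewrite eqr_nat => /eqP [].
- by rewrite size_map size_iota /N.
Qed.

Lemma poly_ext (R : realType) (P Q : {poly R}) :
  (forall x, P.[x] = Q.[x]) -> P = Q.
Proof. by move=> PQ; apply: (@poly_eq_oo _ _ _ 0 1) => // x _. Qed.

Lemma intr_sub2 (R : realType) (k : int) : (k - 2)%:~R = k%:~R - 2 :> R.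
Proof. by rewrite intrB. Qed.

(** * Cardinal B-splines on half cells *)

Section HalfCells.
Context {R : realType}.
Implicit Types (k : int) (t : R) (d : nat) (P : {poly R}).

(** The cardinal recursion on one cell, where the translation by 1 becomes [k - 2]. Cells have half
    the knot distance because the reflections that fold the basis may be centred at
    half-integers. *)
Fixpoint hcell_rec d k : {poly R} :=
  if d is d'.+1 then
    d%:R^-1 *: ((2^-1 *: ('X + k%:~R%:P)) * hcell_rec d' k
      + (d.+1%:R%:P - 2^-1 *: ('X + k%:~R%:P)) * hcell_rec d' (k - 2))
  else (if (0 <= k) && (k < 2) then 1 else 0).

(* Cardinal B-spline on the half cell [k/2, (k+1)/2], in the coordinate t of y = (k + t) / 2. *)
Definition hcell : nat -> int -> {poly R} := locked hcell_rec.

Lemma hcellS d k : hcell d.+1 k =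
  d.+1%:R^-1 *: ((2^-1 *: ('X + k%:~R%:P)) * hcell d k
      + (d.+2%:R%:P - 2^-1 *: ('X + k%:~R%:P)) * hcell d (k - 2)).
Proof. by rewrite /hcell -lock. Qed.

Lemma hcell0 k : hcell 0 k = if (0 <= k) && (k < 2) then 1 else 0.
Proof. by rewrite /hcell -lock. Qed.

Lemma horner_hcellS d k t : (hcell d.+1 k).[t] =
  d.+1%:R^-1 * ((2^-1 * (t + k%:~R)) * (hcell d k).[t]
      + (d.+2%:R - 2^-1 * (t + k%:~R)) * (hcell d (k - 2)).[t]).
Proof. by rewrite hcellS !hE. Qed.

Lemma hcell_out d k : (k < 0) || (2 * d.+1%:Z <= k) -> hcell d k = 0.
Proof.
elim: d k => [|d IH] k kout; first by rewrite hcell0 ifF //; lia.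
by rewrite hcellS !IH ?mulr0 ?addr0 ?scaler0 //; lia.
Qed.

Lemma size_hcell d k : (size (hcell d k) <= d.+1)%N.
Proof.
elim: d k => [|d IH] k; first by rewrite hcell0; case: ifP; rewrite ?size_poly1 ?size_poly0.
have lin (c : R) P : (size P <= d.+1)%N -> (size (('X + c%:P) * P)%R <= d.+2)%N.
  move=> sP; apply: (leq_trans (size_polyMleq _ _)).
  by rewrite size_XaddC /= ltnS.
rewrite hcellS; apply: (leq_trans (size_scale_leq _ _)).
apply: (leq_trans (size_polyD _ _)); rewrite geq_max; apply/andP; split.
  by rewrite -scalerAl; apply: (leq_trans (size_scale_leq _ _)); exact: lin.
have -> : (d.+2%:R%:P - 2^-1 *: ('X + k%:~R%:P) : {poly R}) =
    (- 2^-1) *: ('X + (k%:~R - 2 * d.+2%:R)%:P).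
  by apply: poly_ext => x; rewrite !hE; field.
by rewrite -scalerAl; apply: (leq_trans (size_scale_leq _ _)); exact: lin.
Qed.

Lemma cardB_hcell d k t : 0 <= t < 1 ->
  cardB d ((t + k%:~R) / 2) = (hcell d k).[t].
Proof.
move=> t01; elim: d k => [|d IH] k.
  rewrite /= hcell0; have -> : (0 <= (t + k%:~R) / 2 < 1) = (0 <= k) && (k < 2).
    case: (ltP k 0) => k0 /=.
      have : (k%:~R : R) <= -1 by rewrite -[-1]/((-1)%:~R) ler_int; lia.
      lra.
    have h0 : (0 : R) <= k%:~R by rewrite ler0z.
    case: (ltP k 2) => k2.
      have h1 : (k%:~R : R) <= 1 by rewrite -[1]/(1%:~R) ler_int; lia.
      lra.
    have h1 : (2 : R) <= k%:~R by rewrite -[2]/(2%:~R) ler_int.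
    lra.
  by case: ifP; rewrite !hE.
rewrite horner_hcellS -!IH /=.
have -> : (t + (k - 2)%:~R) / 2 = (t + k%:~R) / 2 - 1 :> R.
  by rewrite intr_sub2; field.
by field; rewrite nat1r pnatr_eq0.
Qed.

(** The factor [2^-1] in the rule [N' = N(y) - N(y - 1)] comes from [y = (k + t) / 2]. As an
    identity of polynomials the rule also covers degree 1, whose B-spline is not differentiable at
    the knots. *)
Lemma deriv_hcell d k : (hcell d.+1 k)^`() = 2^-1 *: (hcell d k - hcell d (k - 2)).
Proof.
have dZX c : (2^-1 *: ('X + c%:P) : {poly R})^`() = (2^-1)%:P.
  by rewrite derivZ derivD derivX derivC addr0 alg_polyC.
elim: d k => [|d IH] k; rewrite hcellS derivZ derivD !derivM derivB derivC !dZX.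
  apply: poly_ext => x; rewrite !hcell0.
  by case: ifP => _; case: ifP => _; rewrite -?polyC1 -?polyC0 ?derivC !hE; field.
apply: poly_ext => x; rewrite !IH !hE !horner_hcellS.
rewrite !intr_sub2; field.
by rewrite !nat1r -?natrD !pnatr_eq0.
Qed.

(** The recursion preserves continuity, but the induction starts from degree 1, since degree 0
    jumps; there the finitely many relevant cells are checked one by one. *)
Lemma hcell_cont d k : (hcell d.+1 k).[1] = (hcell d.+1 (k + 1)).[0].
Proof.
elim: d k => [|d IH] k.
  rewrite !horner_hcellS.
  case: (ltP k (-1)) => k1; first by rewrite !hcell_out ?hE ?mulr0 //; lia.
  case: (ltP 3 k) => k2; first by rewrite !hcell_out ?hE ?mulr0 //; lia.
  have : k \in [:: -1; 0; 1; 2; 3] by rewrite !inE; lia.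
  by rewrite !inE => /or4P[/eqP->|/eqP->|/eqP->|/orP[/eqP->|/eqP->]];
    rewrite !hcell0 /= -?polyC1 ?hE; lra.
rewrite horner_hcellS [RHS]horner_hcellS !IH.
by rewrite (_ : k - 2 + 1 = k + 1 - 2) ?intrD ?add0r 1?[1 + _]addrC //; lia.
Qed.

(** The B-spline is symmetric about [(d+1)/2], which sends cell [k] to [2d + 1 - k] and [t] to
    [1 - t]. For the pieces this holds in degree 0 as well, where half-open intervals spoil it
    pointwise. *)
Lemma hcell_refl d k : hcell d k \Po (1 - 'X) = hcell d (2 * d%:Z + 1 - k).
Proof.
elim: d k => [|d IH] k.
  rewrite !hcell0; have -> : (0 <= 2 * 0 + 1 - k) && (2 * 0 + 1 - k < 2) = (0 <= k) && (k < 2) by lia.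
  by case: ifP; rewrite ?comp_polyC ?comp_poly0 -?polyC1 ?comp_polyC.
have IHx t e : (hcell d e).[1 - t] = (hcell d (2 * d%:Z + 1 - e)).[t].
  by rewrite -IH horner_comp !hE.
apply: poly_ext => t; rewrite horner_comp !horner_hcellS !hE !IHx.
have -> : 2 * d%:Z + 1 - (k - 2) = 2 * d.+1%:Z + 1 - k by lia.
have -> : 2 * d.+1%:Z + 1 - k - 2 = 2 * d%:Z + 1 - k by lia.
rewrite (_ : (2 * d.+1%:Z + 1 - k)%:~R = 2 * d.+1%:R + 1 - k%:~R :> R).
  by field; rewrite nat1r pnatr_eq0.
by rewrite intrB intrD intrM.
Qed.

End HalfCells.

(** * Correlations of cardinal B-splines *)

Section UnitIntegral.
Context {R : realType}.
Implicit Types (P Q : {poly R}).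

Definition primitive P : {poly R} := \poly_(i < (size P).+1) (P`_i.-1 / i%:R).

Lemma coef_primitive P i : (primitive P)`_i = P`_i.-1 / i%:R.
Proof.
rewrite coef_poly; case: i => [|i]; first by rewrite /= invr0 mulr0.
rewrite ltnS; case: ltnP => //= si.
by rewrite nth_default ?mul0r.
Qed.

Lemma deriv_primitive P : (primitive P)^`() = P.
Proof.
apply/polyP => i; rewrite coef_deriv coef_primitive /= -[_ *+ _]mulr_natr divfK //.
Qed.

(** The integral over [0,1], defined through a primitive so that correlations are pure algebra;
    [integral_cell] is the link to the Lebesgue integral. *)
Definition unit_int : {poly R} -> R :=
  locked (fun P => (primitive P).[1] - (primitive P).[0]).

Lemma unit_int_deriv Q : unit_int Q^`() = Q.[1] - Q.[0].
Proof.
suff H x : Q.[x] = (primitive Q^`()).[x] + Q`_0 by rewrite /unit_int -lock !H; ring.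
rewrite -(hornerC Q`_0 x) -hornerD; congr horner.
apply/polyP => i; rewrite coefD coef_primitive coefC coef_deriv.
case: i => [|i] /=; first by rewrite invr0 mulr0 add0r.
by rewrite addr0 -[_ *+ _]mulr_natr mulfK // pnatr_eq0.
Qed.

Lemma unit_int_is_linear : linear (unit_int : {poly R} -> R^o).
Proof.
move=> a P Q; rewrite -[P]deriv_primitive -[Q]deriv_primitive.
rewrite -derivZ -derivD !unit_int_deriv !hE /GRing.scale /=; ring.
Qed.
HB.instance Definition _ := GRing.isLinear.Build R {poly R} R^o _ unit_int unit_int_is_linear.

Lemma unit_int0 : unit_int 0 = 0.
Proof. exact: linear0. Qed.
Lemma unit_intD P Q : unit_int (P + Q) = unit_int P + unit_int Q.
Proof. exact: linearD. Qed.
Lemma unit_intB P Q : unit_int (P - Q) = unit_int P - unit_int Q.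
Proof. exact: linearB. Qed.
Lemma unit_intZ a P : unit_int (a *: P) = a * unit_int P.
Proof. exact: linearZ. Qed.
Lemma unit_int_sum I (r : seq I) (Pr : pred I) (F : I -> {poly R}) :
  unit_int (\sum_(i <- r | Pr i) F i) = \sum_(i <- r | Pr i) unit_int (F i).
Proof. exact: linear_sum. Qed.

Lemma unit_int_refl P : unit_int (P \Po (1 - 'X)) = unit_int P.
Proof.
rewrite -[P]deriv_primitive; set Q := primitive P.
have -> : Q^`() \Po (1 - 'X) = (- (Q \Po (1 - 'X)))^`().
  rewrite derivN deriv_comp derivB derivX -polyC1 derivC sub0r.
  by rewrite mulrN polyC1 mulr1 opprK.
by rewrite !unit_int_deriv !hE !horner_comp !hE subrr subr0 opprK addrC.
Qed.

End UnitIntegral.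

Lemma int_succ_inv (T : Type) (f : int -> T) :
  (forall u, f (u + 1) = f u) -> forall u w, f u = f w.
Proof.
move=> fS; suff f0 u : f u = f 0 by move=> u w; rewrite (f0 u) (f0 w).
elim/int_rect: u => [//|n IH|n IH]; first by rewrite -IH -[RHS]fS; congr f; lia.
by rewrite -IH -[LHS]fS; congr f; lia.
Qed.

Section Correlation.
Context {R : realType}.
Implicit Types (d e : nat) (u k : int).
Local Notation hcell := (@hcell R).
Local Notation L := (@unit_int R).

(** The integral over the line of [N_d(y) N_e(y + u)]: [2^-1] is the length of a cell, and the cells
    off the support of [N_d] are left out. *)
Definition corr d e u : R :=
  2^-1 * \sum_(0 <= k < 2 * d.+1) L (hcell d k%:Z * hcell e (k%:Z + 2 * u)).

Lemma corr_widen d e u K : (2 * d.+1 <= K)%N ->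
  \sum_(0 <= k < K) L (hcell d k%:Z * hcell e (k%:Z + 2 * u)) = 2 * corr d e u.
Proof.
move=> dK; rewrite /corr mulrA divff ?mul1r ?pnatr_eq0 //.
rewrite (big_cat_nat (n := 2 * d.+1)) //= addrC [X in X + _]big_nat_cond big1 ?add0r // => k.
by move=> /andP[/andP[k1 k2] _]; rewrite hcell_out ?mul0r ?unit_int0 //; lia.
Qed.

Lemma corr_shift d e u K : (2 * d.+2 <= K)%N ->
  \sum_(0 <= k < K) L (hcell d (k%:Z - 2) * hcell e (k%:Z + 2 * u)) = 2 * corr d e (u + 1).
Proof.
case: K => [|[|K]] dK; [lia|lia|].
rewrite big_nat_recl // big_nat_recl // [hcell d (0%Z - 2)]hcell_out // [hcell d (1%Z - 2)]hcell_out //.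
rewrite !mul0r unit_int0 !add0r.
rewrite -(@corr_widen _ _ _ K); last by lia.
by apply: eq_bigr => k _; congr (L (hcell _ _ * hcell _ _)); lia.
Qed.

Lemma corr_out d e u : (e.+1%:Z <= u) || (u <= - d.+1%:Z) -> corr d e u = 0.
Proof.
move=> H; rewrite /corr big_nat_cond big1 ?mulr0 // => k /andP[/andP[_ kd] _].
by rewrite [hcell e _]hcell_out ?mulr0 ?unit_int0 //; lia.
Qed.

(* The integral of the derivative of N_(d+1)(y) N_(e+1)(y + w) vanishes, and this
   says that the difference of the two sides does not depend on u; it is 0 for
   large u. *)
Lemma corr_swap d e u : corr d e.+1 u = corr d.+1 e (u - 1).
Proof.
pose h u := corr d e.+1 u - corr d.+1 e (u - 1).
suff hS w : h (w + 1) = h w.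
  apply/eqP; rewrite -subr_eq0 -/(h u) (int_succ_inv hS u (e + 3)%:Z) /h.
  by rewrite !corr_out ?subrr //; lia.
have : \sum_(0 <= k < 2 * d.+2) L (hcell d.+1 k%:Z * hcell e.+1 (k%:Z + 2 * w))^`() = 0.
  rewrite (eq_bigr (fun k : nat => (hcell d.+1 (k.+1)%:Z * hcell e.+1 ((k.+1)%:Z + 2 * w)).[0]
     - (hcell d.+1 k%:Z * hcell e.+1 (k%:Z + 2 * w)).[0])).
    rewrite (telescope_sumr (fun k : nat => (hcell d.+1 k%:Z * hcell e.+1 (k%:Z + 2 * w)).[0])) //.
    rewrite hcell_out ?mul0r ?horner0 ?sub0r; last by lia.
    by rewrite hornerM (_ : 0%:Z = -1 + 1) // -hcell_cont hcell_out ?hE ?mul0r ?oppr0.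
  move=> k _; rewrite unit_int_deriv !hornerM !hcell_cont.
  by congr (_.[_] * _.[_] - _); congr (hcell _ _); lia.
under eq_bigr => k _.
  rewrite derivM !deriv_hcell -scalerAl -scalerAr -scalerDr unit_intZ.
  rewrite mulrBl mulrBr unit_intD !unit_intB.
  rewrite (_ : k%:Z + 2 * w - 2 = k%:Z + 2 * (w - 1)); last by lia.
  over.
rewrite -mulr_sumr big_split /= !sumrB corr_shift // !corr_widen //; last by lia.
rewrite /h addrK; lra.
Qed.

(** This is [N_(e+1)(u+1)] as the integral of [N_e] over [[u, u+1]]. Both sides have the same
    increments in [u] and vanish for very negative [u]. *)
Lemma corr0 e u : corr 0 e u = (hcell e.+1 (2 * u + 2)).[0].
Proof.
pose g u := (hcell e.+1 (2 * u + 2)).[0] - corr 0 e u.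
have c0 w : corr 0 e w = 2^-1 * (L (hcell e (2 * w)) + L (hcell e (2 * w + 1))).
  rewrite /corr !big_nat_recl // big_geq // addr0 !hcell0 /= !mul1r.
  by congr (_ * (L (hcell _ _) + L (hcell _ _))); lia.
have gS w : g (w + 1) = g w.
  rewrite /g !c0.
  have i1 k : (hcell e.+1 (k + 1)).[0] = (hcell e.+1 k).[0] + 2^-1 * (L (hcell e k) - L (hcell e (k - 2))).
    by rewrite -hcell_cont -unit_intB -unit_intZ -deriv_hcell unit_int_deriv; ring.
  rewrite (_ : 2 * (w + 1) + 2 = 2 * w + 3 + 1) ?i1; last by lia.
  rewrite (_ : 2 * w + 3 = 2 * w + 2 + 1) ?i1; last by lia.
  rewrite (_ : 2 * w + 2 + 1 - 2 = 2 * w + 1); last by lia.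
  rewrite (_ : 2 * w + 2 - 2 = 2 * w); last by lia.
  rewrite (_ : 2 * (w + 1) + 1 = 2 * w + 2 + 1); last by lia.
  rewrite (_ : 2 * (w + 1) = 2 * w + 2); last by lia.
  ring.
apply/esym/eqP; rewrite -subr_eq0 -/(g u) (int_succ_inv gS u (- 3)) /g.
by rewrite hcell_out ?corr_out ?horner0 ?subrr.
Qed.

(** The convolution of two B-splines is a B-spline: [corr_swap] moves the degree of the first factor
    to the second one unit at a time, down to the characteristic function treated in [corr0]. *)
Lemma corrE d e u : corr d e u = cardB (d + e).+1 (u%:~R + d.+1%:R).
Proof.
rewrite (_ : u%:~R + d.+1%:R = ((0 + (2 * (u + d%:Z) + 2)%:~R) / 2)); last first.
  by rewrite !intrD !intrM intrD /= -natr1; field.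
rewrite cardB_hcell ?lexx ?ltr01 // -corr0.
elim: d e u => [|d IH] e u; first by rewrite addr0.
rewrite -[u](addrK 1) -corr_swap IH.
by rewrite addSnnS; congr corr; lia.
Qed.

End Correlation.

(** * Gram matrices of folded B-splines *)

Section WindowSums.
Context {V : zmodType}.
Implicit Types (g : int -> V) (a b : int) (N M : nat).

(** A window is given by its start and its length, so that translations and reflections of the index
    only move the start. *)
Definition wsum g a N : V := \sum_(0 <= i < N) g (a + i%:Z).

Lemma wsum_cat g a N M : wsum g a (N + M) = wsum g a N + wsum g (a + N%:Z) M.
Proof.
rewrite /wsum (big_cat_nat (n := N)) ?leq_addr //=; congr (_ + _).
rewrite -{1}[N]add0n [(N + M)%N]addnC big_addn addnK.
by apply: eq_bigr => i _; congr g; lia.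
Qed.

Lemma eq_wsum g g' a N :
  (forall k, a <= k -> k < a + N%:Z -> g k = g' k) -> wsum g a N = wsum g' a N.
Proof. by move=> gg'; apply: eq_big_nat => i iN; apply: gg'; lia. Qed.

Lemma wsum_0 g a N : (forall k, a <= k -> k < a + N%:Z -> g k = 0) -> wsum g a N = 0.
Proof. by move=> g0; rewrite (@eq_wsum _ (fun=> 0)) // /wsum big1. Qed.

Lemma wsum_supp g a N b M : (forall k, ~~ (b <= k < b + M%:Z) -> g k = 0) ->
  a <= b -> b + M%:Z <= a + N%:Z -> wsum g a N = wsum g b M.
Proof.
move=> g0 ab MN.
have -> : N = (absz (b - a)%R + (M + absz (a + N%:Z - b - M%:Z)%R))%N by lia.
rewrite wsum_cat wsum_cat wsum_0 ?add0r; last by move=> k ? ?; apply: g0; lia.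
rewrite [X in _ + X]wsum_0 ?addr0; last by move=> k ? ?; apply: g0; lia.
by congr wsum; lia.
Qed.

Lemma wsum_rev g c a N :
  wsum (fun k => g (c - k)) a N = wsum g (c - a - N%:Z + 1) N.
Proof.
rewrite /wsum big_nat_rev; apply: eq_big_nat => i iN.
by congr g; lia.
Qed.

End WindowSums.

Section Unfolding.
Context {R : realType}.
Variables (p n : nat) (e0 e1 : bool) (ph : int -> {poly R}) (v : int -> R) (tau : R).
Hypothesis pn : (p < n)%N.
Hypothesis ph_out : forall k, ~~ (0 <= k < (2 * p.+1)%:Z) -> ph k = 0.
Hypothesis ph_refl : forall k, ph k \Po (1 - 'X) = tau *: ph (2 * p%:Z + 1 - k).
Hypothesis tau2 : tau * tau = 1.
Local Notation L := (@unit_int R).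
Local Notation s0 := ((-1) ^+ e0 : R).
Local Notation s1 := ((-1) ^+ e1 : R).
Local Notation A := (p.+2 - e0)%N.
Local Notation B := (p.+2 + 2 * n + e1)%N.
Hypothesis v0 : forall t, v ((1 - e0)%N%:Z - t) = s0 * v t.
Hypothesis v1 : forall t, v ((2 * n + 1 + e1)%:Z - t) = s1 * v t.

(* A B-spline, with support starting at j, minus or plus its mirror images at the
   two ends of the domain: e0, e1 tell at which end the functions are odd. The
   domain is [A, B] in units of half cells. *)
Definition fold_cell (f : int -> {poly R}) (j k : int) : {poly R} :=
  f (k - 2 * j) + s0 *: f (k - 2 * ((1 - e0)%N%:Z - j))
   + s1 *: f (k - 2 * ((2 * n + 1 + e1)%:Z - j)).

(** All shifts of [ph] summed with the weights [v]; the window consists of the [p+1] shifts whose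
    support contains the cell [k]. *)
Let F k : {poly R} := wsum (fun t => v t *: ph (k - 2 * t)) ((k %/ 2)%Z - p%:Z) p.+1.

Lemma fold_window_widen k a N : a <= (k %/ 2)%Z - p%:Z -> (k %/ 2)%Z + 1 <= a + N%:Z ->
  wsum (fun t => v t *: ph (k - 2 * t)) a N = F k.
Proof.
move=> ha hN; apply: wsum_supp => //; last by lia.
by move=> t ht; rewrite ph_out ?scaler0 //; lia.
Qed.

Lemma sign_sq (e : bool) : (-1) ^+ e * (-1) ^+ e = 1 :> R.
Proof. by case: e; rewrite /= ?expr0 ?expr1 ?mulr1 ?mulrNN ?mulr1. Qed.

(** [tau] is the sign that a piece takes under a reflection, 1 for B-splines and -1 for their
    derivatives. A symmetry of [v] about [c/2] becomes one of the sum about [(c+p+1)/2], since the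
    supports have length [p+1]. *)
Lemma fold_window_refl (c : int) (s : R) k : s * s = 1 -> (forall t, v (c - t) = s * v t) ->
  F (2 * (c + p%:Z) + 1 - k) = (s * tau) *: (F k \Po (1 - 'X)).
Proof.
move=> ss vc.
rewrite -(@fold_window_widen k ((k %/ 2)%Z - p%:Z - 1) p.+3); [|lia|lia].
rewrite /wsum linear_sum /= scaler_sumr.
under eq_bigr => i _.
  rewrite comp_polyZ ph_refl !scalerA.
  rewrite (_ : _ * _ * _ * _ = s * v ((k %/ 2)%Z - p%:Z - 1 + i%:Z)); last first.
    by rewrite -[RHS]mulr1 -tau2; ring.
  rewrite -vc.
  rewrite (_ : 2 * p%:Z + 1 - _ = 2 * (c + p%:Z) + 1 - k - 2 * (c - ((k %/ 2)%Z - p%:Z - 1 + i%:Z))); last by lia.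
  over.
rewrite -[RHS]/(wsum (fun t => (fun t => v t *: ph (2 * (c + p%:Z) + 1 - k - 2 * t)) (c - t)) _ p.+3).
by rewrite wsum_rev fold_window_widen //; lia.
Qed.

(* Since v has the symmetries of the ends, summing v against the folded functions
   on the domain amounts to summing the extended v against all shifts. *)
Lemma sum_fold_cell k : A%:Z <= k -> k < B%:Z ->
  \sum_(l < n) v (l.+1)%:Z *: fold_cell ph (l.+1)%:Z k = F k.
Proof.
move=> kA kB; pose h t := v t *: ph (k - 2 * t).
transitivity (wsum h 1 n + wsum h ((1 - e0)%N%:Z - n%:Z) n + wsum h ((n + 1 + e1)%:Z) n).
  rewrite (_ : (1 - e0)%N%:Z - n%:Z = (1 - e0)%N%:Z - 1 - n%:Z + 1); last by lia.
  rewrite (_ : (n + 1 + e1)%:Z = (2 * n + 1 + e1)%:Z - 1 - n%:Z + 1); last by lia.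
  rewrite -!wsum_rev /wsum -!big_split /= big_mkord; apply: eq_bigr => l _.
  rewrite /fold_cell !scalerDr /h (_ : 1 + l%:Z = l.+1%:Z); last by lia.
  by rewrite v0 v1 !scalerA ![_ * v _]mulrC.
(* An odd reflection fixes one index, at which [v] vanishes; it is the gap between the shifts and
   their mirror images. An even reflection leaves no gap. *)
have gap (e : bool) c : (forall t, v (c - t) = (-1) ^+ e * v t) -> e -> forall t, 2 * t = c -> v t = 0.
  move=> vc; case: e vc => // vc _ t tc.
  by have := vc t; rewrite -tc (_ : 2 * t - t = t); [rewrite expr1; lra|lia].
have h0 : wsum h (1 - e0)%N%:Z e0 = 0.
  apply: wsum_0 => t t0 t1; rewrite /h (gap _ _ v0) ?scale0r //; lia.
have h1 : wsum h (n + 1)%:Z e1 = 0.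
  apply: wsum_0 => t t0 t1; rewrite /h (gap _ _ v1) ?scale0r //; lia.
transitivity (wsum h ((1 - e0)%N%:Z - n%:Z) (n + e0 + n + e1 + n)); last first.
  by apply: fold_window_widen; lia.
rewrite !wsum_cat.
rewrite [X in _ = _ + X + _ + _ + _](_ : _ = 0) ?addr0; last first.
  by rewrite -h0; congr wsum; lia.
rewrite [X in _ = _ + _ + X + _](_ : _ = 0) ?addr0; last first.
  by rewrite -h1; congr wsum; lia.
rewrite [X in X + _ = _]addrC; congr (_ + wsum h _ _ + wsum h _ _); lia.
Qed.

(** As [F] shares the symmetries, reflecting the cells turns the two mirror images of the [j]-th
    function on the domain into the function itself on the two adjacent copies of the domain. With
    [p < n] the three copies cover its support. *)
Lemma unfold_sum (j : nat) : (0 < j <= n)%N ->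
  \sum_(A <= k < B) L (fold_cell ph j%:Z k%:Z * F k%:Z)
   = \sum_(0 <= k < 2 * p.+1) L (ph k%:Z * F (k%:Z + 2 * j%:Z)).
Proof.
move=> jn; pose g k := L (ph (k - 2 * j%:Z) * F k).
have refl (c : int) s k : s * s = 1 -> (forall t, v (c - t) = s * v t) ->
    L (s *: ph (k - 2 * (c - j%:Z)) * F k) = g (2 * (c + p%:Z) + 1 - k).
  move=> ss vc; rewrite /g (fold_window_refl _ ss vc) -[LHS]unit_int_refl comp_polyM comp_polyZ.
  rewrite ph_refl -!scalerAl -!scalerAr !scalerA !unit_intZ; congr (_ * L (ph _ * _)).
  lia.
transitivity (wsum g A%:Z (B - A) + wsum (fun k => g (2 * A%:Z - 1 - k)) A%:Z (B - A)
    + wsum (fun k => g (2 * B%:Z - 1 - k)) A%:Z (B - A)).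
  rewrite /wsum -!big_split /= -{1}[A]add0n big_addn; apply: eq_bigr => k _.
  rewrite /fold_cell mulrDl unit_intD mulrDl unit_intD.
  rewrite (refl _ _ _ (sign_sq e0) v0) (refl _ _ _ (sign_sq e1) v1) /g.
  by congr (L (ph _ * F _) + L (ph _ * F _) + L (ph _ * F _)); lia.
transitivity (wsum g (2 * A%:Z - B%:Z) ((B - A) + (B - A) + (B - A))).
  rewrite !wsum_cat !wsum_rev [X in X + _ = _]addrC; congr (wsum g _ _ + wsum g _ _ + wsum g _ _); lia.
rewrite (@wsum_supp _ _ _ _ (2 * j%:Z) (2 * p.+1)).
- by apply: eq_bigr => k _; rewrite /g; congr (L (ph _ * F _)); lia.
- by move=> k hk; rewrite /g ph_out ?mul0r ?unit_int0 //; lia.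
- lia.
- lia.
Qed.

Definition gram_cell (j l : int) : R :=
  \sum_(A <= k < B) L (fold_cell ph j k%:Z * fold_cell ph l k%:Z).

Definition auto_corr (u : int) : R :=
  \sum_(0 <= k < 2 * p.+1) L (ph k%:Z * ph (k%:Z + 2 * u)).

(** After unfolding, the Gram matrix acts on the extended [v] as a convolution with the even
    sequence [auto_corr], and [v] is an eigenvector of every symmetric shift. *)
Lemma gram_eigen (c : nat -> R) (j : nat) : (0 < j <= n)%N ->
  (forall u : nat, v (j%:Z + u%:Z) + v (j%:Z - u%:Z) = 2 * c u * v j%:Z) ->
  (forall u : nat, auto_corr (- u%:Z) = auto_corr u%:Z) ->
  \sum_(l < n) gram_cell j%:Z (l.+1)%:Z * v (l.+1)%:Z
   = (auto_corr 0 + 2 * \sum_(1 <= u < p.+1) auto_corr u%:Z * c u) * v j%:Z.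
Proof.
move=> jn vc ac_even.
transitivity (\sum_(A <= k < B) L (fold_cell ph j%:Z k%:Z * F k%:Z)).
  rewrite /gram_cell; under eq_bigr => l _ do rewrite mulr_suml.
  rewrite exchange_big; apply: eq_big_nat => k kAB.
  rewrite -sum_fold_cell; [|lia|lia].
  rewrite mulr_sumr unit_int_sum; apply: eq_bigr => l _.
  by rewrite -scalerAr unit_intZ mulrC.
rewrite unfold_sum //.
transitivity (wsum (fun t => v (j%:Z + t) * auto_corr (- t)) (- p%:Z) (p + 1 + p)).
  rewrite /auto_corr /wsum; under [RHS]eq_bigr => i _ do rewrite mulr_sumr.
  rewrite exchange_big; apply: eq_big_nat => k kp.
  rewrite -(@fold_window_widen _ (j%:Z - p%:Z) (p + 1 + p)); [|lia|lia].
  rewrite /wsum mulr_sumr unit_int_sum; apply: eq_bigr => i _.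
  rewrite -scalerAr unit_intZ; congr (v _ * L (_ * ph _)); lia.
rewrite !wsum_cat [X in _ + X + _](_ : _ = v j%:Z * auto_corr 0); last first.
  rewrite /wsum big_nat1; congr (v _ * auto_corr _); lia.
rewrite [X in X + _ + _](_ : _ = \sum_(1 <= u < p.+1) v (j%:Z - u%:Z) * auto_corr u%:Z); last first.
  rewrite [RHS]big_add1 /= /wsum big_nat_rev; apply: eq_big_nat => i ip.
  congr (v _ * auto_corr _); lia.
rewrite [X in _ + _ + X](_ : _ = \sum_(1 <= u < p.+1) v (j%:Z + u%:Z) * auto_corr u%:Z); last first.
  rewrite [RHS]big_add1 /= /wsum; apply: eq_big_nat => i ip.
  by rewrite -ac_even; congr (v _ * auto_corr _); lia.
rewrite addrAC -big_split /= addrC mulrDl mulrC; congr (_ + _).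
rewrite mulr_sumr mulr_suml; apply: eq_bigr => u _.
by rewrite -mulrDl addrC vc; ring.
Qed.

End Unfolding.

(** * Symmetry, support and autocorrelations of B-splines *)

Section Symbols.
Context {R : realType}.
Variable p : nat.
Local Notation L := (@unit_int R).

Lemma cardB_hcell_closed d (k : int) (t : R) : 0 <= t <= 1 ->
  cardB d.+1 ((t + k%:~R) / 2) = (hcell d.+1 k).[t].
Proof.
case/andP => t0; rewrite le_eqVlt => /orP[/eqP->|t1]; last first.
  by rewrite cardB_hcell // t0.
by rewrite hcell_cont -cardB_hcell ?lexx ?ltr01 // intrD add0r [1 + _]addrC.
Qed.

Lemma half_cell_coord (x : R) : exists k : int, exists2 t : R, 0 <= t < 1 & x = (t + k%:~R) / 2.
Proof.
exists (Num.floor (2 * x)), (2 * x - (Num.floor (2 * x))%:~R); last by field.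
have := floor_itv (2 * x); rewrite intrD => /andP[]; lra.
Qed.

Lemma cardB_sym d (x : R) : cardB d.+1 (d.+2%:R - x) = cardB d.+1 x.
Proof.
have [k [t t01 ->]] := half_cell_coord x.
rewrite [RHS]cardB_hcell //.
rewrite (_ : _ - _ = ((1 - t) + (2 * d.+1%:Z + 1 - k)%:~R) / 2); last first.
  by rewrite intrB intrD intrM /= -natr1; field.
rewrite cardB_hcell_closed; last by lra.
by rewrite -hcell_refl horner_comp !hE subKr.
Qed.

Lemma cardB_out d (x : R) : (x < 0) || (d.+1%:R <= x) -> cardB d x = 0.
Proof.
have [k [t t01 ->]] := half_cell_coord x => xout.
rewrite cardB_hcell // hcell_out ?horner0 //.
case: ltP => //= k0; rewrite leNgt; apply/negP => kd.
have : 0 <= k%:~R :> R by rewrite ler0z.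
have : k%:~R + 1 <= 2 * d.+1%:R :> R.
  by rewrite -[1]/(1%:~R) -[2 * _]/(2%:~R * (d.+1)%:~R) -intrM -intrD ler_int; lia.
by case/orP: xout; lra.
Qed.

Lemma auto_corr_mass (u : int) :
  auto_corr p (@hcell R p) u = 2 * cardB (2 * p).+1 (u%:~R + p.+1%:R).
Proof. by rewrite /auto_corr corr_widen // corrE addnn mul2n. Qed.

Lemma auto_corr_stiff (u : int) : (0 < p)%N ->
  auto_corr p (fun k => (@hcell R p k)^`()) u =
  2^-1 * (2 * cardB (2 * p).-1 (u%:~R + p%:R) - cardB (2 * p).-1 (u%:~R + p%:R - 1)
     - cardB (2 * p).-1 (u%:~R + p%:R + 1)).
Proof.
case: p => // d _; rewrite /auto_corr.
under eq_bigr => k _.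
  rewrite !deriv_hcell -scalerAl -scalerAr !unit_intZ.
  rewrite mulrBl !mulrBr !unit_intB.
  rewrite (_ : k%:Z + 2 * u - 2 = k%:Z + 2 * (u - 1)); last by lia.
  over.
rewrite -!mulr_sumr !sumrB !corr_widen ?corr_shift //; try lia.
rewrite subrK !corrE (_ : (d + d).+1 = (2 * d.+1).-1); last by lia.
rewrite !intrD intrN.
rewrite (_ : u%:~R - 1%:~R + d.+1%:R = u%:~R + d.+1%:R - 1); last by ring.
rewrite (_ : u%:~R + 1%:~R + d.+1%:R = u%:~R + d.+1%:R + 1); last by ring.
by field.
Qed.

End Symbols.

(** * Integrals of piecewise polynomials *)

Section Integration.
Context {R : realType}.
Local Notation mu := (@lebesgue_measure R).
Local Notation L := (@unit_int R).

Lemma continuous_horner_within (P : {poly R}) (A : set R) : {within A, continuous (horner P)}.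
Proof. by apply: continuous_subspaceT => x; exact: continuous_horner. Qed.

Lemma Rintegral_deriv_poly (P : {poly R}) (a b : R) : a < b ->
  \int[mu]_(x in `[a, b]) P^`().[x] = P.[b] - P.[a].
Proof.
move=> ab; rewrite /Rintegral (@continuous_FTC2 _ (horner P^`()) (horner P)) //.
- exact: continuous_horner_within.
- split => [x _||]; first exact: derivable_horner.
  + by apply: cvg_at_right_filter; exact: continuous_horner.
  + by apply: cvg_at_left_filter; exact: continuous_horner.
- by move=> x _; rewrite derivE.
Qed.

Lemma integrable_horner (P : {poly R}) (a b : R) :
  mu.-integrable `[a, b] (EFin \o horner P).
Proof.
apply: continuous_compact_integrable; first exact: segment_compact.
exact: continuous_horner_within.
Qed.

Lemma integrable_setU d (T : measurableType d) (m : {measure set T -> \bar R})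
    (A B : set T) (f : T -> \bar R) :
  measurable A -> measurable B -> [disjoint A & B] ->
  m.-integrable A f -> m.-integrable B f -> m.-integrable (A `|` B) f.
Proof.
move=> mA mB AB /integrableP[mfA fA] /integrableP[mfB fB].
have mf : measurable_fun (A `|` B) f by apply/measurable_funU.
apply/integrableP; split => //; rewrite ge0_integral_setU //.
  exact: lte_add_pinfty.
by apply: measurableT_comp.
Qed.

Definition affine_cell (a b : R) : {poly R} := (b - a)^-1 *: ('X - a%:P).

(** Only values inside the cell are assumed, since [D01] is unspecified where a derivative jumps;
    the end points are null sets. Integrability is part of the conclusion because [Rintegral_setU]
    asks for it when cells are added up. *)
Lemma integral_cell (a b : R) (f : R -> R) (P : {poly R}) : a < b ->
  (forall t, 0 < t < 1 -> f (a + (b - a) * t) = P.[t]) ->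
  mu.-integrable `]a, b] (EFin \o f) /\ \int[mu]_(x in `]a, b]) f x = (b - a) * L P.
Proof.
move=> ab fP; have ba : b - a != 0 by rewrite subr_eq0 gt_eqF.
pose Q := P \Po affine_cell a b.
have fQ : {in `]a, b[, f =1 horner Q}.
  move=> x; rewrite in_itv /= => /andP[ax xb].
  rewrite /Q /affine_cell horner_comp !hE -fP; first by congr f; field.
  rewrite mulrC divr_gt0 ?ltr_pdivrMr ?mul1r ?subr_gt0 //=; lra.
have iQ : mu.-integrable `[a, b] (EFin \o horner Q) by exact: integrable_horner.
have ioo : mu.-integrable `]a, b[ (EFin \o f).
  have iQoo : mu.-integrable `]a, b[ (EFin \o horner Q).
    by apply: integrableS iQ => //; exact: subset_itv_oo_cc.
  apply: eq_integrable iQoo => // x; rewrite inE /= => xab.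
  by congr EFin; rewrite fQ.
have ioc : mu.-integrable `]a, b] (EFin \o f).
  rewrite -(setUitv1 true) ?bnd_simp //; apply: integrable_setU => //.
  - by apply/disj_setPS => y [/=]; rewrite in_itv /= => /andP[_ yb] yE; move: yb; rewrite yE ltxx.
  - apply/integrableP; split; first exact: measurable_fun_set1.
    by rewrite integral_set1.
split => //; rewrite -Rintegral_itv_bndo_bndc //.
transitivity (\int[mu]_(x in `]a, b[) Q.[x]).
  by apply: eq_Rintegral => x; rewrite inE; exact: fQ.
rewrite Rintegral_itv_bndo_bndc; last by apply: integrableS iQ => //; exact: subset_itv_oo_cc.
rewrite Rintegral_itv_obnd_cbnd; last by apply: integrableS iQ => //; exact: subset_itv_oc_cc.
have -> : Q = ((b - a) *: (primitive P \Po affine_cell a b))^`().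
  rewrite derivZ deriv_comp deriv_primitive /affine_cell derivZ derivB derivX derivC subr0.
  by rewrite -scalerAr scalerA divff // scale1r mulr1.
rewrite Rintegral_deriv_poly // !hE !horner_comp /affine_cell !hE subrr mulr0 mulVf //.
by rewrite -mulrBr -unit_int_deriv deriv_primitive.
Qed.

Lemma Rintegral_piecewise (m : nat) (x : nat -> R) (f : R -> R) (P : nat -> {poly R}) :
  (forall k, (k < m)%N -> x k < x k.+1) ->
  (forall k, (k < m)%N -> forall t, 0 < t < 1 ->
     f (x k + (x k.+1 - x k) * t) = (P k).[t]) ->
  \int[mu]_(y in `[x 0, x m]) f y = \sum_(0 <= k < m) (x k.+1 - x k) * L (P k).
Proof.
move=> xS fP.
suff H : mu.-integrable `[x 0, x m] (EFin \o f) /\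
    \int[mu]_(y in `[x 0, x m]) f y = \sum_(0 <= k < m) (x k.+1 - x k) * L (P k) by case: H.
elim: m xS fP => [|m IH] xS fP.
  rewrite set_itv1 Rintegral_set1 big_geq //; split => //.
  apply/integrableP; split; first exact: measurable_fun_set1.
  by rewrite integral_set1.
have [||im Im] := IH; [by move=> k km; apply: xS; lia|by move=> k km; apply: fP; lia|].
have x0m : x 0 <= x m.
  elim: {IH fP im Im} m xS => // m IH xS; apply: (le_trans (IH _)); last by apply/ltW/xS.
  by move=> k km; apply: xS; lia.
have xm : x m < x m.+1 by exact: xS.
have [ic Ic] := integral_cell xm (fP m (leqnn _)).
have dj : [disjoint `[x 0, x m] & `]x m, x m.+1]].
  apply/disj_setPS => y [/=]; rewrite !in_itv /= => /andP[_ y1] /andP[y2 _].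
  by have := lt_le_trans y2 y1; rewrite ltxx.
have E : `[x 0, x m.+1]%classic = `[x 0, x m] `|` `]x m, x m.+1].
  by rewrite -itv_bndbnd_setU // bnd_simp // ltW.
have iU : mu.-integrable (`[x 0, x m] `|` `]x m, x m.+1]) (EFin \o f).
  exact: integrable_setU.
rewrite E Rintegral_setU // big_nat_recr //= Im Ic; split => //.
Qed.

End Integration.

(** * Derivatives of cardinal B-splines *)

Section Derivatives.
Context {R : realType}.
Implicit Types (f g h : R -> R) (x d : R).

Lemma near_lt x z : x < z -> \forall y \near x, y < z.
Proof.
move=> xz; exists (z - x) => /=; first by rewrite subr_gt0.
by move=> y /=; rewrite ltr_distl => /andP[]; lra.
Qed.

Lemma near_gt x z : z < x -> \forall y \near x, z < y.
Proof.
move=> xz; exists (x - z) => /=; first by rewrite subr_gt0.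
by move=> y /=; rewrite ltr_distl => /andP[]; lra.
Qed.

(** By Caratheodory's criterion each side has a slope function continuous at [x]; both take the
    value [d] there, so the glued slope function is continuous too. *)
Lemma is_derive_glue f g h x d :
  (\forall y \near x, y <= x -> f y = g y) ->
  (\forall y \near x, x <= y -> f y = h y) ->
  is_derive x 1 g d -> is_derive x 1 h d -> is_derive x 1 f d.
Proof.
move=> fg fh /is_derive1_caratheodory[g' [gE gc gd]] /is_derive1_caratheodory[h' [hE hc hd]].
have fgx : f x = g x by have := nbhs_singleton fg; apply.
have fhx : f x = h x by have := nbhs_singleton fh; apply.
pose m y := if y <= x then g' y else h' y.
have mc : {for x, continuous m}.
  apply/cvgrPdist_lt => e e0.
  have mx : m x = d by rewrite /m lexx.
  near=> y; rewrite mx /m; case: ifP => _.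
    by rewrite -gd; near: y; move/cvgrPdist_lt: gc; apply.
  by rewrite -hd; near: y; move/cvgrPdist_lt: hc; apply.
have Hm : is_derive x 1 (fun y => f x + m y * (y - x)) d.
  apply/is_derive1_caratheodory; exists m; split => //; last by rewrite /m lexx.
  by move=> z; rewrite subrr mulr0 addr0 addrC addKr.
apply: near_eq_is_derive Hm; near=> y; rewrite /m; case: (leP y x) => yx.
  rewrite -gE fgx addrC subrK; apply/esym; move: yx; near: y; exact: fg.
rewrite -hE fhx addrC subrK; apply/esym; move/ltW: yx; near: y; exact: fh.
Unshelve. all: by end_near. Qed.

Lemma is_derive_cell (D : nat) (k : int) (x : R) :
  is_derive x 1 (fun y => (hcell D.+1 k).[2 * y - k%:~R])
    (hcell D k - hcell D (k - 2)).[2 * x - k%:~R].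
Proof.
rewrite (_ : (fun y => _) = horner (hcell D.+1 k \Po (2 *: 'X - k%:~R%:P))); last first.
  by apply/funext => y; rewrite horner_comp !hE.
apply: is_derive_eq; rewrite deriv_comp deriv_hcell derivB derivZ derivX derivC.
by rewrite subr0 hornerM horner_comp !hE; field.
Qed.

Lemma near_half_left (k : int) (x : R) : 2 * x = k%:~R ->
  \forall y \near x, y <= x -> 0 <= 2 * y - (k - 1)%:~R <= 1.
Proof.
move=> xk; near=> y => yx.
have : x - 2^-1 < y by near: y; apply: near_gt; lra.
by rewrite intrB -xk; lra.
Unshelve. all: by end_near. Qed.

Lemma near_half_right (k : int) (x : R) : 2 * x = k%:~R ->
  \forall y \near x, x <= y -> 0 <= 2 * y - k%:~R <= 1.
Proof.
move=> xk; near=> y => yx.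
have : y < x + 2^-1 by near: y; apply: near_lt; lra.
by rewrite -xk; lra.
Unshelve. all: by end_near. Qed.

Lemma cardB_closed_half D (k : int) (y : R) : 0 <= 2 * y - k%:~R <= 1 ->
  cardB D.+1 y = (hcell D.+1 k).[2 * y - k%:~R].
Proof. by move=> yk; rewrite -cardB_hcell_closed //; congr cardB; field. Qed.

(** The knots are integers, so both halves of a unit cell carry the same polynomial. *)
Lemma hcell_odd D (K : int) : @hcell R D (2 * K + 1) = hcell D (2 * K) \Po ('X + 1).
Proof.
elim: D K => [|D IH] K.
  rewrite !hcell0 (_ : (0 <= 2 * K + 1) && _ = (0 <= 2 * K) && (2 * K < 2)); last by lia.
  by case: ifP; rewrite -?polyC1 -?polyC0 comp_polyC.
apply: poly_ext => x; rewrite horner_comp !horner_hcellS !hE.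
rewrite (_ : 2 * K + 1 - 2 = 2 * (K - 1) + 1); last by lia.
rewrite !IH !horner_comp !hE (_ : 2 * (K - 1) = 2 * K - 2); last by lia.
by rewrite (_ : (2 * K + 1)%:~R = 1 + (2 * K)%:~R :> R) ?addrA // intrD addrC.
Qed.

Lemma is_derive_cardB D (x : R) : (0 < D)%N \/ (exists K : int, x = K%:~R + 2^-1) ->
  is_derive x 1 (cardB D.+1) (cardB D x - cardB D (x - 1)).
Proof.
move=> HD; have [k [t t01 xE]] := half_cell_coord x.
have tE : 2 * x - k%:~R = t by rewrite xE; field.
have dE : cardB D x - cardB D (x - 1) = (hcell D k - hcell D (k - 2)).[2 * x - k%:~R].
  rewrite !hE tE -!cardB_hcell // xE; congr (_ - cardB _ _).
  by rewrite intr_sub2; field.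
case/andP: t01; rewrite le_eqVlt => /orP[/eqP t0|t0] t1.
  have xk : 2 * x = k%:~R by lra.
  apply: (@is_derive_glue _ (fun y => (hcell D.+1 (k - 1)).[2 * y - (k - 1)%:~R])
           (fun y => (hcell D.+1 k).[2 * y - k%:~R])).
  - near=> y => yx; apply: cardB_closed_half; move: yx; near: y; exact: near_half_left.
  - near=> y => yx; apply: cardB_closed_half; move: yx; near: y; exact: near_half_right.
  - rewrite dE; apply: (is_derive_eq (is_derive_cell D (k - 1) x)).
    have -> : 2 * x - (k - 1)%:~R = 1 by rewrite intrB xk; ring.
    rewrite xk subrr !hE.
    case: HD => [|[K xK]].
      case: D dE => // D dE _; rewrite !hcell_cont.
      by congr (horner _ _ - horner _ _); congr hcell; lia.
    have kK : k = 2 * K + 1.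
      by apply: (@intr_inj R); rewrite -xk xK intrD intrM; field.
    have -> : k - 1 - 2 = 2 * (K - 1) by lia.
    have -> : k - 2 = 2 * (K - 1) + 1 by lia.
    have -> : k - 1 = 2 * K by lia.
    by rewrite kK !hcell_odd !horner_comp !hE add0r.
  - by rewrite dE; exact: is_derive_cell.
rewrite dE; apply: near_eq_is_derive (is_derive_cell D k x).
near=> y; rewrite -cardB_hcell; first by congr cardB; field.
apply/andP; split.
  have : k%:~R / 2 < y by near: y; apply: near_gt; rewrite xE; lra.
  lra.
have : y < (k%:~R + 1) / 2 by near: y; apply: near_lt; rewrite xE; lra.
lra.
Unshelve. all: by end_near. Qed.

(* a-th derivative of cardB d, for a <= d *)
Fixpoint dcardB (a d : nat) (x : R) : R :=
  if a is a'.+1 then dcardB a' d.-1 x - dcardB a' d.-1 (x - 1) else cardB d x.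

Lemma is_derive_shift f (c x d : R) : is_derive (x + c) 1 f d ->
  is_derive x 1 (fun y => f (y + c)) d.
Proof.
move=> fd; rewrite -[d]mulr1.
apply: (@is_derive1_comp _ f (fun y => y + c)).
by apply: is_derive_eq; rewrite addr0.
Qed.

Lemma is_derive_dcardB (a d : nat) (x : R) : (a < d)%N ->
  (a.+1 < d)%N \/ (exists K : int, x = K%:~R + 2^-1) ->
  is_derive x 1 (dcardB a d) (dcardB a.+1 d x).
Proof.
elim: a d x => [|a IH] [|d] x //= ad H.
  by apply: is_derive_cardB; case: H => [|]; [left|right].
have Hs : (a.+1 < d)%N \/ (exists K : int, x - 1 = K%:~R + 2^-1).
  case: H => [|[K xK]]; [by left|right; exists (K - 1)].
  by rewrite intrB xK; ring.
apply: is_deriveB; first exact: IH.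
by apply: (is_derive_shift (IH _ _ _ Hs)).
Qed.

Lemma dcardB_out (a d : nat) (x : R) : (a <= d)%N -> (x < 0) || (d.+1%:R <= x) -> dcardB a d x = 0.
Proof.
elim: a d x => [|a IH] d x ad xo; first exact: cardB_out.
case: d ad xo => // d ad xo; rewrite /= !IH ?subr0 //.
- by move: xo; rewrite -natr1; lra.
- by move: xo; rewrite -natr1; lra.
Qed.

Lemma dcardB_sym (a d : nat) (x : R) : (a <= d)%N ->
  (a < d)%N \/ (exists K : int, x = K%:~R + 2^-1) ->
  dcardB a d (d.+1%:R - x) = (-1) ^+ a * dcardB a d x.
Proof.
elim: a d x => [|a IH] d x ad H.
  rewrite expr0 mul1r /=; case: H => [|[K ->]]; first by case: d {ad} => // d _; exact: cardB_sym.
  case: d {ad} => [|d]; last exact: cardB_sym.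
  rewrite /=; congr (if _ then _ else _).
  case: (ltgtP K 0) => K0.
  - have : (K%:~R : R) <= -1 by rewrite -[-1]/((-1)%:~R) ler_int; lia.
    lra.
  - have : 1 <= (K%:~R : R) by rewrite -[1]/(1%:~R) ler_int; lia.
    lra.
  - by rewrite K0; lra.
case: d ad H => // d ad H /=.
have H1 : (a < d)%N \/ (exists K : int, x - 1 = K%:~R + 2^-1).
  case: H => [|[K xK]]; [by left|right; exists (K - 1)].
  by rewrite intrB xK; ring.
have -> : d.+2%:R - x = d.+1%:R - (x - 1) by rewrite -[d.+2%:R]natr1; ring.
have -> : d.+1%:R - (x - 1) - 1 = d.+1%:R - x by ring.
by rewrite !IH // exprS; ring.
Qed.

End Derivatives.

(** * Monotonicity of the quotient of the symbols *)

Section CotPolynomials.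
Context {R : realType}.
Implicit Types (f g : nat -> R) (d j k l m : nat).

(** Coefficient of [x^k] in [(1 + x^2) f']; the truncation in [k.-1] is harmless, because that term
    has the factor 0 for [k <= 1]. *)
Definition cot_step f k : R := k.+1%:R * f k.+1 + k.-1%:R * f k.-1.

(* Coefficients of S_(d+1), where S_1 = x and S_(m+1) = (1 + x^2) S_m' / m. *)
Fixpoint cot_coef d : nat -> R :=
  if d is d'.+1 then fun k => d%:R^-1 * cot_step (cot_coef d') k
  else fun k => (k == 1)%:R.

Lemma cot_coefS d k : cot_coef d.+1 k = d.+1%:R^-1 * cot_step (cot_coef d) k.
Proof. by []. Qed.

Lemma cot_coef_out d k : (d.+1 < k)%N -> cot_coef d k = 0.
Proof.
elim: d k => [|d IH] [|[|k]] //= kd.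
by rewrite /cot_step !IH ?mulr0 ?addr0 ?mulr0 //; lia.
Qed.

Lemma cot_coef_odd d k : odd (d + k) = false -> cot_coef d k = 0.
Proof.
elim: d k => [|d IH] k kd.
  by rewrite /=; case: eqP => // k1; move: kd; rewrite k1.
rewrite cot_coefS /cot_step IH; last by rewrite addnS -addSn.
case: k kd => [|k] kd; rewrite /= ?mul0r !mulr0 ?addr0 ?mulr0 //.
by rewrite IH ?mulr0 ?addr0 ?mulr0 //; move: kd; rewrite addSn addnS /= negbK.
Qed.

Lemma cot_coef_ge0 d k : 0 <= cot_coef d k.
Proof.
elim: d k => [|d IH] k; first by rewrite /= ler0n.
by rewrite cot_coefS mulr_ge0 ?invr_ge0 ?ler0n // /cot_step addr_ge0 // mulr_ge0 ?ler0n.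
Qed.

Lemma cot_coef_gt0 d k : odd (d + k) -> (k <= d.+1)%N -> 0 < cot_coef d k.
Proof.
elim: d k => [|d IH] k kd kle; first by move: kd kle; case: k => [|[|k]] //= _ _; rewrite ltr01.
rewrite cot_coefS mulr_gt0 ?invr_gt0 ?ltr0n // /cot_step.
case: (leqP k 1) => k1.
  rewrite ltr_pwDl ?mulr_ge0 ?ler0n ?cot_coef_ge0 // mulr_gt0 ?ltr0n //.
  apply: IH; first by rewrite addnS -addSn.
  case: k k1 kle kd => [|[|k]] // _ kle kd.
  by case: d kd kle => //=; lia.
rewrite ltr_wpDl ?mulr_ge0 ?ler0n ?cot_coef_ge0 // mulr_gt0 ?ltr0n //; first by lia.
apply: IH; last by lia.
by move: kd; case: k k1 {kle} => //= k _; rewrite addnS /= negbK.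
Qed.

(** The quotient [f/g] does not increase along indices of equal parity; it is cross-multiplied since
    every second coefficient of the polynomials is 0. *)
Definition ratio_mono f g := forall j l, f (j + 2 * l)%N * g j <= f j * g (j + 2 * l)%N.

(** Two distinct indices of equal parity differ by at least 2, so the neighbours of the smaller one
    never exceed those of the larger one. Hence each of the four cross terms of the expanded
    products satisfies the inequality, with the same weights on both sides. *)
Lemma ratio_mono_step f g : ratio_mono f g -> ratio_mono (cot_step f) (cot_step g).
Proof.
move=> fg j [|l]; first by rewrite muln0 addn0 mulrC.
rewrite /cot_step.
have -> : (j + 2 * l.+1).-1 = (j.+1 + 2 * l)%N by lia.
have -> : (j + 2 * l.+1).+1 = (j.+1 + 2 * l.+1)%N by lia.
have h1 := fg j.+1 l; have h2 := fg j.+1 l.+1.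
move: h1 h2; move E1 : (j.+1 + 2 * l)%N => K1; move E2 : (j.+1 + 2 * l.+1)%N => K2 h1 h2.
have key c c' (x y z w : R) : 0 <= c -> 0 <= c' -> x * y <= z * w ->
  (c * x) * (c' * y) <= (c' * z) * (c * w).
  move=> c0 c0' H; rewrite [leLHS]mulrACA [leRHS]mulrACA [c' * c]mulrC.
  by rewrite ler_wpM2l // mulr_ge0.
(* For [j = 0] the index [j.-1] has the wrong parity, but its weight is 0. *)
have [h3 h4] : (j.-1)%:R * f K2 * g j.-1 <= (j.-1)%:R * f j.-1 * g K2
     /\ (j.-1)%:R * f K1 * g j.-1 <= (j.-1)%:R * f j.-1 * g K1.
  case: j {h1 h2} E1 E2 => [|j] E1 E2; first by rewrite /= !mul0r.
  have := fg j l.+1; have := fg j l.+2.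
  rewrite /= (_ : j + 2 * l.+2 = K2)%N; last by lia.
  rewrite (_ : j + 2 * l.+1 = K1)%N; last by lia.
  by move=> H1 H2; rewrite -!mulrA !ler_wpM2l ?ler0n.
rewrite !mulrDl !mulrDr.
have n0 n : (0 : R) <= n%:R by rewrite ler0n.
have t1 := key _ _ _ _ _ _ (n0 K2) (n0 j.+1) h2.
have t2 := key _ _ _ _ _ _ (n0 K1) (n0 j.+1) h1.
have t3 : K2%:R * f K2 * (j.-1%:R * g j.-1) <= j.-1%:R * f j.-1 * (K2%:R * g K2).
  have := ler_wpM2l (n0 K2) h3; nra.
have t4 : K1%:R * f K1 * (j.-1%:R * g j.-1) <= j.-1%:R * f j.-1 * (K1%:R * g K1).
  have := ler_wpM2l (n0 K1) h4; nra.
by lra.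
Qed.

Lemma cot_coef_ratio d : ratio_mono (cot_coef d) (cot_coef d.+2).
Proof.
elim: d => [|d IH] j l.
  case: l => [|l]; first by rewrite muln0 addn0 mulrC.
  rewrite {1}/cot_coef (_ : (_ == 1)%N = false); last by lia.
  by rewrite mul0r mulr_ge0 ?cot_coef_ge0.
rewrite 2!cot_coefS [in leRHS]cot_coefS [in leRHS]cot_coefS.
have := ratio_mono_step IH j l.
set a := _^-1; set b := _^-1 => H.
rewrite [leLHS]mulrACA [leRHS]mulrACA ler_wpM2l // mulr_ge0 ?invr_ge0 ?ler0n //.
Qed.

Lemma sum_even (F : nat -> R) m : (forall k, odd k -> F k = 0) ->
  \sum_(k < (2 * m).+1) F k = \sum_(j < m.+1) F (2 * j)%N.
Proof.
move=> F0; elim: m => [|m IH]; first by rewrite !big_ord1.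
rewrite (_ : (2 * m.+1).+1 = (2 * m).+3); last by lia.
rewrite big_ord_recr big_ord_recr /= IH [RHS]big_ord_recr /= (F0 (2 * m).+1); last by lia.
by rewrite addr0; congr (_ + F _); lia.
Qed.

(** Twice the difference of the two sides is the double sum of [D j k], by exchanging [j] and [k].
    Each [D j k] is a product of factors of opposite sign, and the pair [(0, m)] makes the sum
    strictly negative. *)
Lemma ratio_mono_form m (a b : nat -> R) (x1 y1 x2 y2 : R) :
  (forall j k, (j <= k <= m)%N -> a k * b j <= a j * b k) ->
  a m * b 0 < a 0 * b m ->
  0 <= x2 < x1 -> 0 <= y1 < y2 ->
  (\sum_(j < m.+1) a j * (x1 ^+ j * y1 ^+ (m - j)))
    * (\sum_(j < m.+1) b j * (x2 ^+ j * y2 ^+ (m - j)))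
  < (\sum_(j < m.+1) a j * (x2 ^+ j * y2 ^+ (m - j)))
    * (\sum_(j < m.+1) b j * (x1 ^+ j * y1 ^+ (m - j))).
Proof.
move=> ab ab0 /andP[x20 x21] /andP[y10 y12].
pose u j := x1 ^+ j * y1 ^+ (m - j); pose v j := x2 ^+ j * y2 ^+ (m - j).
pose D j k := (a j * b k - a k * b j) * (u j * v k - v j * u k).
have uv j k : (j <= k <= m)%N -> u j * v k <= v j * u k.
  move=> /andP[jk km]; rewrite /u /v.
  rewrite -(subnKC jk); set e := (k - j)%N; have -> : (m - j = m - (j + e) + e)%N by rewrite /e; lia.
  set q := (m - (j + e))%N; rewrite !exprD.
  have h : (y1 * x2) ^+ e <= (y2 * x1) ^+ e.
    by rewrite lerXn2r ?nnegrE ?mulr_ge0 ?ler_pM //; lra.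
  have c0 : 0 <= (x1 * x2) ^+ j * (y1 * y2) ^+ q.
    by rewrite mulr_ge0 ?exprn_ge0 ?mulr_ge0 //; lra.
  have := ler_wpM2l c0 h; rewrite !exprMn.
  by rewrite (_ : x1 ^+ j * (y1 ^+ q * y1 ^+ e) * _ = x1 ^+ j * x2 ^+ j * (y1 ^+ q * y2 ^+ q) * (y1 ^+ e * x2 ^+ e)) 1?(_ : x2 ^+ j * (y2 ^+ q * y2 ^+ e) * _ = x1 ^+ j * x2 ^+ j * (y1 ^+ q * y2 ^+ q) * (y2 ^+ e * x1 ^+ e)) //; ring.
have Dle j k : (j <= m)%N -> (k <= m)%N -> D j k <= 0.
  move=> jm km; rewrite /D; case: (leqP j k) => jk.
    rewrite mulr_ge0_le0 ?subr_ge0 ?subr_le0 ?ab ?uv ?jk //.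
  rewrite mulr_le0_ge0 ?subr_ge0 ?subr_le0 ?ab ?(ltnW jk) //.
  by rewrite [X in X <= _]mulrC [X in _ <= X]mulrC uv // (ltnW jk).
have DE : \sum_(j < m.+1) \sum_(k < m.+1) D j k =
    2 * ((\sum_(j < m.+1) a j * u j) * (\sum_(k < m.+1) b k * v k)
       - (\sum_(j < m.+1) a j * v j) * (\sum_(k < m.+1) b k * u k)).
  rewrite !mulr_suml -sumrB.
  have -> : \sum_(j < m.+1) (a j * u j * (\sum_(k < m.+1) b k * v k) - a j * v j * (\sum_(k < m.+1) b k * u k))
     = \sum_(j < m.+1) \sum_(k < m.+1) a j * b k * (u j * v k - v j * u k).
    apply: eq_bigr => j _; rewrite !mulr_sumr -sumrB; apply: eq_bigr => k _; ring.
  rewrite [2]/(1 + 1) mulrDl mul1r [X in _ = _ + X]exchange_big /= -big_split /=; apply: eq_bigr => j _.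
  by rewrite -big_split /=; apply: eq_bigr => k _; rewrite /D; ring.
rewrite -subr_lt0 -/u -/v.
suff : \sum_(j < m.+1) \sum_(k < m.+1) D j k < 0 by rewrite DE pmulr_rlt0 ?ltr0n.
rewrite (bigD1 ord0) //= (bigD1 ord_max) //= -addrA.
have D0 : D 0%N m < 0.
  rewrite /D pmulr_rlt0 ?subr_gt0 // subr_lt0 /u /v !subnn !subn0 !expr0 !mulr1 !mul1r.
  case: (posnP m) => [m0|m0]; first by move: ab0; rewrite m0 ltxx.
  have -> : y1 ^+ m * x2 ^+ m = (y1 * x2) ^+ m by rewrite exprMn.
  have -> : y2 ^+ m * x1 ^+ m = (y2 * x1) ^+ m by rewrite exprMn.
  by rewrite ltrXn2r ?nnegrE ?mulr_ge0 -?lt0n ?ltr_pM //; lra.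
set S1 := \sum_(i < _ | _) _; set S2 := \sum_(i < _ | _) _.
have S1le : S1 <= 0 by apply: sumr_le0 => k _; apply: Dle => //; rewrite -ltnS.
have S2le : S2 <= 0.
  by apply: sumr_le0 => j _; apply: sumr_le0 => k _; apply: Dle; rewrite -ltnS.
by move: D0; rewrite /=; lra.
Qed.

End CotPolynomials.
Arguments cot_coef {R} d k : simpl never.

(** * The symbols as forms in cosine and sine *)

Section Symbol.
Context {R : realType}.
Implicit Types (phi theta : R) (d k p : nat).

(** The Euler-Frobenius polynomial on the unit circle, made real by the symmetry of the B-spline;
    [phi] is half of the usual angle. *)
Definition euler_sum d phi : R :=
  \sum_(k < d.+2) cardB d k%:R * cos ((2 * k%:R - d.+1%:R) * phi).

(** This is [sin(phi)^(d+1) S_(d+1)(cot phi)] without division, so that it makes sense where the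
    sine vanishes. *)
Definition cot_form d phi : R :=
  \sum_(k < d.+2) cot_coef d k * (cos phi ^+ k * sin phi ^+ (d.+1 - k)).

Lemma is_derive_euler_sum d phi : is_derive phi 1 (euler_sum d)
  (- \sum_(k < d.+2) cardB d k%:R * ((2 * k%:R - d.+1%:R) * sin ((2 * k%:R - d.+1%:R) * phi))).
Proof.
rewrite /euler_sum -sumrN.
have -> : (fun x => \sum_(k < d.+2) cardB d k%:R * cos ((2 * k%:R - d.+1%:R) * x))
  = \sum_(k < d.+2) (fun x : R => cardB d k%:R * cos ((2 * k%:R - d.+1%:R) * x)).
  by apply/funext => x; rewrite fct_sumE.
apply: is_derive_sum => k.
set c := cardB d k%:R; set m := 2 * k%:R - d.+1%:R.
have Hm : is_derive phi 1 (fun x : R => m * x) m.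
  by apply: is_derive_eq; rewrite /GRing.scale /= mulr1.
have Hc : is_derive phi 1 (fun x : R => cos (m * x)) (- sin (m * phi) * m).
  exact: (@is_derive1_comp _ cos (fun x => m * x)).
by apply: is_derive_eq; rewrite /GRing.scale /=; ring.
Qed.

Lemma is_derive_cot_form d phi : is_derive phi 1 (cot_form d)
  (\sum_(k < d.+2) cot_coef d k * (cos phi ^+ k.+1 * sin phi ^+ (d - k) * (d.+1 - k)%:R
     - k%:R * (cos phi ^+ k.-1 * sin phi ^+ (d.+2 - k)))).
Proof.
rewrite /cot_form.
have -> : (fun x => \sum_(k < d.+2) cot_coef d k * (cos x ^+ k * sin x ^+ (d.+1 - k)))
  = \sum_(k < d.+2) (fun x : R => cot_coef d k * (cos x ^+ k * sin x ^+ (d.+1 - k))).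
  by apply/funext => x; rewrite fct_sumE.
apply: is_derive_sum => k.
have powD (f : R -> R) (df : R) n : is_derive phi 1 f df ->
    is_derive phi 1 (fun x => f x ^+ n) (n%:R * f phi ^+ n.-1 * df).
  move=> fD; rewrite (_ : (fun x => f x ^+ n) = f ^+ n); last first.
    by apply/funext => x; rewrite exprfctE.
  by apply: is_derive_eq; rewrite /GRing.scale /=.
have HC := powD _ _ k (is_derive_cos phi).
have HS := powD _ _ (d.+1 - k)%N (is_derive_sin phi).
have HM := is_deriveM HC HS.
have := is_deriveZ (cot_coef d k) HM.
move=> H; apply: is_derive_eq H _; rewrite /GRing.scale /=; congr (_ * _).
have -> : (d.+2 - k = (d.+1 - k).+1)%N by rewrite subSn // -ltnS.
have -> : (d - k = (d.+1 - k).-1)%N by lia.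
by rewrite !exprS; ring.
Qed.

Lemma cardB_rec_nat d k : d.+1%:R * cardB d.+1 k%:R =
  k%:R * cardB d k%:R + (if k is k'.+1 then (d.+1 - k')%:R * cardB d k'%:R else 0) :> R.
Proof.
rewrite /=; case: k => [|k].
  by rewrite !mul0r !add0r [cardB d (- 1)]cardB_out ?mulr0 // ltrN10.
have -> : k.+1%:R - 1 = k%:R :> R by rewrite -natr1 addrK.
have [kd|kd] := leqP k d.+1.
  rewrite natrB // -!natr1; field.
  by rewrite natr1 pnatr_eq0.
rewrite [cardB d k%:R]cardB_out; last by rewrite ler_nat; lia.
by rewrite !mulr0 !addr0; field; rewrite nat1r pnatr_eq0.
Qed.

(** Raising the degree moves the centre of the B-spline by 1/2, hence the angles by [phi] in one
    direction or the other; the addition formulas then leave the sum times [cos phi] and its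
    derivative times [sin phi]. *)
Lemma euler_sum_rec d phi : d.+1%:R * euler_sum d.+1 phi =
  d.+1%:R * cos phi * euler_sum d phi + sin phi *
  \sum_(k < d.+2) cardB d k%:R * ((2 * k%:R - d.+1%:R) * sin ((2 * k%:R - d.+1%:R) * phi)).
Proof.
rewrite /euler_sum !mulr_sumr -big_split /=.
under eq_bigr => k _ do rewrite mulrA cardB_rec_nat mulrDl.
rewrite big_split /= big_ord_recr /= [X in _ + X + _](_ : _ = 0) ?addr0; last first.
  by rewrite cardB_out ?mulr0 ?mul0r // ler_nat; lia.
rewrite [X in _ + X]big_ord_recl /= mul0r add0r -big_split /=.
apply: eq_bigr => k _.
have -> : (2 * k%:R - d.+2%:R) * phi = (2 * k%:R - d.+1%:R) * phi - phi by rewrite -[d.+2%:R]natr1; ring.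
have -> : (2 * (bump 0 k)%:R - d.+2%:R) * phi = (2 * k%:R - d.+1%:R) * phi + phi.
  by rewrite /bump /= natrD -[d.+2%:R]natr1; ring.
rewrite add0n cosB cosD natrB; last by rewrite -ltnS.
by ring.
Qed.

Lemma cot_form_rec d phi : d.+1%:R * cot_form d.+1 phi =
  d.+1%:R * cos phi * cot_form d phi - sin phi *
  \sum_(k < d.+2) cot_coef d k * (cos phi ^+ k.+1 * sin phi ^+ (d - k) * (d.+1 - k)%:R
     - k%:R * (cos phi ^+ k.-1 * sin phi ^+ (d.+2 - k))).
Proof.
set C := cos phi; set S := sin phi.
transitivity (\sum_(k < d.+2) cot_coef d k * k%:R *
    (C ^+ k.+1 * S ^+ (d.+1 - k) + C ^+ k.-1 * S ^+ (d.+3 - k))).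
  rewrite /cot_form mulr_sumr -/C -/S.
  under eq_bigr => k _ do rewrite cot_coefS -mulrA mulVKf ?pnatr_eq0 // /cot_step mulrDl.
  rewrite big_split /=.
  have -> : \sum_(i < d.+3) i.+1%:R * cot_coef d i.+1 * (C ^+ i * S ^+ (d.+2 - i))
      = \sum_(k < d.+2) cot_coef d k * k%:R * (C ^+ k.-1 * S ^+ (d.+3 - k)).
    rewrite big_ord_recr big_ord_recr /= !cot_coef_out // !mulr0 !mul0r !addr0.
    rewrite [RHS]big_ord_recl mulr0 mul0r add0r; apply: eq_bigr => k _.
    by rewrite /bump /= ?add1n ?add0n ?subSS [_%:R * _]mulrC.
  have -> : \sum_(i < d.+3) i.-1%:R * cot_coef d i.-1 * (C ^+ i * S ^+ (d.+2 - i))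
      = \sum_(k < d.+2) cot_coef d k * k%:R * (C ^+ k.+1 * S ^+ (d.+1 - k)).
    rewrite big_ord_recl /= !mul0r add0r; apply: eq_bigr => k _.
    by rewrite /bump /= ?add1n ?add0n ?subSS [_%:R * _]mulrC.
  by rewrite -big_split /=; apply: eq_bigr => k _; rewrite -mulrDr addrC.
rewrite /cot_form !mulr_sumr -sumrB; apply: eq_bigr => k _; rewrite -/C -/S.
have -> : (d.+3 - k = (d.+2 - k).+1)%N by rewrite subSn // ltnW // ltnS.
case: (leqP k d) => kd.
  rewrite (subSn kd) !exprS -[(d - k).+1%:R]natr1 natrB // -[d.+1%:R]natr1; ring.
have -> : nat_of_ord k = d.+1 by have := ltn_ord k; lia.
rewrite subnn !exprS mulr0; ring.
Qed.

(* Both sides satisfy the same recursion in d, which involves the derivative in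
   phi: for cot_form it is the one that defines cot_coef. *)
Lemma euler_sumE d phi : euler_sum d phi = cot_form d phi.
Proof.
elim: d phi => [|d IH] phi.
  rewrite /euler_sum /cot_form !big_ord_recr !big_ord0 /=.
  rewrite ltr01 lexx ltxx ler01 /= !mul0r !mul1r !addr0 !add0r mulr0 sub0r mulN1r cosN.
  by rewrite subnn expr0 expr1 mulr1.
have n0 : (d.+1%:R : R) != 0 by rewrite pnatr_eq0.
apply: (mulfI n0); rewrite euler_sum_rec cot_form_rec IH; congr (_ + _).
rewrite -mulrN; congr (_ * _).
have H1 := is_derive_euler_sum d phi.
have H2 := is_derive_cot_form d phi.
have E : euler_sum d = cot_form d by apply/funext.
rewrite -E in H2; have := @derive_val _ _ _ _ _ _ _ H1; rewrite (@derive_val _ _ _ _ _ _ _ H2).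
by move=> ->; rewrite opprK.
Qed.

End Symbol.

Section Symbol.
Context {R : realType}.
Implicit Types (phi theta : R) (d k p M : nat) (c : int -> R).

Definition cos_sum c theta M : R :=
  wsum (fun k : int => c k * cos (k%:~R * theta)) (- M%:Z) (M + 1 + M).

Lemma cos_sumE c theta M : (forall k : nat, c (- k%:Z) = c k%:Z) ->
  cos_sum c theta M = c 0 + 2 * \sum_(1 <= k < M.+1) c k%:Z * cos (k%:R * theta).
Proof.
move=> c_even; rewrite /cos_sum !wsum_cat [X in _ + X + _](_ : _ = c 0); last first.
  by rewrite /wsum big_nat1 addNr addr0 mul0r cos0 mulr1.
rewrite [X in X + _ + _](_ : _ = \sum_(1 <= k < M.+1) c k%:Z * cos (k%:R * theta)); last first.
  rewrite [RHS]big_add1 /= /wsum big_nat_rev; apply: eq_big_nat => i iM.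
  have -> : - M%:Z + (0 + M - i.+1)%N%:Z = - i.+1%:Z by lia.
  by rewrite c_even intrN mulNr cosN.
rewrite [X in _ + _ + X](_ : _ = \sum_(1 <= k < M.+1) c k%:Z * cos (k%:R * theta)); last first.
  rewrite [RHS]big_add1 /= /wsum; apply: eq_big_nat => i iM.
  by have -> : - M%:Z + (M + 1)%N%:Z + i%:Z = i.+1%:Z by lia.
by rewrite addrAC addrC mulrDl !mul1r.
Qed.

Lemma cos_sum_widen c theta M N : (M <= N)%N -> (forall k : int, M%:Z < `|k| -> c k = 0) ->
  cos_sum c theta N = cos_sum c theta M.
Proof.
move=> MN c0; apply: wsum_supp; [|lia|lia].
by move=> k hk; rewrite c0 ?mul0r //; lia.
Qed.

Lemma cos_sum_laplace c theta M : (forall k : int, M%:Z < `|k| -> c k = 0) ->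
  cos_sum (fun k : int => 2 * c k - c (k - 1) - c (k + 1)) theta M.+1
   = (2 - 2 * cos theta) * cos_sum c theta M.
Proof.
move=> c0; 
have H : forall (e : int), `|e| <= 1 ->
    wsum (fun k : int => c (k + e) * cos (k%:~R * theta)) (- M.+1%:Z) (M.+1 + 1 + M.+1)
    = wsum (fun k : int => c k * cos ((k - e)%:~R * theta)) (- M%:Z) (M + 1 + M).
  move=> e e1.
  transitivity (wsum (fun k : int => c k * cos ((k - e)%:~R * theta)) (- M.+1%:Z + e) (M.+1 + 1 + M.+1)).
    rewrite /wsum; apply: eq_bigr => i _; congr (c _ * cos (_%:~R * _)); lia.
  apply: wsum_supp; [|lia|lia].
  by move=> k hk; rewrite c0 ?mul0r //; lia.
transitivity (2 * wsum (fun k : int => c (k + 0) * cos (k%:~R * theta)) (- M.+1%:Z) (M.+1 + 1 + M.+1)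
    - wsum (fun k : int => c (k + - 1) * cos (k%:~R * theta)) (- M.+1%:Z) (M.+1 + 1 + M.+1)
    - wsum (fun k : int => c (k + 1) * cos (k%:~R * theta)) (- M.+1%:Z) (M.+1 + 1 + M.+1)).
  rewrite /cos_sum /wsum mulr_sumr -!sumrB; apply: eq_bigr => i _.
  by rewrite addr0; ring.
rewrite !H // /cos_sum /wsum !mulr_sumr -!sumrB; apply: eq_bigr => i _.
set k := - M%:Z + i%:Z; rewrite subr0 opprK.
have -> : (k - 1)%:~R * theta = k%:~R * theta - theta by rewrite intrB; ring.
have -> : (k + 1)%:~R * theta = k%:~R * theta + theta by rewrite intrD; ring.
by rewrite cosB cosD; ring.
Qed.

(** Values at the integers of the B-spline of degree [2d+1], counted from its centre. *)
Definition odd_knots d (k : int) : R := cardB (2 * d).+1 (k%:~R + d.+1%:R).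

Lemma odd_knots_even d (k : int) : odd_knots d (- k) = odd_knots d k.
Proof.
rewrite /odd_knots -[RHS]cardB_sym; congr cardB.
rewrite (_ : (2 * d).+2 = d.+1 + d.+1)%N; last by lia.
by rewrite natrD intrN; ring.
Qed.

Lemma odd_knots_out d (k : int) : d%:Z < `|k| -> odd_knots d k = 0.
Proof.
move=> dk; rewrite /odd_knots.
have -> : k%:~R + d.+1%:R = (0 + (2 * (k + d.+1%:Z))%:~R) / 2 :> R by rewrite intrM intrD; field.
rewrite cardB_hcell ?lexx ?ltr01 //.
case: (leP (2 * (k + d.+1%:Z)) 0) => k0; last by rewrite hcell_out ?horner0 //; lia.
have -> : 2 * (k + d.+1%:Z) = 2 * (k + d.+1%:Z) - 1 + 1 by lia.
by rewrite -hcell_cont hcell_out ?horner0 //; lia.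
Qed.

Lemma euler_sum_odd d theta :
  euler_sum (2 * d).+1 (theta / 2) = cos_sum (odd_knots d) theta d.
Proof.
rewrite -(@cos_sum_widen _ _ _ d.+1) //; last exact: odd_knots_out.
rewrite /cos_sum /wsum /euler_sum (_ : d.+1 + 1 + d.+1 = (2 * d).+3)%N; last by lia.
rewrite big_mkord; apply: eq_bigr => k _; rewrite /odd_knots; congr (cardB _ _ * cos _).
  by rewrite intrD intrN -[RHS]addrAC addNr add0r.
have -> : (2 * d).+2%:R = d.+1%:R + d.+1%:R :> R by rewrite -natrD; congr (_%:R); lia.
by rewrite intrD intrN; field.
Qed.

Lemma gsym0_cos_sum p theta : gsym p 0 theta = cos_sum (odd_knots p) theta p.
Proof.
rewrite cos_sumE; last by move=> k; exact: odd_knots_even.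
rewrite /gsym muln0 derive1n0 expr0 !mul1r mulr1 /odd_knots add0r; congr (_ + _ * _).
apply: eq_big_nat => k kp; congr (_ * _); rewrite -[RHS]cardB_sym; congr cardB.
rewrite (_ : (2 * p).+2 = p.+1 + p.+1)%N; last by lia.
by rewrite natrD; ring.
Qed.

Lemma derive2_cardB d : derive1n 2 (@cardB R d.+3) =
  fun x => cardB d.+1 x - 2 * cardB d.+1 (x - 1) + cardB d.+1 (x - 2).
Proof.
have D1 : (@cardB R d.+3)^`()%classic = dcardB 1 d.+3.
  apply/funext => x; rewrite derive1E.
  exact: (@derive_val _ _ _ _ _ _ _ (@is_derive_dcardB R 0 d.+3 x isT (or_introl isT))).
have D2 : (@dcardB R 1 d.+3)^`()%classic = dcardB 2 d.+3.
  apply/funext => x; rewrite derive1E.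
  exact: (@derive_val _ _ _ _ _ _ _ (@is_derive_dcardB R 1 d.+3 x isT (or_introl isT))).
rewrite !derive1nS derive1n0 D1 D2; apply/funext => x.
by rewrite /dcardB (_ : x - 1 - 1 = x - 2); ring.
Qed.

(** The second derivative of [N_(2p+1)] is the second difference of [N_(2p-1)], and taking second
    differences multiplies a cosine sum by [2 - 2 cos theta] up to sign. *)
Lemma gsym1_cos_sum p theta : (0 < p)%N ->
  gsym p 1 theta = (2 - 2 * cos theta) * cos_sum (odd_knots p.-1) theta p.-1.
Proof.
case: p => // d _ /=; rewrite -cos_sum_laplace; last exact: odd_knots_out.
have N2 (k : int) : derive1n 2 (@cardB R (2 * d.+1).+1) (d.+2%:R - k%:~R) =
    - (2 * odd_knots d k - odd_knots d (k - 1) - odd_knots d (k + 1)).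
  rewrite (_ : (2 * d.+1).+1 = (2 * d).+3)%N; last by lia.
  rewrite derive2_cardB -(odd_knots_even d k) -(odd_knots_even d (k - 1)) -(odd_knots_even d (k + 1)).
  rewrite /odd_knots !intrN intrB intrD -[d.+2%:R]natr1.
  rewrite (_ : d.+1%:R + 1 - k%:~R = - (k%:~R - 1) + d.+1%:R); last by ring.
  rewrite (_ : - (k%:~R - 1) + d.+1%:R - 1 = - k%:~R + d.+1%:R :> R); last by ring.
  rewrite (_ : - (k%:~R - 1) + d.+1%:R - 2 = - (k%:~R + 1) + d.+1%:R :> R); last by ring.
  by ring.
rewrite cos_sumE; last first.
  move=> k; rewrite odd_knots_even -(odd_knots_even _ (- k%:Z - 1)) -(odd_knots_even _ (- k%:Z + 1)).
  rewrite (_ : - (- k%:Z - 1) = k%:Z + 1); last by ring.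
  by rewrite (_ : - (- k%:Z + 1) = k%:Z - 1); ring.
rewrite /gsym expr1 muln1; have := N2 0; rewrite subr0 => ->; rewrite mulN1r opprK.
congr (_ + _); rewrite mulrN1 mulNr -mulrN; congr (_ * _).
rewrite -sumrN; apply: eq_bigr => k _.
by have := N2 k; rewrite -[k%:~R]/(k%:R) => ->; rewrite mulNr opprK.
Qed.

Lemma cot_form_even d phi : cot_form (2 * d).+1 phi =
  \sum_(j < d.+2) cot_coef (2 * d).+1 (2 * j) *
    ((cos phi ^+ 2) ^+ j * (sin phi ^+ 2) ^+ (d.+1 - j)).
Proof.
rewrite /cot_form (_ : (2 * d).+3 = (2 * d.+1).+1); last by lia.
rewrite (sum_even (F := fun k => cot_coef (2 * d).+1 k * (cos phi ^+ k * sin phi ^+ ((2 * d).+2 - k)))).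
  apply: eq_bigr => j _; rewrite -!exprM; congr (_ * (_ * _ ^+ _)); lia.
by move=> k kodd; rewrite cot_coef_odd ?mul0r //; lia.
Qed.

Lemma half_angle theta :
  cos (theta / 2) ^+ 2 = (1 + cos theta) / 2 /\ sin (theta / 2) ^+ 2 = (1 - cos theta) / 2.
Proof.
have E : theta = theta / 2 + theta / 2 by field.
have cE : cos theta = cos (theta / 2) ^+ 2 - sin (theta / 2) ^+ 2 by rewrite {1}E cosD -!expr2.
have := cos2Dsin2 (theta / 2); rewrite cE.
by move: (cos _ ^+ 2) (sin _ ^+ 2) => x y; split; lra.
Qed.

Lemma gsym0_form p theta : gsym p 0 theta =
  \sum_(j < p.+2) cot_coef (2 * p).+1 (2 * j) *
    (((1 + cos theta) / 2) ^+ j * ((1 - cos theta) / 2) ^+ (p.+1 - j)).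
Proof.
have [h1 h2] := half_angle theta.
by rewrite gsym0_cos_sum -euler_sum_odd euler_sumE cot_form_even h1 h2.
Qed.

Lemma gsym1_form p theta : (0 < p)%N -> gsym p 1 theta =
  4 * \sum_(j < p.+2) cot_coef (2 * p).-1 (2 * j) *
    (((1 + cos theta) / 2) ^+ j * ((1 - cos theta) / 2) ^+ (p.+1 - j)).
Proof.
case: p => // d _; have [h1 h2] := half_angle theta.
rewrite (_ : (2 * d.+1).-1 = (2 * d).+1); last by lia.
rewrite gsym1_cos_sum // -euler_sum_odd euler_sumE cot_form_even h1 h2.
(* The top term is 0 since [S_(2p)] has degree [2p]; it is there to give both symbols the same
   degree [p+1]. The factor [2 - 2 cos theta] supplies the missing power of the sine. *)
rewrite [in RHS]big_ord_recr /= [X in _ = _ * (_ + X)](_ : _ = 0); last first.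
  by rewrite cot_coef_out ?mul0r //; lia.
rewrite addr0 !mulr_sumr; apply: eq_bigr => j _.
have -> : (d.+2 - j = (d.+1 - j).+1)%N by rewrite subSn // -ltnS.
by rewrite exprS; field.
Qed.

Lemma cos_lt_bounds (theta1 theta2 : R) : 0 <= theta1 < theta2 -> theta2 <= pi ->
  [/\ cos theta2 < cos theta1, -1 <= cos theta2 & cos theta1 <= 1].
Proof.
move=> /andP[t1 t12] t2; split; [|exact: cos_geN1|exact: cos_le1].
by rewrite ltr_cos // in_itv /=; apply/andP; split; lra.
Qed.

Lemma gsym_ratio_mono p (theta1 theta2 : R) : (0 < p)%N ->
  0 <= theta1 < theta2 -> theta2 <= pi ->
  gsym p 1 theta1 * gsym p 0 theta2 < gsym p 1 theta2 * gsym p 0 theta1.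
Proof.
move=> p0 t12 t2; have [c12 c2 c1] := cos_lt_bounds t12 t2.
rewrite !gsym1_form // !gsym0_form -!mulrA ltr_pM2l ?ltr0n //.
apply: (ratio_mono_form (m := p.+1) (a := fun j => cot_coef (2 * p).-1 (2 * j))
  (b := fun j => cot_coef (2 * p).+1 (2 * j))).
- move=> j k /andP[jk _].
  have := @cot_coef_ratio R (2 * p).-1 (2 * j)%N (k - j)%N.
  have -> : (2 * j + 2 * (k - j) = 2 * k)%N by lia.
  by have -> : ((2 * p).-1.+2 = (2 * p).+1)%N by lia.
(* Strictness comes from the extreme coefficients: that of [x^(2p+2)] is 0 in [S_(2p)] but positive
   in [S_(2p+2)], and the constant one of [S_(2p)] is positive. *)
- rewrite cot_coef_out ?mul0r; last by lia.
  by rewrite mulr_gt0 // cot_coef_gt0 //; lia.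
- by apply/andP; split; lra.
- by apply/andP; split; lra.
Qed.

Lemma gsym0_gt0 p (theta : R) : 0 < gsym p 0 theta.
Proof.
have c1 := cos_geN1 theta; have c2 := cos_le1 theta.
rewrite gsym0_form; set x := _ / 2; set y := _ / 2.
have x0 : 0 <= x by rewrite /x; lra.
have y0 : 0 <= y by rewrite /y; lra.
have pos j : (j <= p.+1)%N -> 0 <= cot_coef (2 * p).+1 (2 * j) * (x ^+ j * y ^+ (p.+1 - j)).
  by move=> _; rewrite mulr_ge0 ?cot_coef_ge0 ?mulr_ge0 ?exprn_ge0.
rewrite big_ord_recl big_ord_recr /= expr0 subn0 /bump /= !add1n !subSS subnn expr0 mulr1 mul1r.
set S := \sum_(_ < _) _; have S0 : 0 <= S.
  by apply: sumr_ge0 => j _; rewrite mulr_ge0 ?cot_coef_ge0 ?mulr_ge0 ?exprn_ge0.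
have [y1|y1] := ltP 0 y.
  have : 0 < cot_coef (2 * p).+1 (2 * 0) * y ^+ p.+1 by rewrite mulr_gt0 ?exprn_gt0 // cot_coef_gt0 //; lia.
  have : 0 <= cot_coef (2 * p).+1 (2 * p.+1) * x ^+ p.+1 by rewrite mulr_ge0 ?cot_coef_ge0 ?exprn_ge0.
  lra.
have x1 : 0 < x by rewrite /x /y in y1 *; lra.
have : 0 <= cot_coef (2 * p).+1 (2 * 0) * y ^+ p.+1 by rewrite mulr_ge0 ?cot_coef_ge0 ?exprn_ge0.
have : 0 < cot_coef (2 * p).+1 (2 * p.+1) * x ^+ p.+1 by rewrite mulr_gt0 ?exprn_gt0 // cot_coef_gt0 //; lia.
lra.
Qed.

End Symbol.

(** * Linear algebra *)

Section Similarity.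
Context {R : realType}.
Variable n : nat.
Implicit Types (A B V T Z : 'M[R]_n).

Lemma char_poly_conj A B V : V \in unitmx -> A *m V = V *m B -> char_poly A = char_poly B.
Proof.
move=> Vu AV; pose W := map_mx polyC V.
have H : char_poly_mx A *m W = W *m char_poly_mx B.
  by rewrite /char_poly_mx mulmxBl mulmxBr -!map_mxM AV scalar_mxC.
have := congr1 determinant H; rewrite !det_mulmx /char_poly mulrC.
apply: mulfI; rewrite det_map_mx polyC_eq0.
by rewrite -unitfE -unitmxE.
Qed.

Lemma spectrum_diag (d : 'rV[R]_n) a : spectrum (diag_mx d) a = #|[pred j | d 0 j == a]|.
Proof.
rewrite /spectrum char_poly_trig ?diag_mx_is_trig //.
rewrite (eq_bigr (fun i => 'X - (d 0 i)%:P)); last by move=> i _; rewrite mxE eqxx.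
rewrite -(big_map (d 0) predT (fun y => 'X - y%:P)) mu_prod_XsubC count_map.
by rewrite -sum1_count -sum1_card; apply: eq_bigl => j; rewrite inE.
Qed.

Lemma spectrum_eigen A V (d : 'rV[R]_n) : V \in unitmx -> A *m V = V *m diag_mx d ->
  spectrum A =1 multiset_of (fun j => d 0 j).
Proof. by move=> Vu AV a; rewrite /spectrum (char_poly_conj Vu AV); exact: spectrum_diag. Qed.

Lemma unit_diag (d : 'rV[R]_n) : (forall j, d 0 j != 0) -> diag_mx d \in unitmx.
Proof. by move=> d0; rewrite unitmxE unitfE det_diag; apply/prodf_neq0 => j _. Qed.

(* In the eigenbasis V the inverse S of C C^T satisfies G0 S G1 = G1 S G0 with
   diagonal matrices G0, G1, so that S is diagonal when g1/g0 is injective. *)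
Lemma conj_commute (M K Mb Kb C V T : 'M[R]_n) (g0 g1 c : 'rV[R]_n) :
  V \in unitmx -> M *m V = V *m diag_mx g0 -> K *m V = V *m diag_mx g1 ->
  T *m V = V *m diag_mx c -> (forall j, g0 0 j != 0) ->
  (forall j l, g0 0 j * g1 0 l = g1 0 j * g0 0 l -> j = l) ->
  M = C *m Mb *m C^T -> K = C *m Kb *m C^T -> Mb *m Kb = Kb *m Mb ->
  C \in unitmx /\ (C *m C^T) *m T = T *m (C *m C^T).
Proof.
move=> Vu MV KV TV g00 ginj ME KE MKb.
have Mu : M \in unitmx.
  have : M *m V \in unitmx by rewrite MV unitmx_mul Vu unit_diag.
  by rewrite unitmx_mul => /andP[].
have Cu : C \in unitmx by move: Mu; rewrite ME !unitmx_mul => /andP[/andP[]].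
have Ctu : C^T \in unitmx by rewrite unitmx_tr.
split => //; set Z := C *m C^T.
have Zu : Z \in unitmx by rewrite unitmx_mul Cu.
pose S := invmx C^T *m invmx C.
have ZS : Z *m S = 1%:M by rewrite /Z /S mulmxA mulmxK // mulmxV.
have SZ : S *m Z = 1%:M by rewrite /Z /S mulmxA mulmxKV // mulVmx.
have sandwich A B : C *m A *m C^T *m S *m (C *m B *m C^T) = C *m (A *m B) *m C^T.
  by rewrite /S !mulmxA mulmxK // mulmxKV.
clearbody S; have MSK : M *m S *m K = K *m S *m M by rewrite ME KE !sandwich MKb.
pose Y := invmx V *m S *m V.
have SE : S = V *m Y *m invmx V by rewrite /Y !mulmxA mulmxV // mul1mx mulmxK.
clearbody Y; have GYG : diag_mx g0 *m Y *m diag_mx g1 = diag_mx g1 *m Y *m diag_mx g0.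
  have H (A B : 'M[R]_n) (a b : 'rV[R]_n) : A *m V = V *m diag_mx a -> B *m V = V *m diag_mx b ->
      V *m (diag_mx a *m Y *m diag_mx b) = A *m S *m B *m V.
    by move=> AV BV; rewrite !mulmxA -AV -[RHS]mulmxA BV SE !mulmxA mulmxKV.
  by rewrite -[LHS](mulKmx Vu) -[RHS](mulKmx Vu) (H _ _ _ _ MV KV) (H _ _ _ _ KV MV) // MSK.
have Ydiag j l : j != l -> Y j l = 0.
  move=> jl; have := congr1 (fun A : 'M[R]_n => A j l) GYG.
  rewrite !mul_mx_diag !mul_diag_mx !mxE => /eqP; rewrite -subr_eq0 => /eqP H.
  have : (g0 0 j * g1 0 l - g1 0 j * g0 0 l) * Y j l = 0 by rewrite -[RHS]H; ring.
  move/eqP; rewrite mulf_eq0 subr_eq0 => /orP[/eqP/ginj jE|/eqP//].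
  by rewrite jE eqxx in jl.
have Yc : Y *m diag_mx c = diag_mx c *m Y.
  apply/matrixP => j l; rewrite mul_mx_diag mul_diag_mx !mxE.
  by case: (eqVneq j l) => [->|jl]; [rewrite mulrC|rewrite Ydiag // mulr0 mul0r].
have TE : T = V *m diag_mx c *m invmx V by rewrite -TV mulmxK.
have ST : S *m T = T *m S.
  by rewrite SE TE !mulmxA mulmxKV // mulmxKV // -!mulmxA [X in _ *m X]mulmxA Yc !mulmxA.
by have := congr1 (fun A => Z *m A *m Z) ST; rewrite !mulmxA ZS mul1mx -!mulmxA SZ mulmx1 => ->.
Qed.

End Similarity.

(** * Tridiagonal matrices *)

Section Tridiagonal.
Context {R : realType}.
Variables (n : nat) (dg : nat -> R).

Definition tridiag : 'M[R]_n :=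
  \matrix_(j, l) ((j == l.+1 :> nat)%:R + (l == j.+1 :> nat)%:R + (j == l :> nat)%:R * dg j).

Lemma tridiag_sym : tridiag^T = tridiag.
Proof.
apply/matrixP => j l; rewrite !mxE [X in X + _]addrC; congr (_ + _).
by case: (eqVneq (j : nat) l) => [->//|]; rewrite !mul0r.
Qed.

Lemma sum_mul_eq_nat (f : nat -> R) (i : nat) :
  \sum_(l < n) f l * (l == i :> nat)%:R = if (i < n)%N then f i else 0.
Proof.
case: ltnP => iN; last by rewrite big1 // => l _; rewrite ltn_eqF ?mulr0 // (leq_trans _ iN).
rewrite (bigD1 (Ordinal iN)) //= eqxx mulr1 big1 ?addr0 // => l li.
by rewrite (_ : (l == i :> nat) = false) ?mulr0 //; apply: negbTE.
Qed.

Lemma sum_tridiag (f : nat -> R) (k : 'I_n) :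
  \sum_(l < n) f l * tridiag l k =
  (if (k.+1 < n)%N then f k.+1 else 0) + (if (k == 0 :> nat)%N then 0 else f k.-1) + f k * dg k.
Proof.
under eq_bigr => l _ do rewrite mxE !mulrDr.
rewrite !big_split /= sum_mul_eq_nat; congr (_ + _ + _).
- case: eqP => k0.
    by rewrite big1 // => l _; rewrite k0 mulr0.
  rewrite -[RHS](_ : (if (k.-1 < n)%N then f k.-1 else 0) = _); last first.
    by rewrite ifT //; have := ltn_ord k; lia.
  rewrite -sum_mul_eq_nat; apply: eq_bigr => l _.
  by congr (_ * _%:R); lia.
- rewrite -[RHS](_ : (if (k < n)%N then f k * dg k else 0) = _); last by rewrite ltn_ord.
  rewrite -(sum_mul_eq_nat (fun l => f l * dg l)); apply: eq_bigr => l _.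
  by rewrite -mulrA [dg l * _]mulrC.
Qed.

(* V^T V commutes with a diagonal matrix with distinct entries, hence is diagonal,
   and its diagonal entries are the squared norms of the columns of V. *)
Lemma tridiag_eigen_unit (V : 'M[R]_n) (c : 'rV[R]_n) :
  tridiag *m V = V *m diag_mx c -> injective (c 0) ->
  (forall k, exists j, V j k != 0) -> V \in unitmx.
Proof.
move=> TV cinj V0; pose W := V^T *m V.
have Wc : W *m diag_mx c = diag_mx c *m W.
  rewrite /W -mulmxA -TV; have := congr1 trmx TV.
  by rewrite !trmx_mul tridiag_sym tr_diag_mx mulmxA => ->; rewrite mulmxA.
have WE : W = diag_mx (\row_j W j j).
  apply/matrixP => j l; rewrite [RHS]mxE [in RHS]mxE; case: (eqVneq j l) => [->|jl]; first by rewrite mulr1n.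
  rewrite mulr0n; have := congr1 (fun A : 'M[R]_n => A j l) Wc.
  rewrite mul_mx_diag mul_diag_mx [LHS]mxE [RHS]mxE => /eqP; rewrite mulrC -subr_eq0 -mulrBl mulf_eq0.
  rewrite subr_eq0 => /orP[/eqP/cinj lj|/eqP //].
  by rewrite lj eqxx in jl.
have : W \in unitmx.
  rewrite WE unit_diag // => k; have [j Vj] := V0 k; rewrite !mxE.
  rewrite psumr_neq0; last by move=> i _; rewrite mxE -expr2 sqr_ge0.
  by apply/hasP; exists j; rewrite ?mem_index_enum //= mxE -expr2 exprn_even_gt0 /=.
by rewrite unitmx_mul => /andP[].
Qed.

(* In Z T = T Z the columns of Z - 1 satisfy a three-term recursion, which
   propagates the zero columns in the middle to both sides. *)
Lemma commute_tridiag_block (Z : 'M[R]_n) (a b : nat) :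
  (a < b <= n)%N -> Z *m tridiag = tridiag *m Z ->
  (forall k l : 'I_n, (a <= k < b)%N -> Z k l = (k == l)%:R) ->
  (forall k l : 'I_n, (a <= k < b)%N -> Z l k = (k == l)%:R) ->
  (forall k l : 'I_n, (k < a)%N -> (b <= l)%N -> Z k l = 0 /\ Z l k = 0) ->
  Z = 1%:M.
Proof.
move=> /andP[ab bn] ZT Zrow Zcol Zblk.
pose X := Z - 1%:M.
have XT : X *m tridiag = tridiag *m X by rewrite /X mulmxBl mulmxBr ZT mul1mx mulmx1.
(* Columns of [Z - 1] indexed by [nat] and extended by 0 beyond [n], so that the recursion may step
   to both neighbours. *)
pose x (j : 'I_n) (l : nat) := if insub l is Some o then X j o else 0.
have xE j (l : 'I_n) : x j l = X j l.
  by rewrite /x; case: insubP => [w _ wl|]; rewrite ?ltn_ord //; congr (X _ _); apply: val_inj.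
have Xrow (j : 'I_n) l : (a <= j < b)%N -> x j l = 0.
  move=> jm; rewrite /x; case: insubP => // o _ _.
  by rewrite !mxE Zrow // subrr.
have Xcol (j : 'I_n) l : (a <= l < b)%N -> x j l = 0.
  move=> lm; rewrite /x; case: insubP => // o _ ol.
  by rewrite !mxE Zcol ?ol // [j == o]eq_sym subrr.
have Xblk1 (j : 'I_n) (l : nat) : (j < a)%N -> (b <= l)%N -> x j l = 0.
  move=> ja bl; rewrite /x; case: insubP => // o _ ol.
  have bo : (b <= o)%N by rewrite ol.
  have [Zjo _] := Zblk j o ja bo.
  rewrite !mxE Zjo (_ : (j == o) = false) ?subr0 //.
  by apply/eqP => jo; move: ja; rewrite jo ol; lia.
have Xblk2 (j : 'I_n) (l : nat) : (l < a)%N -> (b <= j)%N -> x j l = 0.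
  move=> la bj; rewrite /x; case: insubP => // o _ ol.
  have oa : (o < a)%N by rewrite ol.
  have [_ Zjo] := Zblk o j oa bj.
  rewrite !mxE Zjo (_ : (j == o) = false) ?subr0 //.
  by apply/eqP => jo; move: bj; rewrite jo ol; lia.
(* A zero column [k] of [X] is also one of [tridiag *m X]; in [X *m tridiag] it then says that
   columns [k-1] and [k+1] are opposite. *)
have rec (k : nat) : (k < n)%N -> (forall j, x j k = 0) -> forall j,
    (if (k.+1 < n)%N then x j k.+1 else 0) + (if (k == 0)%N then 0 else x j k.-1) = 0.
  move=> kn xk j; have := congr1 (fun A : 'M[R]_n => A j (Ordinal kn)) XT.
  rewrite !mxE [RHS]big1; last by move=> l _; rewrite -xE xk mulr0.
  under eq_bigr => l _ do rewrite -xE.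
  by rewrite sum_tridiag /= xk mul0r addr0.
have up (l : nat) : (a <= l < n)%N -> forall j, x j l = 0.
  have [m] := ubnP l; elim: m l => // m IH l lm /andP[al ln] j.
  case: (ltnP l b) => lb; first by apply: Xcol; rewrite al.
  have l0 : (0 < l)%N by lia.
  have l1n : (l.-1 < n)%N by lia.
  have xl1 j' : x j' l.-1 = 0 by apply: IH; lia.
  have := rec l.-1 l1n xl1 j; rewrite prednK // ln.
  case: eqP => l1; first by rewrite addr0.
  (* If the middle block is a single column, column [l.-2] may still be unknown. The block shape
     helps: in each row one of the two opposite entries is 0. *)
  suff [-> //|->] : x j l = 0 \/ x j l.-2 = 0 by rewrite addr0.
  case: (leqP a l.-2) => al2; first by right; apply: IH; lia.
  case: (ltnP j a) => ja; first by left; apply: Xblk1; lia.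
  case: (ltnP j b) => jb; first by left; apply: Xrow; lia.
  by right; apply: Xblk2; lia.
have down (m : nat) : (m <= a)%N -> forall j, x j (a - m)%N = 0.
  elim: m {-2}m (leqnn m) => [|m IH] m' mm' ma j; first by apply: up; lia.
  case: (posnP m') => [->|m0]; first by rewrite subn0; apply: up; lia.
  have kn : (a - m'.-1 < n)%N by lia.
  have xk j' : x j' (a - m'.-1)%N = 0 by apply: IH; lia.
  have := rec _ kn xk j.
  rewrite (_ : (a - m'.-1 == 0)%N = false); last by lia.
  rewrite (_ : (a - m'.-1).-1 = (a - m')%N); last by lia.
  case: ltnP => h; last by rewrite add0r.
  suff [-> //|->] : x j (a - m')%N = 0 \/ x j (a - m'.-1).+1 = 0 by rewrite add0r.
  case: (ltnP 1 m') => m1.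
    right; rewrite (_ : (a - m'.-1).+1 = (a - m'.-2)%N); last by lia.
    by apply: IH; lia.
  case: (ltnP (a - m'.-1).+1 b) => hb; first by right; apply: up; lia.
  case: (ltnP j a) => ja; first by right; apply: Xblk1; lia.
  case: (ltnP j b) => jb; first by left; apply: Xrow; lia.
  by left; apply: Xblk2; lia.
apply/eqP; rewrite -subr_eq0 -/X; apply/eqP/matrixP => j l; rewrite -xE [RHS]mxE.
case: (leqP a l) => al; first by apply: up; rewrite al ltn_ord.
by have := down (a - l)%N (leq_subr _ _) j; rewrite subKn // ltnW.
Qed.

End Tridiagonal.

(** * Splines on [0,1] *)

Section Deriv01.
Context {R : realType}.
Implicit Types (f g : R -> R) (x y d : R) (k : nat).

Lemma quot01P f x (P : set R) : quot01 f x P <->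
  (\forall y \near x, y != x -> y \in `[0, 1] -> P ((f y - f x) / (y - x))).
Proof. by []. Qed.

Lemma within01_proper x : x \in `[0, 1] -> ProperFilter (within `[0, 1]%classic x^').
Proof.
rewrite in_itv /= => /andP[x0 x1].
apply: Build_ProperFilter_ex => P [e /= e0 He].
pose h := Num.min e 1 / 2.
have h0 : 0 < h by rewrite divr_gt0 // lt_min e0 ltr01.
have he : h < e by have := ge_min e e 1; rewrite lexx /h; lra.
have h1 : h <= 2^-1 by have := ge_min 1 e 1; rewrite lexx orbT /h; lra.
case: (lerP x 2^-1) => x2.
  exists (x + h); apply: (He (x + h)) => /=.
  - by rewrite opprD addrA subrr add0r normrN ger0_norm // ltW.
  - by rewrite -subr_eq0 addrAC subrr add0r gt_eqF.
  - by rewrite in_itv /=; apply/andP; split; lra.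
exists (x - h); apply: (He (x - h)) => /=.
- by rewrite opprB addrC subrK ger0_norm // ltW.
- by rewrite -subr_eq0 addrAC subrr add0r oppr_eq0 gt_eqF.
- by rewrite in_itv /=; apply/andP; split; lra.
Qed.

Lemma quot01_eq f g x : x \in `[0, 1] -> {in `[0, 1], f =1 g} -> quot01 f x = quot01 g x.
Proof.
move=> x01 fg; apply/seteqP; split => P /quot01P H; apply/quot01P; move: H;
  by apply: filterS => y H yx y01; move: (H yx y01); rewrite !fg.
Qed.

Lemma D01_eq f g : {in `[0, 1], f =1 g} -> {in `[0, 1], D01 f =1 D01 g}.
Proof. by move=> fg x x01; rewrite /D01 (quot01_eq x01 fg). Qed.

Lemma D01n_eq k f g : {in `[0, 1], f =1 g} -> {in `[0, 1], D01n k f =1 D01n k g}.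
Proof. by move=> fg; elim: k => //= k IH; exact: D01_eq. Qed.

Lemma quot01_is_derive f x d : is_derive x 1 f d -> quot01 f x --> d.
Proof.
move=> /is_derive1_caratheodory[g [fg gc <-]].
apply/cvgrPdist_lt => e e0.
have gce : \forall y \near x, `|g x - g y| < e by move/cvgrPdist_lt: gc; apply.
apply: (quot01P f x (fun t => `|g x - t| < e)).2; move: gce; apply: filterS => y H yx _ /=.
by rewrite fg mulfK // subr_eq0.
Qed.

Lemma D01_is_derive f x d : x \in `[0, 1] -> is_derive x 1 f d -> D01 f x = d.
Proof.
move=> x01 fd; have := within01_proper x01 => ?.
by apply/cvg_lim => //; exact: (quot01_is_derive fd).
Qed.

Lemma quot01_cvg_continuous f x : cvg (quot01 f x) ->
  f @ within `[0, 1]%classic (nbhs x) --> f x.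
Proof.
move=> /cvg_ex[l /= Hl]; apply/cvgrPdist_lt => e e0.
move/cvgrPdist_lt: Hl => /(_ 1 ltr01) Hl.
have H := (quot01P f x (fun t => `|l - t| < 1)).1 Hl.
pose c := `|l| + 1; have c0 : 0 < c by rewrite ltr_wpDl.
have ec0 : 0 < e / c by rewrite divr_gt0.
have B : \forall y \near x, `|x - y| < e / c by exists (e / c).
rewrite near_withinE; move: H B; apply: filterS2 => y H B y01 /=.
case: (eqVneq y x) => [->|yx]; first by rewrite subrr normr0.
move: (H yx y01) => {}H; have yx0 : y - x != 0 by rewrite subr_eq0.
have -> : f x - f y = (f y - f x) / (y - x) * (x - y) by field.
have qc : `|(f y - f x) / (y - x)| <= c.
  rewrite -[_ / _](subrK l) (le_trans (ler_normD _ _)) // /c addrC lerD2l distrC ltW //.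
by rewrite normrM (le_lt_trans (ler_wpM2r _ qc)) // mulrC -ltr_pdivlMr.
Qed.

Lemma D01n_piece f (P : {poly R}) (a b : R) : 0 <= a -> b <= 1 ->
  (forall x, a < x < b -> f x = P.[x]) ->
  forall k x, a < x < b -> D01n k f x = P^`(k).[x].
Proof.
move=> a0 b1 fP; elim=> [|k IH] x xab; first by rewrite derivn0 -fP.
rewrite derivnS; apply: D01_is_derive.
  by rewrite in_itv /=; apply/andP; split; lra.
apply: near_eq_is_derive (is_derive_poly _ _).
case/andP: (xab) => /near_gt ax /near_lt xb.
by move: ax xb; apply: filterS2 => y ay yb; rewrite -IH // ay yb.
Qed.

Lemma C01_continuous q f k x : C01 q f -> (k <= q)%N -> x \in `[0, 1] ->
  D01n k f @ within `[0, 1]%classic (nbhs x) --> D01n k f x.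
Proof.
move=> [fq fc]; rewrite leq_eqVlt => /orP[/eqP->|kq] x01.
  by move/subspace_continuousP: fc; apply; move: x01; rewrite in_itv.
by apply: quot01_cvg_continuous; exact: fq.
Qed.

(** Inside the piece the derivatives are those of [P]; continuity of [D01n k f] on [0,1] carries
    them to the ends, where [D01] also sees the neighbouring piece. *)
Lemma C01_piece_end q f (P : {poly R}) (a b : R) k : 0 <= a < b -> b <= 1 -> C01 q f ->
  (forall x, a < x < b -> f x = P.[x]) -> (k <= q)%N ->
  D01n k f a = P^`(k).[a] /\ D01n k f b = P^`(k).[b].
Proof.
move=> /andP[a0 ab] b1 fq fP kq.
have DP := D01n_piece a0 b1 fP k.
have ca : D01n k f @ within `[0, 1]%classic (nbhs a) --> D01n k f a.
  by apply: C01_continuous kq _ => //; rewrite in_itv /=; apply/andP; split; lra.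
have cb : D01n k f @ within `[0, 1]%classic (nbhs b) --> D01n k f b.
  by apply: C01_continuous kq _ => //; rewrite in_itv /=; apply/andP; split; lra.
split.
  have c1 : D01n k f @ a^'+ --> D01n k f a.
    apply: cvg_trans ca; apply: cvg_app => A AH; have H : \forall y \near a, `[0, 1]%classic y -> A y := AH.
    suff : \forall y \near a, a < y -> A y by [].
    move: H (near_lt ab); apply: filterS2 => y H yb ay; apply: H.
    by rewrite /= in_itv /=; apply/andP; split; lra.
  have c2 : D01n k f @ a^'+ --> P^`(k).[a].
    have : horner P^`(k) @ a^'+ --> P^`(k).[a].
      by apply: cvg_at_right_filter; exact: continuous_horner.
    apply: cvg_trans; apply: near_eq_cvg; rewrite near_withinE.
    by have := near_lt ab; apply: filterS => y yb ay; rewrite DP // ay yb.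
  exact: (cvg_unique _ c1 c2).
have c1 : D01n k f @ b^'- --> D01n k f b.
  apply: cvg_trans cb; apply: cvg_app => A AH; have H : \forall y \near b, `[0, 1]%classic y -> A y := AH.
  suff : \forall y \near b, y < b -> A y by [].
  move: H (near_gt ab); apply: filterS2 => y H ya yb; apply: H.
  by rewrite /= in_itv /=; apply/andP; split; lra.
have c2 : D01n k f @ b^'- --> P^`(k).[b].
  have : horner P^`(k) @ b^'- --> P^`(k).[b].
    by apply: cvg_at_left_filter; exact: continuous_horner.
  apply: cvg_trans; apply: near_eq_cvg; rewrite near_withinE.
  by have := near_gt ab; apply: filterS => y ya yb; rewrite DP // ya yb.
exact: (cvg_unique _ c1 c2).
Qed.

Lemma poly_truncated_power (W : {poly R}) (b : R) p : (size W <= p.+1)%N ->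
  (forall k, (k < p)%N -> W^`(k).[b] = 0) -> exists c, W = c *: ('X - b%:P) ^+ p.
Proof.
move=> sW W0; exists W^`N(p).[b]; apply: poly_ext => x.
rewrite -{1}(subrKC b x) (nderiv_taylor_wide (mulrC _ _) sW).
rewrite big_ord_recr /= big1 ?add0r; first by rewrite hornerZ horner_exp hornerXsubC.
move=> i _; have := W0 i (ltn_ord i); rewrite nderivn_def hornerMn => /eqP.
by rewrite mulrn_eq0 eqn0Ngt fact_gt0 /= => /eqP ->; rewrite mul0r.
Qed.

(** All derivatives of order below [p] agree at the knot, so the Taylor expansion of [Q - P] there
    is reduced to its last term. *)
Lemma piece_jump p f (P Q : {poly R}) (a b c : R) : (0 < p)%N ->
  0 <= a < b -> b < c <= 1 -> C01 p.-1 f ->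
  (size P <= p.+1)%N -> (size Q <= p.+1)%N ->
  (forall x, a < x < b -> f x = P.[x]) -> (forall x, b < x < c -> f x = Q.[x]) ->
  exists e, Q - P = e *: ('X - b%:P) ^+ p.
Proof.
move=> p0 /andP[a0 ab] /andP[bc c1] fC sP sQ fP fQ.
apply: poly_truncated_power.
  by rewrite (leq_trans (size_polyD _ _)) // size_polyN geq_max sQ sP.
move=> k kp; have kp1 : (k <= p.-1)%N by lia.
have h1 : 0 <= a < b by rewrite a0 ab.
have h2 : 0 <= b < c by apply/andP; split; lra.
have b1 : b <= 1 by lra.
have [_ Pb] := C01_piece_end h1 b1 fC fP kp1.
have [Qb _] := C01_piece_end h2 c1 fC fQ kp1.
by rewrite derivnB !hornerE -Pb -Qb subrr.
Qed.

End Deriv01.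

(** * Spectra of the reference basis *)

Section ReferenceFunctions.
Context {R : realType}.
Implicit Types (x y t : R).

Lemma cardB_out_closed (d : nat) x : (x <= 0) || (d.+2%:R <= x) -> cardB d.+1 x = 0.
Proof.
case/orP => [|xd]; last by rewrite cardB_out // xd orbT.
rewrite le_eqVlt => /orP[/eqP->|x0]; last by rewrite cardB_out // x0.
by rewrite -cardB_sym subr0 cardB_out // lexx orbT.
Qed.

Section Fold.
Variables (p n : nat) (e0 e1 : bool).
Local Notation s0 := ((-1) ^+ e0 : R).
Local Notation s1 := ((-1) ^+ e1 : R).
Local Notation A := (p.+2 - e0)%N.
Local Notation w := (2 * n + e0 + e1)%N.

(** By the symmetry of [N_p] its mirror images are translates, so the derivative of order [a] keeps
    the signs [s0] and [s1]. *)
Definition fold_fun (a j : nat) y : R :=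
  dcardB a p (y - j%:R) + s0 * dcardB a p (y - ((1 - e0)%:R - j%:R))
  + s1 * dcardB a p (y - ((2 * n + 1 + e1)%:R - j%:R)).

(* Coordinate in which the j-th reference function has the support [j, j+p+1]
   before folding, whatever the index of the space and the parity of p. *)
Definition ycoord x : R := w%:R / 2 * x + A%:R / 2.

Lemma ycoord0 : ycoord 0 = A%:R / 2.
Proof. by rewrite /ycoord mulr0 add0r. Qed.

Lemma ycoord1 : ycoord 1 = (p.+2 + 2 * n + e1)%N%:R / 2.
Proof.
rewrite /ycoord mulr1 -mulrDl -natrD; congr (_%:R / _); lia.
Qed.

Lemma fold_fun_cell (j : nat) (k : int) t : 0 <= t < 1 ->
  fold_fun 0 j ((t + k%:~R) / 2) = (fold_cell n e0 e1 (@hcell R p) j%:Z k).[t].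
Proof.
move=> t01; rewrite /fold_cell !hE -!cardB_hcell // /fold_fun /=.
rewrite !intrD !intrN !intrM !intrD !intrN.
by congr (_ + _ * _ + _ * _); congr cardB; field.
Qed.

(** In this coordinate [0,1] consists of [w] half cells, starting with cell [A]; integrals over it
    become the sums of [gram_cell]. *)
Lemma ycoord_cell (k : nat) t : (0 < w)%N ->
  ycoord ((t + k%:R) / w%:R) = (t + (A + k)%N%:Z%:~R) / 2.
Proof.
rewrite -(ltr0n R) /ycoord => w0.
rewrite (_ : (A + k)%N%:Z%:~R = A%:R + k%:R :> R); last by rewrite -natrD.
by move: w%:R A%:R w0 => W a w0; field; rewrite gt_eqF.
Qed.

Lemma deriv_fold_cell j k : (fold_cell n e0 e1 (@hcell R p) j k)^`() =
  fold_cell n e0 e1 (fun k => (hcell p k)^`()) j k.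
Proof. by rewrite /fold_cell !derivD !derivZ. Qed.

Section Matrices.
Variable b : 'I_n -> R -> R.
Hypothesis bE : forall k x, x \in `[0, 1] -> b k x = fold_fun 0 k.+1 (ycoord x).
Hypothesis w0 : (0 < w)%N.

Let w0R : 0 < w%:R :> R. Proof. by rewrite ltr0n. Qed.

Lemma fold_cell_itv (k : nat) t : (k < w)%N -> 0 < t < 1 ->
  0 < (t + k%:R) / w%:R < 1.
Proof.
move=> kw /andP[t0 t1]; apply/andP; split.
  by rewrite divr_gt0 // ltr_pwDl // ler0n.
rewrite ltr_pdivrMr // mul1r.
by have : k.+1%:R <= w%:R :> R; [rewrite ler_nat|rewrite -natr1; lra].
Qed.

Lemma fold_basis_cell (l : 'I_n) (k : nat) t : (k < w)%N -> 0 < t < 1 ->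
  b l ((t + k%:R) / w%:R) = (fold_cell n e0 e1 (@hcell R p) l.+1%:Z (A + k)%N%:Z).[t].
Proof.
move=> kw t01; have /andP[x0 x1] := fold_cell_itv kw t01.
rewrite bE; last by rewrite in_itv /= !ltW.
rewrite ycoord_cell // fold_fun_cell //; case/andP: t01 => t0 ->.
by rewrite ltW.
Qed.

Lemma D01_fold_basis_cell (l : 'I_n) (k : nat) t : (k < w)%N -> 0 < t < 1 ->
  D01 (b l) ((t + k%:R) / w%:R) =
   w%:R * (fold_cell n e0 e1 (fun k => (hcell p k)^`()) l.+1%:Z (A + k)%N%:Z).[t].
Proof.
move=> kw t01; have /andP[x0 x1] := fold_cell_itv kw t01.
apply: D01_is_derive; first by rewrite in_itv /= !ltW.
set P := fold_cell n e0 e1 (@hcell R p) l.+1%:Z (A + k)%N%:Z.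
have H x : is_derive x 1 (horner (P \Po (w%:R *: 'X - k%:R%:P))) (w%:R * P^`().[w%:R * x - k%:R]).
  apply: is_derive_eq; rewrite deriv_comp derivB derivZ derivX derivC subr0 !hE horner_comp !hE.
  by rewrite mulr1 mulrC.
have := H ((t + k%:R) / w%:R).
have -> : w%:R * ((t + k%:R) / w%:R) - k%:R = t by rewrite mulrC divfK ?gt_eqF // addrK.
rewrite /P deriv_fold_cell -/P => {}H; apply: near_eq_is_derive H.
have B1 : k%:R / w%:R < (t + k%:R) / w%:R by rewrite ltr_pM2r ?invr_gt0 //; lra.
have B2 : (t + k%:R) / w%:R < k.+1%:R / w%:R by rewrite ltr_pM2r ?invr_gt0 // -natr1; lra.
move: (near_gt B1) (near_lt B2); apply: filterS2 => y y1 y2.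
rewrite horner_comp (_ : (w%:R *: 'X - k%:R%:P).[y] = w%:R * y - k%:R); last by rewrite !hE.
rewrite /P -fold_basis_cell //; first by rewrite subrK mulrC mulKf ?gt_eqF.
move: y1 y2; rewrite ltr_pdivrMr // ltr_pdivlMr // -natr1; lra.
Qed.

Let grid (k : nat) : R := k%:R / w%:R.

Let gridS k : grid k.+1 - grid k = w%:R^-1.
Proof. by rewrite /grid -mulrBl -natr1 addrAC subrr add0r mul1r. Qed.

Let grid_lt k : grid k < grid k.+1.
Proof. by rewrite -subr_gt0 gridS invr_gt0. Qed.

Lemma int_grid (f : R -> R) (P : nat -> {poly R}) :
  (forall k t, (k < w)%N -> 0 < t < 1 -> f ((t + k%:R) / w%:R) = (P k).[t]) ->
  \int[lebesgue_measure]_(x in `[0, 1]) f x = w%:R^-1 * \sum_(0 <= k < w) unit_int (P k).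
Proof.
move=> fP.
have g0 : grid 0 = 0 by rewrite /grid mul0r.
have g1 : grid w = 1 by rewrite /grid divff ?gt_eqF.
have gE k t : grid k + w%:R^-1 * t = (t + k%:R) / w%:R.
  by rewrite /grid [RHS]mulrDl [w%:R^-1 * t]mulrC addrC.
have gS := gridS; have gl := grid_lt.
move: (grid) g0 g1 gE gS gl => g g0 g1 gE gS gl.
have := @Rintegral_piecewise _ w g f P (fun k _ => gl k); rewrite g0 g1 => ->.
  by rewrite mulr_sumr; apply: eq_bigr => k _; rewrite gS.
by move=> k kw t t01; rewrite gS gE fP.
Qed.

Lemma sum_cells (F : nat -> R) :
  \sum_(A <= k < p.+2 + 2 * n + e1) F k = \sum_(0 <= k < w) F (A + k)%N.
Proof.
rewrite -{1}[A]add0n big_addn (_ : p.+2 + 2 * n + e1 - A = w)%N; last by lia.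
by apply: eq_bigr => c _; rewrite addnC.
Qed.

Lemma mass_fold : mass b = \matrix_(k, l)
  (w%:R^-1 * gram_cell p n e0 e1 (@hcell R p) k.+1%:Z l.+1%:Z).
Proof.
apply/matrixP => k l; rewrite !mxE.
rewrite (@int_grid _ (fun c => fold_cell n e0 e1 (@hcell R p) k.+1%:Z (A + c)%N%:Z
   * fold_cell n e0 e1 (@hcell R p) l.+1%:Z (A + c)%N%:Z)).
  by congr (_ * _); rewrite /gram_cell sum_cells.
by move=> c t cw t01; rewrite !fold_basis_cell // hornerM mulrC.
Qed.

Lemma stiffness_fold : stiffness b = \matrix_(k, l)
  (w%:R * gram_cell p n e0 e1 (fun c => (hcell p c)^`()) k.+1%:Z l.+1%:Z).
Proof.
apply/matrixP => k l; rewrite !mxE.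
set ph := fun c => (@hcell R p c)^`().
rewrite (@int_grid _ (fun c => (w%:R * w%:R) *: (fold_cell n e0 e1 ph k.+1%:Z (A + c)%N%:Z
   * fold_cell n e0 e1 ph l.+1%:Z (A + c)%N%:Z))).
  under eq_bigr => c _ do rewrite unit_intZ.
  by rewrite -mulr_sumr mulrA mulKf ?gt_eqF // /gram_cell sum_cells.
move=> c t cw t01; rewrite !D01_fold_basis_cell // hornerZ hornerM; ring.
Qed.

End Matrices.
End Fold.
End ReferenceFunctions.

(** * Sampled sines and cosines as eigenvectors *)

Section Spectral.
Context {R : realType}.
Variables (p n : nat) (e0 e1 : bool).
Hypotheses (p0 : (0 < p)%N) (pn : (p < n)%N).
Local Notation w := (2 * n + e0 + e1)%N.
Local Notation s0 := ((-1) ^+ e0 : R).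
Local Notation s1 := ((-1) ^+ e1 : R).

Definition angle (k : nat) : R := (2 * k + e0 + e1)%:R * pi / w%:R.

(** Centred at [(1 - e0)/2], the fixed point of the left reflection, where a sine is odd and a
    cosine is even. *)
Definition mode (th : R) (j : int) : R :=
  let phi := (j%:~R - (1 - e0)%:R / 2) * th in if e0 then sin phi else cos phi.

Lemma cos_sin_mulpi (m : nat) : cos (m%:R * pi : R) = (-1) ^+ m /\ sin (m%:R * pi : R) = 0.
Proof.
elim: m => [|m [c s]]; first by rewrite mul0r cos0 sin0 expr0.
by rewrite -natr1 mulrDl mul1r cosDpi sinDpi c s oppr0 exprS mulN1r.
Qed.

Lemma w_gt0 : (0 < w)%N. Proof. by lia. Qed.

Lemma mode_left th (j : int) : mode th ((1 - e0)%N%:Z - j) = s0 * mode th j.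
Proof.
rewrite /mode intrD intrN; set c := (1 - e0)%:R.
have -> : (c - j%:~R - c / 2) * th = - ((j%:~R - c / 2) * th) by field.
by case: (e0); rewrite ?sinN ?cosN ?expr1 ?expr0 ?mulN1r ?mul1r.
Qed.

(** The two reflections differ by the translation by [w], along which the phase grows by
    [(2k + e0 + e1) pi]: this is what determines the angles. *)
Lemma mode_right (k : nat) (j : int) :
  mode (angle k) ((2 * n + 1 + e1)%N%:Z - j) = s1 * mode (angle k) j.
Proof.
rewrite /mode intrD intrN; set c := (1 - e0)%:R.
have wE : (2 * n + 1 + e1)%N%:Z%:~R = w%:R + c :> R.
  by rewrite -natrD; congr (_%:R); case: (e0); lia.
have -> : ((2 * n + 1 + e1)%N%:Z%:~R - j%:~R - c / 2) * angle k
    = (2 * k + e0 + e1)%:R * pi - (j%:~R - c / 2) * angle k.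
  have <- : w%:R * angle k = (2 * k + e0 + e1)%:R * pi.
    by rewrite /angle mulrC divfK // pnatr_eq0 -lt0n w_gt0.
  by rewrite wE; field.
have [cm sm] := cos_sin_mulpi (2 * k + e0 + e1).
rewrite sinB cosB cm sm !mul0r addr0 sub0r.
have -> : (-1) ^+ (2 * k + e0 + e1) = s0 * s1 :> R by rewrite exprD exprD exprM sqrrN expr1n expr1n mul1r.
by case: (e0); rewrite ?expr1 ?expr0 ?mul1r //; ring.
Qed.

Lemma mode_add th (j : int) (u : nat) :
  mode th (j + u%:Z) + mode th (j - u%:Z) = 2 * cos (u%:R * th) * mode th j.
Proof.
rewrite /mode intrB intrD; set c := (1 - e0)%:R.
have -> : (j%:~R + u%:~R - c / 2) * th = (j%:~R - c / 2) * th + u%:R * th by ring.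
have -> : (j%:~R - u%:~R - c / 2) * th = (j%:~R - c / 2) * th - u%:R * th by ring.
by case: (e0); rewrite ?sinD ?cosD ?cosN ?sinN; ring.
Qed.

Definition mode_mx : 'M[R]_n := \matrix_(j, k) mode (angle k) j.+1%:Z.

(* At an end with an even reflection the value outside equals the last value
   inside, which adds 1 to the diagonal. *)
Definition corner (j : nat) : R := ((j == 0%N) && ~~ e0)%:R + ((j.+1 == n) && ~~ e1)%:R.

Lemma tridiag_mode_mx :
  tridiag n corner *m mode_mx = mode_mx *m diag_mx (\row_k (2 * cos (angle k))).
Proof.
apply/matrixP => j k; rewrite mul_mx_diag !mxE.
pose v (l : nat) := mode (angle k) l.+1%:Z.
rewrite (eq_bigr (fun l : 'I_n => v l * tridiag n corner l j)); last first.
  move=> l _; rewrite [mode_mx l k]mxE mulrC; congr (_ * _).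
  by have := congr1 (fun A : 'M[R]_n => A j l) (tridiag_sym n corner); rewrite mxE => ->.
rewrite sum_tridiag /v [RHS]mulrC; have := mode_add (angle k) j.+1%:Z 1; rewrite mul1r => <-.
have gap (e : bool) c : (forall t, mode (angle k) (c - t) = (-1) ^+ e * mode (angle k) t) ->
    e -> forall t, 2 * t = c -> mode (angle k) t = 0.
  move=> vc; case: e vc => // vc _ t tc.
  by have := vc t; rewrite -tc (_ : 2 * t - t = t); [rewrite expr1; lra|lia].
have L : (if (j == 0 :> nat)%N then 0 else mode (angle k) j.-1.+1%:Z)
    + mode (angle k) j.+1%:Z * ((j == 0 :> nat)%N && ~~ e0)%:R = mode (angle k) (j.+1%:Z - 1%:Z).
  case: eqP => [j0|/eqP j0] /=; last first.
    by rewrite mulr0 addr0 prednK ?lt0n //; congr mode; lia.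
  have := mode_left (angle k); case: (e0) (gap e0 _ (mode_left (angle k))) => /= gp Hl.
    by rewrite mulr0 addr0 j0 (gp isT (1 - 1)) //; lia.
  by rewrite mulr1 add0r j0 -[1%:Z - 1%:Z]/(1%N%:Z - 1%:Z) Hl expr0 mul1r.
have H : (if (j.+1 < n)%N then mode (angle k) j.+2%:Z else 0)
    + mode (angle k) j.+1%:Z * ((j.+1 == n :> nat)%N && ~~ e1)%:R = mode (angle k) (j.+1%:Z + 1%:Z).
  case: eqP => [jn|/eqP jn] /=; last first.
    rewrite mulr0 addr0 ifT; first by congr mode; lia.
    by have := ltn_ord j; lia.
  rewrite ifF; last by lia.
  rewrite add0r; have := mode_right k; have := gap e1 _ (mode_right k); case: (e1) => /= gp Hr.
    by rewrite mulr0 (gp isT (j.+1%:Z + 1%:Z)) //; lia.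
  rewrite mulr1 -[LHS]mul1r -[1 * _]/((-1) ^+ false * _) -Hr; congr mode; lia.
by rewrite -L -H /corner mulrDr; ring.
Qed.

Lemma angle_itv (k : nat) : (k < n)%N -> 0 <= angle k <= pi.
Proof.
move=> kn; rewrite /angle; apply/andP; split.
  by rewrite divr_ge0 ?mulr_ge0 ?ler0n ?pi_ge0.
rewrite ler_pdivrMr ?ltr0n ?w_gt0 // mulrC ler_wpM2l ?pi_ge0 // ler_nat; lia.
Qed.

Lemma angle_lt (k l : nat) : (k < l)%N -> angle k < angle l.
Proof.
move=> kl; rewrite /angle ltr_pM2r ?invr_gt0 ?ltr0n ?w_gt0 //.
by rewrite ltr_pM2r ?pi_gt0 // ltr_nat; lia.
Qed.

Lemma mode_mx_unit : mode_mx \in unitmx.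
Proof.
apply: (tridiag_eigen_unit tridiag_mode_mx).
  move=> k l; rewrite !mxE => /mulfI; rewrite pnatr_eq0 => /(_ isT) ckl.
  apply: val_inj.
  have inj (a b : 'I_n) : (a < b)%N -> cos (angle a) <> cos (angle b).
    move=> ab; have /andP[a0 _] := angle_itv (ltn_ord a); have /andP[_ b1] := angle_itv (ltn_ord b).
    have [|c _ _] := @cos_lt_bounds _ (angle a) (angle b) _ b1; first by rewrite a0 angle_lt.
    by move=> E; rewrite E ltxx in c.
  by case: (ltngtP k l) => // [kl|lk]; [case: (inj _ _ kl)|case: (inj _ _ lk)].
move=> k; have n0 : (0 < n)%N by lia.
(* The first entry of column [k] is [sin (angle k)] or [cos (angle k / 2)], which is positive in
   either case. *)
exists (Ordinal n0); rewrite mxE /mode /=.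
have kn := ltn_ord k.
have /andP[k0 k1] := angle_itv kn.
have w0R : 0 < w%:R :> R by rewrite ltr0n w_gt0.
case E : (e0); apply: lt0r_neq0.
  rewrite /= mul0r subr0 mul1r sin_gt0_pi //; apply/andP; split.
    by rewrite /angle divr_gt0 ?mulr_gt0 ?pi_gt0 ?ltr0n //; rewrite E; lia.
  by rewrite /angle ltr_pdivrMr // mulrC ltr_pM2l ?pi_gt0 // ltr_nat; lia.
have klt : angle k < pi.
  by rewrite /angle ltr_pdivrMr // mulrC ltr_pM2l ?pi_gt0 // ltr_nat; lia.
rewrite (_ : _ * angle k = angle k / 2); last by rewrite subn0; field.
by apply: cos_gt0_pihalf; have := @pi_gt0 R; lra.
Qed.

Variable b : 'I_n -> R -> R.
Hypothesis bE : forall k x, x \in `[0, 1] -> b k x = fold_fun p n e0 e1 0 k.+1 (ycoord p n e0 e1 x).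

Lemma mass_mode : mass b *m mode_mx =
  mode_mx *m diag_mx (\row_k ((w%:R / 2)^-1 * gsym p 0 (angle k))).
Proof.
apply/matrixP => j k; rewrite mul_mx_diag (mass_fold bE w_gt0) !mxE.
under eq_bigr => l _ do rewrite !mxE -mulrA.
rewrite -mulr_sumr (@gram_eigen _ p n e0 e1 _ (mode (angle k)) 1 pn _ _ _ _ _ (fun u => cos (u%:R * angle k))).
- under eq_bigr => u _ do rewrite auto_corr_mass -[cardB _ _]/(odd_knots p u%:Z).
  rewrite auto_corr_mass -[cardB _ _]/(odd_knots p 0).
  rewrite gsym0_cos_sum cos_sumE; last by move=> u; exact: odd_knots_even.
  rewrite invfM invrK; under eq_bigr => u _ do rewrite -mulrA.
  by rewrite -mulr_sumr; ring.
- by move=> c hc; rewrite hcell_out //; lia.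
- by move=> c; rewrite scale1r hcell_refl.
- by rewrite mulr1.
- exact: mode_left.
- exact: mode_right.
- by have := ltn_ord j; lia.
- by move=> u; exact: mode_add.
- by move=> u; rewrite !auto_corr_mass -[cardB _ _]/(odd_knots p (- u%:Z)) odd_knots_even.
Qed.

Lemma stiffness_mode : stiffness b *m mode_mx =
  mode_mx *m diag_mx (\row_k (w%:R / 2 * gsym p 1 (angle k))).
Proof.
pose c2 (u : int) := 2 * odd_knots p.-1 u - odd_knots p.-1 (u - 1) - odd_knots p.-1 (u + 1) : R.
have acE u : auto_corr p (fun k => (@hcell R p k)^`()) u = 2^-1 * c2 u.
  rewrite auto_corr_stiff // /c2 /odd_knots prednK // intrB intrD.
  have -> : (2 * p.-1).+1 = (2 * p).-1 by lia.
  by congr (_ * (_ - cardB _ _ - cardB _ _)); ring.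
have c2_even (u : nat) : c2 (- u%:Z) = c2 u%:Z.
  rewrite /c2 odd_knots_even -(odd_knots_even _ (- u%:Z - 1)) -(odd_knots_even _ (- u%:Z + 1)).
  rewrite (_ : - (- u%:Z - 1) = u%:Z + 1); last by ring.
  by rewrite (_ : - (- u%:Z + 1) = u%:Z - 1); ring.
apply/matrixP => j k; rewrite mul_mx_diag (stiffness_fold bE w_gt0) !mxE.
under eq_bigr => l _ do rewrite !mxE -mulrA.
rewrite -mulr_sumr (@gram_eigen _ p n e0 e1 _ (mode (angle k)) (-1) pn _ _ _ _ _ (fun u => cos (u%:R * angle k))).
- under eq_bigr => u _ do rewrite acE -mulrA.
  rewrite acE gsym1_cos_sum // -cos_sum_laplace; last exact: odd_knots_out.
  rewrite prednK // -/c2 cos_sumE //.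
  by rewrite -mulr_sumr; field.
- by move=> c hc; rewrite hcell_out ?deriv0 ?linear0 //; lia.
- move=> c; rewrite -hcell_refl deriv_comp derivB derivX -polyC1 derivC sub0r mulrN polyC1 mulr1.
  by rewrite scaleN1r opprK.
- by rewrite mulrNN mulr1.
- exact: mode_left.
- exact: mode_right.
- by have := ltn_ord j; lia.
- by move=> u; exact: mode_add.
- by move=> u; rewrite !acE c2_even.
Qed.

End Spectral.

(** * The reference basis lies in the optimal space *)

Section Continuity.
Context {R : realType}.
Implicit Types (f g h : R -> R) (x y : R).

Lemma continuous_glue f g h x :
  (\forall y \near x, y <= x -> f y = g y) ->
  (\forall y \near x, x <= y -> f y = h y) ->
  {for x, continuous g} -> {for x, continuous h} -> {for x, continuous f}.
Proof.
move=> fg fh gc hc.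
have fgx : f x = g x by have := nbhs_singleton fg; apply.
have fhx : f x = h x by have := nbhs_singleton fh; apply.
apply/cvgrPdist_lt => e e0; near=> y; case: (leP y x) => yx.
  have -> : f y = g y by move: yx; near: y; exact: fg.
  by rewrite fgx; near: y; move/cvgrPdist_lt: gc; apply.
have -> : f y = h y by move/ltW: yx; near: y; exact: fh.
by rewrite fhx; near: y; move/cvgrPdist_lt: hc; apply.
Unshelve. all: by end_near. Qed.

Lemma continuous_hcell d (k : int) x : {for x, continuous (fun y => (@hcell R d k).[2 * y - k%:~R])}.
Proof.
rewrite (_ : (fun y => _) = horner (hcell d k \Po (2 *: 'X - k%:~R%:P))); last first.
  by apply/funext => y; rewrite horner_comp !hE.
exact: continuous_horner.
Qed.

Lemma cardB_continuous d : continuous (@cardB R d.+1).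
Proof.
case: d => [|d] x; last first.
  apply/differentiable_continuous/derivable1_diffP.
  by apply: ex_derive; apply: is_derive_cardB; left.
have [k [t /andP[t0 t1] xE]] := half_cell_coord x.
have xk : 2 * x - k%:~R = t by rewrite xE; field.
move: t0; rewrite le_eqVlt => /orP[/eqP t0|t0].
  have xk0 : 2 * x = k%:~R by lra.
  apply: (@continuous_glue _ (fun y => (hcell 1 (k - 1)).[2 * y - (k - 1)%:~R])
           (fun y => (hcell 1 k).[2 * y - k%:~R])); try exact: continuous_hcell.
  - near=> y => yx; apply: cardB_closed_half; move: yx; near: y; exact: near_half_left.
  - near=> y => yx; apply: cardB_closed_half; move: yx; near: y; exact: near_half_right.
have H : \forall y \near x, cardB 1 y = (hcell 1 k).[2 * y - k%:~R].
  near=> y; apply: cardB_closed_half; apply/andP; split.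
    have : k%:~R / 2 < y by near: y; apply: near_gt; rewrite xE; lra.
    lra.
  have : y < (k%:~R + 1) / 2 by near: y; apply: near_lt; rewrite xE; lra.
  lra.
by apply: (continuous_glue _ _ (@continuous_hcell 1 k x) (@continuous_hcell 1 k x));
  move: H; apply: filterS => y ->.
Unshelve. all: by end_near. Qed.

Lemma dcardB_continuous a d : (a < d)%N -> continuous (@dcardB R a d).
Proof.
elim: a d => [|a IH] [|d] //= ad x; first exact: cardB_continuous.
apply: continuousB; first exact: IH.
apply: (@continuous_comp _ _ _ (fun x => x - 1) (dcardB a d)); last exact: IH.
by apply: continuousB; [exact: cvg_id|exact: cvg_cst].
Qed.

Lemma cardB_unit_cell d (K : int) y : K%:~R <= y <= K%:~R + 1 ->
  cardB d.+1 y = (hcell d.+1 (2 * K)).[2 * y - (2 * K)%:~R].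
Proof.
move=> /andP[y0 y1]; have E : (2 * K)%:~R = 2 * K%:~R :> R by rewrite intrM.
case: (lerP y (K%:~R + 2^-1)) => y2; first by apply: cardB_closed_half; rewrite E; lra.
have E1 : (2 * K + 1)%:~R = 2 * K%:~R + 1 :> R by rewrite intrD intrM.
rewrite (@cardB_closed_half _ _ (2 * K + 1)); last by rewrite E1; lra.
by rewrite hcell_odd horner_comp !hE E1 E; congr horner; ring.
Qed.

End Continuity.

Section Membership.
Context {R : realType}.
Variables (p n : nat) (e0 e1 : bool) (j : nat).
Hypotheses (p0 : (0 < p)%N) (pn : (p < n)%N) (jn : (0 < j <= n)%N).
Local Notation s0 := ((-1) ^+ e0 : R).
Local Notation s1 := ((-1) ^+ e1 : R).
Local Notation A := (p.+2 - e0)%N.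
Local Notation w := (2 * n + e0 + e1)%N.
Local Notation yc := (@ycoord R p n e0 e1).
Local Notation F := (@fold_fun R p n e0 e1).

Definition is_half (y : R) := exists K : int, y = K%:~R + 2^-1.

Lemma is_half_sub y (K : int) : is_half y -> is_half (y - K%:~R).
Proof. by move=> [L ->]; exists (L - K); rewrite intrB addrAC. Qed.

Lemma is_derive_fold a y : (a < p)%N -> (a.+1 < p)%N \/ is_half y ->
  is_derive y 1 (F a j) (F a.+1 j y).
Proof.
move=> ap H.
have Hs (K : int) : is_derive y 1 (fun y => dcardB a p (y - K%:~R)) (dcardB a.+1 p (y - K%:~R)).
  apply: is_derive_shift; apply: is_derive_dcardB => //.
  by case: H => H; [left|right; exact: is_half_sub].
have E : F a j = (fun y => dcardB a p (y - j%:Z%:~R)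
   + s0 * dcardB a p (y - ((1 - e0)%N%:Z - j%:Z)%:~R)
   + s1 * dcardB a p (y - ((2 * n + 1 + e1)%N%:Z - j%:Z)%:~R)).
  by apply/funext => z; rewrite !intrB.
have H1 := Hs j%:Z; have H2 := Hs ((1 - e0)%N%:Z - j%:Z).
have H3 := Hs ((2 * n + 1 + e1)%N%:Z - j%:Z).
rewrite E; apply: is_derive_eq; rewrite /fold_fun /GRing.scale /= !intrB.
by rewrite /GRing.scale /=; ring.
Qed.

Lemma is_derive_ycoord_comp (f : R -> R) (c d x : R) : is_derive (yc x) 1 f d ->
  is_derive x 1 (fun x => c * f (yc x)) (w%:R / 2 * c * d).
Proof.
move=> fd; have Hy : is_derive x 1 yc (w%:R / 2).
  rewrite /ycoord; apply: is_derive_eq; rewrite /GRing.scale /=; ring.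
have Hc := @is_derive1_comp _ f yc x d _ fd Hy.
have := is_deriveZ c Hc; rewrite /GRing.scale /= => H; apply: is_derive_eq H _; ring.
Qed.

Let f x := F 0 j (yc x).

Lemma D01n_fold a x : x \in `[0, 1] -> (a <= p)%N -> (a < p)%N \/ is_half (yc x) ->
  D01n a f x = (w%:R / 2) ^+ a * F a j (yc x).
Proof.
elim: a x => [|a IH] x x01 ap H; first by rewrite expr0 mul1r.
rewrite /D01n iterS -/(D01n a f).
rewrite (@D01_eq _ _ (fun x => (w%:R / 2) ^+ a * F a j (yc x)) _ x x01); last first.
  by move=> z z01; apply: IH => //; [lia|left].
rewrite exprS; apply: D01_is_derive => //; apply: is_derive_ycoord_comp.
by apply: is_derive_fold.
Qed.

Lemma fold_C01 : C01 p.-1 f.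
Proof.
split=> [a ap x x01|].
  have ap1 : (a.+1 < p)%N by lia.
  rewrite (@quot01_eq _ _ (fun x => (w%:R / 2) ^+ a * F a j (yc x))) //; last first.
    by move=> z z01; apply: D01n_fold => //; [lia|left; lia].
  apply: cvgP; apply: quot01_is_derive; apply: is_derive_ycoord_comp.
  by apply: is_derive_fold; [lia|left].
apply: (@subspace_eq_continuous _ _ _ (fun x => (w%:R / 2) ^+ p.-1 * F p.-1 j (yc x))).
  move=> z; rewrite inE /= => z01; apply/esym; apply: D01n_fold => //; [lia|left; lia].
apply: continuous_subspaceT.
suff : continuous (fun x : R => (w%:R / 2) ^+ p.-1 * F p.-1 j (yc x)) by [].
move=> x; have yC c : {for x, continuous (fun x => yc x - c)}.
  apply: continuousB; last exact: cvg_cst.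
  rewrite /ycoord; apply: continuousD; last exact: cvg_cst.
  by apply: continuousM; [exact: cvg_cst|exact: cvg_id].
have dC c : {for x, continuous (fun x => dcardB p.-1 p (yc x - c))}.
  apply: (@continuous_comp _ _ _ (fun x => yc x - c) (dcardB p.-1 p)); first exact: yC.
  by apply: dcardB_continuous; lia.
apply: cvgM; first exact: cvg_cst.
rewrite /fold_fun; apply: cvgD; first apply: cvgD.
- exact: dC.
- by apply: cvgM; [exact: cvg_cst|exact: dC].
- by apply: cvgM; [exact: cvg_cst|exact: dC].
Qed.

Lemma fold_poly (K : int) : exists2 P : {poly R}, (size P <= p.+1)%N &
  forall x, K%:~R <= yc x <= K%:~R + 1 -> f x = P.[x].
Proof.
pose aff : {poly R} := w%:R *: 'X + (A%:R - (2 * K)%:~R)%:P.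
exists (fold_cell n e0 e1 (@hcell R p) j%:Z (2 * K) \Po aff).
  have s1 : (size aff <= 2)%N.
    rewrite (leq_trans (size_polyD _ _)) // geq_max (leq_trans (size_scale_leq _ _)) ?size_polyX //=.
    by rewrite (leq_trans (size_polyC_leq1 _)).
  have s2 : (size (fold_cell n e0 e1 (@hcell R p) j%:Z (2 * K)) <= p.+1)%N.
    have sZ (c : R) k : (size (c *: @hcell R p k) <= p.+1)%N.
      exact: leq_trans (size_scale_leq _ _) (size_hcell _ _).
    apply: (leq_trans (size_polyD _ _)); rewrite geq_max sZ andbT.
    by apply: (leq_trans (size_polyD _ _)); rewrite geq_max sZ size_hcell.
  rewrite (leq_trans (size_comp_poly_leq _ _)) // ltnS.
  rewrite (leq_trans (leq_mul (leqnn _) (_ : _ <= 1)%N)) ?muln1; lia.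
move=> x xK; rewrite horner_comp.
have -> : aff.[x] = 2 * yc x - (2 * K)%:~R by rewrite /aff !hE /ycoord; field.
have H0 (L : int) (y : R) : L%:~R <= y <= L%:~R + 1 -> cardB p y = (hcell p (2 * L)).[2 * y - (2 * L)%:~R].
  by case: p p0 => // d _; exact: cardB_unit_cell.
rewrite /fold_cell !hE /f /fold_fun /=.
have H (c : int) : cardB p (yc x - c%:~R) = (hcell p (2 * K - 2 * c)).[2 * yc x - (2 * K)%:~R].
  rewrite (@H0 (K - c)); last by rewrite intrB; lra.
  rewrite (_ : 2 * (K - c) = 2 * K - 2 * c); last by ring.
  by congr horner; rewrite intrB [(2 * c)%:~R]intrM; ring.
by rewrite -!H !intrB.
Qed.

(** At 0 the right image vanishes and the left one cancels the function itself, by the symmetry of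
    its derivatives. For [a = p] that symmetry is available at half-integers, and there the parity
    condition makes [A] odd. *)
Lemma fold_left a : (a <= p)%N -> odd a != e0 -> D01n a f 0 = 0.
Proof.
move=> ap ao; have H : (a < p)%N \/ is_half (yc 0).
  case: (ltnP a p) => pa; [by left|right]; have {pa} aE : a = p by lia.
  have Aodd : odd A by lia.
  exists (A./2)%:Z; rewrite ycoord0 -{1}[A]odd_double_half Aodd natrD -muln2 natrM.
  by rewrite -[X in _ = X + _]/((A./2)%:R) /=; field.
rewrite D01n_fold ?in_itv /= ?lexx ?ler01 // ycoord0 /fold_fun.
rewrite [dcardB a p (_ - ((2 * n + _ + _)%:R - _))]dcardB_out //; last first.
  apply/orP; left; rewrite -natrB; last by lia.
  by rewrite subr_lt0 ltr_pdivrMr // -natrM ltr_nat; lia.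
have -> : A%:R / 2 - ((1 - e0)%:R - j%:R) = p.+1%:R - (A%:R / 2 - j%:R) :> R.
  have : A%:R = p.+1%:R + (1 - e0)%:R :> R by rewrite -natrD; congr (_%:R); lia.
  lra.
rewrite dcardB_sym //; last first.
  by case: H => [|h]; [left|right; rewrite -(ycoord0 p n e0 e1); exact: (is_half_sub j%:Z h)].
rewrite mulr0 addr0 mulrA -exprD -signr_odd oddD.
by rewrite (_ : odd e0 (+) odd a = true) ?expr1 ?mulN1r ?subrr ?mulr0 //; case: (e0) ao; case: (odd a).
Qed.

Lemma fold_right a : (a <= p)%N -> odd a != e1 -> D01n a f 1 = 0.
Proof.
move=> ap ao; pose B := (p.+2 + 2 * n + e1)%N; have H : (a < p)%N \/ is_half (yc 1).
  case: (ltnP a p) => pa; [by left|right]; have {pa} aE : a = p by lia.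
  have Bodd : odd B by rewrite /B; lia.
  exists (B./2)%:Z; rewrite ycoord1 -/B -{1}[B]odd_double_half Bodd natrD -muln2 natrM.
  by rewrite -[X in _ = X + _]/((B./2)%:R) /=; field.
rewrite D01n_fold ?in_itv /= ?lexx ?ler01 // ycoord1 -/B /fold_fun.
rewrite [dcardB a p (_ - ((1 - e0)%:R - _))]dcardB_out //; last first.
  apply/orP; right.
  have : (2 * (p.+1 + (1 - e0)))%:R <= (B + 2 * j)%:R :> R by rewrite ler_nat /B; lia.
  by rewrite natrM natrD (natrD _ B) natrM; lra.
have -> : B%:R / 2 - ((2 * n + 1 + e1)%:R - j%:R) = p.+1%:R - (B%:R / 2 - j%:R) :> R.
  have : B%:R = p.+1%:R + (2 * n + 1 + e1)%:R :> R by rewrite -natrD; congr (_%:R); rewrite /B; lia.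
  lra.
rewrite dcardB_sym //; last first.
  by case: H => [|h]; [left|right; rewrite /B -(ycoord1 p n e0 e1); exact: (is_half_sub j%:Z h)].
rewrite mulr0 addr0 mulrA -exprD -signr_odd oddD.
by rewrite (_ : odd e1 (+) odd a = true) ?expr1 ?mulN1r ?subrr ?mulr0 //; case: (e1) ao; case: (odd a).
Qed.

End Membership.

(** * The partitions and the reference functions in the common coordinate *)

Section Spaces.
Context {R : realType}.
Variables (p i n : nat).
Hypotheses (p0 : (0 < p)%N) (fn : (f_bound p i <= n)%N).
Local Notation e0 := (i != 1)%N.
Local Notation e1 := (i == 0)%N.
Local Notation A := (p.+2 - e0)%N.
Local Notation w := (2 * n + e0 + e1)%N.
Local Notation yc := (@ycoord R p n e0 e1).
Local Notation brk := (@break R p i n).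
Local Notation m := (n_int p i n).

Lemma f_bound_gt : (p < n)%N.
Proof. by move: fn; rewrite /f_bound; case: i => [|[|?]]; lia. Qed.

Lemma f_bound_blocks : (d1 p i + d3 p i < n)%N.
Proof. by move: fn; rewrite /f_bound /d1 /d3; case: i => [|[|?]]; lia. Qed.

Lemma f_bound_fold : (i = 1)%N -> (2 * (p - p./2) < n)%N.
Proof. by move=> iE; move: fn; rewrite /f_bound iE; lia. Qed.

Lemma cardB_outside (z : R) : (z <= 0) || (p.+1%:R <= z) -> cardB p z = 0.
Proof. by case: p p0 => // d _; exact: cardB_out_closed. Qed.

Lemma le_n_int : (n <= m)%N.
Proof. by rewrite /n_int; case: i => [|[|i']]; case: (odd p) => /=; lia. Qed.

Let w_gt0 : 0 < w%:R :> R.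
Proof. by rewrite ltr0n; have := f_bound_gt; lia. Qed.

Lemma ycoord_lt x y : (yc x < yc y) = (x < y).
Proof. by rewrite /ycoord ltrD2r ltr_pM2l ?divr_gt0. Qed.

Lemma ycoord_le x y : (yc x <= yc y) = (x <= y).
Proof. by rewrite /ycoord lerD2r ler_pM2l ?divr_gt0. Qed.

Lemma natr_half (k : nat) : k%:R = (odd k)%:R + 2 * (k./2)%:R :> R.
Proof. by rewrite -natrM -natrD; congr (_%:R); lia. Qed.

Lemma w_natr : w%:R = 2 * n%:R + e0%:R + e1%:R :> R.
Proof. by rewrite -natrM -!natrD. Qed.

Lemma A_natr : A%:R = p%:R + 2 - e0%:R :> R.
Proof. by rewrite natrB; [rewrite -!natr1; ring|case: (e0)]. Qed.

Lemma A_half_natr : (A./2)%:R = (p%:R + 2 - e0%:R - (odd p (+) e0)%:R) / 2 :> R.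
Proof.
rewrite -A_natr [A%:R]natr_half (_ : odd A = odd p (+) e0); first by field.
by case: (e0); lia.
Qed.

(** The coordinate is chosen so that the interior breakpoints of all six partitions become
    consecutive integers; [A./2] is the last integer not above the image of 0. *)
Lemma ycoord_break k : (0 < k < m)%N -> yc (brk k) = (A./2 + k)%:R.
Proof.
move=> /andP[k0 km]; rewrite /break ifF ?km; last by lia.
have n0 := f_bound_gt.
have nR : n%:R != 0 :> R by rewrite pnatr_eq0; lia.
have nR1 : n%:R + 1 != 0 :> R by rewrite natr1 pnatr_eq0.
have nR2 : 2 * n%:R + 1 != 0 :> R by rewrite -natrM natr1 pnatr_eq0.
rewrite natrD /ycoord w_natr A_natr A_half_natr /inner_break -[n.+1%:R]natr1.
have -> : (2 * n).+1%:R = 2 * n%:R + 1 :> R by rewrite -natr1 natrM.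
case: i => [|[|i']] /=; rewrite ?natrM; case: (odd p) => /=; field => //.
Qed.

Lemma break0 : brk 0 = 0.
Proof. by rewrite /break eqxx. Qed.

Lemma break_last : brk m = 1.
Proof. by rewrite /break ltnn ifF //; have := le_n_int; have := f_bound_gt; lia. Qed.

Lemma ycoord_break_bounds k : (k <= m)%N ->
  (A./2 + k)%:R - 2^-1 <= yc (brk k) <= (A./2 + k)%:R + 2^-1 /\
  ((0 < k)%N -> yc (brk k) <= (A./2 + k)%:R) /\ ((k < m)%N -> (A./2 + k)%:R <= yc (brk k)).
Proof.
move=> km; case: (posnP k) => [->|k0].
  rewrite break0 ycoord0 addn0.
  have H : A%:R = (odd A)%:R + 2 * (A./2)%:R :> R by rewrite -natrM -natrD; congr (_%:R); lia.
  have : 0 <= (odd A)%:R :> R by rewrite ler0n.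
  have : (odd A)%:R <= 1 :> R by case: odd; rewrite ?lexx ?ler01.
  by move=> h1 h2; split; [lra|split=> // _; lra].
case: (ltnP k m) => km'; last first.
  have -> : k = m by lia.
  rewrite break_last ycoord1 natrD.
  (* [q] is 1 if the last interval has half the regular length, and 0 otherwise. *)
  have [q [q1 qE]] : exists q : nat, (q <= 1)%N /\ (p.+2 + 2 * n + e1 + q = 2 * (A./2 + m))%N.
    exists (2 * (A./2 + m) - (p.+2 + 2 * n + e1))%N.
    by rewrite /n_int; case: i => [|[|i']]; case E : (odd p) => /=; lia.
  have := congr1 (fun k => k%:R : R) qE; rewrite natrD natrM [(A./2 + m)%:R]natrD.
  have : 0 <= q%:R :> R by rewrite ler0n.
  have : q%:R <= 1 :> R by rewrite -[1]/(1%N%:R) ler_nat.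
  by move=> h1 h2 h3; split; [lra|split=> [_|//]; lra].
rewrite ycoord_break ?k0 //; split; first by lra.
by split=> _; rewrite lexx.
Qed.

Lemma break_lt k : (k < m)%N -> brk k < brk k.+1.
Proof.
move=> km; rewrite -ycoord_lt.
have [h1 [_ h2]] := ycoord_break_bounds (ltnW km).
have [h3 [h4 h5]] := ycoord_break_bounds km.
have := h2 km; have := h4 isT; move: h1 h3; rewrite !natrD -[k.+1%:R]natr1 => h1 h3 h6 h7.
case: (posnP k) => [k0|k0].
  have A1 : yc (brk k) <= (A./2)%:R + k%:R + 2^-1 by lra.
  case: (ltnP 1 m) => m1; last by have := f_bound_gt; have := le_n_int; lia.
  have := ycoord_break (k := k.+1); rewrite k0 /= m1 => /(_ isT) ->.
  by rewrite k0 in A1; rewrite natrD; move: A1; rewrite addr0; lra.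
rewrite (@ycoord_break k) ?k0 // natrD; lra.
Qed.

Lemma break_mono k l : (k <= l <= m)%N -> brk k <= brk l.
Proof.
move=> /andP[]; elim: l => [|l IH]; first by rewrite leqn0 => /eqP ->.
rewrite leq_eqVlt => /orP[/eqP -> //|kl] lm.
by apply: le_trans (IH _ _) _; [lia|lia|apply/ltW/break_lt].
Qed.

Lemma break_itv k : (k <= m)%N -> 0 <= brk k <= 1.
Proof.
move=> km; have := @break_mono 0 k km; have := @break_mono k m.
by rewrite km leqnn break0 break_last => -> // ->.
Qed.

Lemma left_image_out (j : nat) x : (p.+1 + (1 - e0) <= 2 * j)%N -> 0 <= x ->
  cardB p (yc x - ((1 - e0)%:R - j%:R)) = 0.
Proof.
move=> h x0; have : A%:R / 2 <= yc x by rewrite -(ycoord0 p n e0 e1) ycoord_le.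
have : (p.+1 + (1 - e0))%:R <= (2 * j)%:R :> R by rewrite ler_nat.
have : A%:R = p.+1%:R + (1 - e0)%:R :> R by rewrite -natrD; congr (_%:R); lia.
rewrite natrD natrM => h1 h2 h3; apply: cardB_outside; apply/orP; right; lra.
Qed.

Lemma right_image_out (j : nat) x : (p.+2 + 2 * n + e1 + 2 * j <= 2 * (2 * n + 1 + e1))%N ->
  x <= 1 -> cardB p (yc x - ((2 * n + 1 + e1)%:R - j%:R)) = 0.
Proof.
move=> h x1.
have : yc x <= (p.+2 + 2 * n + e1)%N%:R / 2 by rewrite -(ycoord1 p n e0 e1) ycoord_le.
have : (p.+2 + 2 * n + e1 + 2 * j)%:R <= (2 * (2 * n + 1 + e1))%:R :> R by rewrite ler_nat.
rewrite natrD [(2 * (_ + _))%:R]natrM [(2 * j)%:R]natrM => h1 h2.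
apply: cardB_outside; apply/orP; left; lra.
Qed.

(** The definition lists only the images that can meet [0,1] for the given [j]; [fold_fun] always
    adds both, and the extra ones vanish there. The variables [ref_var] and [ycoord] differ by an
    integer. *)
Lemma ref_basisE (k : 'I_n) x : x \in `[0, 1] ->
  ref_basis p i k x = fold_fun p n e0 e1 0 k.+1 (yc x).
Proof.
rewrite in_itv /= => /andP[x0 x1].
rewrite /ref_basis; move: (k.+1) (ltn_ord k) (ltn0Sn k) => j jn j0.
have pn := f_bound_gt; have := f_bound_fold; have bl := f_bound_blocks.
rewrite /fold_fun /=.
pose T1 := cardB p (yc x - j%:R); pose T2 := cardB p (yc x - ((1 - e0)%:R - j%:R)).
pose T3 := cardB p (yc x - ((2 * n + 1 + e1)%:R - j%:R)).
rewrite -/T1 -/T2 -/T3 => fi.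
have T2out : (p.+1 + (1 - e0) <= 2 * j)%N -> T2 = 0 by move/left_image_out; apply.
have T3out : (p.+2 + 2 * n + e1 + 2 * j <= 2 * (2 * n + 1 + e1))%N -> T3 = 0.
  by move/right_image_out; apply.
have pE := natr_half p.
pose Nf (t : int) := cardBt t p (@ref_var R p i n x); pose q : int := (p./2)%:Z - p%:Z.
have refE : ref_fun p i n j x = match i with
    | 0 => if (j <= p./2)%N then - Nf (q - j%:Z) + Nf (q + j%:Z)
           else if (j <= n - p./2)%N then Nf (q + j%:Z)
           else Nf (q + j%:Z) - Nf (q + (2 * n.+1)%:Z - j%:Z)
    | 1 => if (j <= p - p./2)%N then Nf (- (p./2)%:Z - j%:Z) + Nf (- (p./2)%:Z + j%:Z - 1)
           else if (j <= n - (p - p./2))%N then Nf (- (p./2)%:Z + j%:Z - 1)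
           else Nf (- (p./2)%:Z + j%:Z - 1) + Nf (- (p./2)%:Z + (2 * n)%:Z - j%:Z)
    | _ => if (j <= p./2)%N then Nf (q + j%:Z) - Nf (q - j%:Z)
           else if (j <= n - (p - p./2))%N then Nf (q + j%:Z)
           else Nf (q + j%:Z) + Nf (q + (2 * n).+1%:Z - j%:Z)
    end by [].
rewrite {}refE.
have NfE (t : int) (z : R) : ref_var p i n x - t%:~R = z -> Nf t = cardB p z.
  by rewrite /Nf /cardBt => ->.
have vE : yc x = ref_var p i n x + (match i with 1 => p./2.+1%:R | _ => p%:R - p./2%:R end).
  rewrite /ycoord /ref_var w_natr A_natr pE -[n.+1%:R]natr1 -[p./2.+1%:R]natr1.
  have -> : (2 * n).+1%:R = 2 * n%:R + 1 :> R by rewrite -natr1 natrM.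
  by case: (i) => [|[|i']] /=; case: (odd p) => /=; field.
have iC : i = 0%N \/ i = 1%N \/ (i != 0%N /\ i != 1%N) by lia.
case: iC => [iE|[iE|[iE0 iE1]]].
- have N1 : Nf (q + j%:Z) = T1.
    by apply: NfE; rewrite vE iE /q !intrD intrN; ring.
  have N2 : Nf (q - j%:Z) = T2.
    by apply: NfE; rewrite vE iE /q /= !intrD !intrN subnn; ring.
  have N3 : Nf (q + (2 * n.+1)%:Z - j%:Z) = T3.
    apply: NfE; rewrite vE iE /q /= !intrD !intrN.
    by rewrite (_ : (2 * n + 1 + 1)%:R = (2 * n.+1)%:Z%:~R :> R); [ring|rewrite -[RHS]/((2 * n.+1)%:R); congr (_%:R); lia].
  move: T2out T3out bl; rewrite iE /= !N1 !N2 !N3 /d1 /d3 expr1 => T2out T3out bl.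
  case: leqP => j1; first by rewrite T3out; [ring|lia].
  case: leqP => j2; first by rewrite T3out ?T2out; [ring|lia|lia].
  by rewrite T2out; [ring|lia].
- have N1 : Nf (- (p./2)%:Z + j%:Z - 1) = T1.
    by apply: NfE; rewrite vE iE /q /= !intrD !intrN -[p./2.+1%:R]natr1; ring.
  have N2 : Nf (- (p./2)%:Z - j%:Z) = T2.
    by apply: NfE; rewrite vE iE /q /= !intrD !intrN subn0 -[p./2.+1%:R]natr1; ring.
  have N3 : Nf (- (p./2)%:Z + (2 * n)%:Z - j%:Z) = T3.
    apply: NfE; rewrite vE iE /q /= !intrD !intrN -[p./2.+1%:R]natr1.
    by rewrite (_ : (2 * n + 1 + 0)%:R = (2 * n)%:Z%:~R + 1 :> R); [ring|rewrite addn0 natrD].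
  move: T2out T3out fi; rewrite iE /= !N1 !N2 !N3 expr0 => T2out T3out fi.
  have {}fi := fi erefl.
  case: leqP => j1; first by rewrite T3out; [ring|lia].
  case: leqP => j2; first by rewrite T3out ?T2out; [ring|lia|lia].
  by rewrite T2out; [ring|lia].
have vE2 : yc x = ref_var p i n x + (p%:R - p./2%:R).
  by rewrite vE; case: (i) iE0 iE1 => [|[|?]].
have N1 : Nf (q + j%:Z) = T1.
  by apply: NfE; rewrite vE2 /q !intrD intrN; ring.
have N2 : Nf (q - j%:Z) = T2.
  by apply: NfE; rewrite vE2 iE1 /q /= !intrD !intrN subnn; ring.
have N3 : Nf (q + (2 * n).+1%:Z - j%:Z) = T3.
  apply: NfE; rewrite vE2 (negbTE iE0) /q /= !intrD !intrN.
  by rewrite (_ : (2 * n + 1 + 0)%:R = (2 * n).+1%:Z%:~R :> R); [ring|rewrite -[RHS]/((2 * n).+1%:R); congr (_%:R); lia].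
have refE (X Y Z : R) : (match i with 0 => X | 1 => Y | _ => Z end) = Z.
  by case: (i) iE0 iE1 => [|[|?]].
move: T2out T3out; rewrite refE iE1 (negbTE iE0) /= !N1 !N2 !N3 expr0 expr1 => T2out T3out.
case: leqP => j1; first by rewrite T3out; [ring|lia].
case: leqP => j2; first by rewrite T3out ?T2out; [ring|lia|lia].
by rewrite T2out; [ring|lia].
Qed.

Lemma ref_basis_space (k : 'I_n) : optimal_space p i n (@ref_basis R p i n k).
Proof.
pose f x := fold_fun p n e0 e1 0 k.+1 (yc x).
have fE : {in `[0, 1], ref_basis p i k =1 f} by move=> x x01; exact: ref_basisE.
have pn := f_bound_gt; have jn : (0 < k.+1 <= n)%N by rewrite /= ltn_ord.
have fC : C01 p.-1 f by exact: fold_C01.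
split.
- split.
    case: fC => fC1 fC2; split => [j jp x x01|].
      by rewrite (@quot01_eq _ _ (D01n j f)) //; [exact: fC1|exact: D01n_eq].
    apply: subspace_eq_continuous fC2 => x; rewrite inE /= => x01.
    by apply/esym; exact: D01n_eq.
  move=> l lm; have [P sP fP] := @fold_poly R p n e0 e1 k.+1 p0 pn jn (A./2 + l)%N%:Z.
  exists P; split => // x; rewrite in_itv /= => /andP[xl xr].
  have /andP[l0 _] := break_itv (ltnW lm); have /andP[_ l1] := break_itv lm.
  rewrite fE; last by rewrite in_itv /=; apply/andP; split; lra.
  apply: fP; have [_ [_ /(_ lm) h1]] := ycoord_break_bounds (ltnW lm).
  have [_ [/(_ isT) h2 _]] := ycoord_break_bounds lm.
  have : yc (brk l) <= yc x by rewrite ycoord_le.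
  have : yc x <= yc (brk l.+1) by rewrite ycoord_le.
  move: h1 h2; rewrite -[(A./2 + l)%N%:Z%:~R]/((A./2 + l)%N%:R) !natrD -[l.+1%:R]natr1; lra.
- move=> a ap; rewrite /bc_left => bc; rewrite (D01n_eq a fE) ?in_itv /= ?lexx ?ler01 //.
  apply: fold_left => //; move: bc; case: eqP => _ /=; first by move=> ->.
  by case: odd.
- move=> a ap; rewrite /bc_right => bc; rewrite (D01n_eq a fE) ?in_itv /= ?lexx ?ler01 //.
  apply: fold_right => //; move: bc; case: eqP => _ /=; last by move=> ->.
  by case: odd.
Qed.

End Spaces.

(** * Truncated powers and B-splines *)

Section TruncatedPowers.
Context {R : realType}.

Lemma coef_binomial_term p i q (t : R) :
  ((-1) ^+ i * 'X ^+ (p - i) * t%:P ^+ i : {poly R})`_q = (-1) ^+ i * t ^+ i * (q == p - i)%N%:R.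
Proof.
rewrite (_ : (-1) ^+ i = ((-1) ^+ i)%:P :> {poly R}); last by rewrite polyC_exp polyCN.
by rewrite -polyC_exp coefMC coefCM coefXn mulrAC.
Qed.

(** Comparing coefficients, whose binomial factors are nonzero, gives the moments of [al] at the
    points [t s]; testing against the polynomial that vanishes at all points but one isolates
    [al s]. *)
Lemma truncated_powers_free p (al t : nat -> R) :
  (forall s s', (s <= p)%N -> (s' <= p)%N -> t s = t s' -> s = s') ->
  \sum_(s < p.+1) al s *: ('X - (t s)%:P) ^+ p = 0 ->
  forall s, (s <= p)%N -> al s = 0.
Proof.
move=> tinj H.
have moment k : (k <= p)%N -> \sum_(s < p.+1) al s * t s ^+ k = 0.
  move=> kp; have := congr1 (fun P : {poly R} => P`_(p - k)) H.
  rewrite coef0 coef_sum.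
  rewrite (eq_bigr (fun s : 'I_p.+1 => ((-1) ^+ k *+ 'C(p, k)) * (al s * t s ^+ k))); last first.
    move=> s _; rewrite coefZ exprBn coef_sum.
    have kp1 : (k < p.+1)%N by [].
    rewrite (bigD1 (Ordinal kp1)) //= big1 ?addr0; last first.
      move=> i ik; have ik' : (i : nat) != k by move: ik; apply: contraNneq => ik; apply/eqP/val_inj.
      rewrite coefMn coef_binomial_term (_ : (p - k == p - i)%N = false) ?mulr0 ?mul0rn //.
      by have := ltn_ord i; lia.
    rewrite coefMn coef_binomial_term eqxx mulr1 !mulrnAr mulrnAl; congr (_ *+ _); ring.
  rewrite -mulr_sumr => /eqP; rewrite mulf_eq0 mulrn_eq0 signr_eq0 orbF => /orP[|/eqP //].
  by rewrite eqn0Ngt bin_gt0 kp.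
have eval (r : {poly R}) : (size r <= p.+1)%N -> \sum_(s < p.+1) al s * r.[t s] = 0.
  move=> sr; under eq_bigr => s _ do rewrite (horner_coef_wide _ sr) mulr_sumr.
  rewrite exchange_big big1 //= => k _.
  have := moment k (leq_ord k) => Mk.
  transitivity (r`_k * \sum_(s < p.+1) al s * t s ^+ k); last by rewrite Mk mulr0.
  by rewrite mulr_sumr; apply: eq_bigr => s _; ring.
move=> s sp; pose s0 := Ordinal (sp : (s < p.+1)%N).
pose r := \prod_(u < p.+1 | u != s0) ('X - (t u)%:P).
have sr : (size r <= p.+1)%N.
  rewrite /r -big_filter size_prod_XsubC size_filter -sum1_count sum1_card.
  by rewrite cardC1 card_ord.
have := eval r sr; rewrite (bigD1 s0) //= big1 ?addr0; last first.
  by move=> u us; rewrite /r horner_prod (bigD1 u) //= hornerXsubC subrr mul0r mulr0.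
move/eqP; rewrite mulf_eq0 => /orP[/eqP //|].
rewrite /r horner_prod prodf_seq_eq0 => /hasP[u _ /andP[us]].
rewrite hornerXsubC subr_eq0 => /eqP E.
have := tinj _ _ sp _ E; rewrite -ltnS => /(_ (ltn_ord u)) su.
by case/eqP: us; apply: val_inj.
Qed.

(** No nonzero spline of degree [p] with simple knots is supported on [p] intervals; [Q 0] and
    [Q p.+1] are the pieces outside. *)
Lemma chain_zero p (Q : nat -> {poly R}) (t : nat -> R) :
  (forall s s', (s <= p)%N -> (s' <= p)%N -> t s = t s' -> s = s') ->
  Q 0 = 0 -> Q p.+1 = 0 ->
  (forall s, (s <= p)%N -> exists e, Q s.+1 - Q s = e *: ('X - (t s)%:P) ^+ p) ->
  forall s, (s <= p.+1)%N -> Q s = 0.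
Proof.
move=> tinj Q0 Qp Qjump.
have /choice[al alE] : forall s, exists e, (s <= p)%N -> Q s.+1 - Q s = e *: ('X - (t s)%:P) ^+ p.
  move=> s; case: (leqP s p) => sp; last by exists 0.
  by have [e eE] := Qjump s sp; exists e.
have al0 : forall s, (s <= p)%N -> al s = 0.
  apply: (truncated_powers_free tinj).
  rewrite (eq_bigr (fun s : 'I_p.+1 => Q s.+1 - Q s)); last first.
    by move=> s _; rewrite alE // -ltnS.
  by rewrite -(big_mkord xpredT (fun s => Q s.+1 - Q s)) telescope_sumr // Q0 Qp subr0.
elim=> // s IH sp; have := alE s sp; rewrite al0 // scale0r => /eqP.
by rewrite subr_eq0 => /eqP ->; apply: IH; lia.
Qed.

End TruncatedPowers.

(** * B-splines on a knot sequence *)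

Section BSplines.
Context {R : realType}.
Variable xi : nat -> R.
Hypothesis xi_mono : forall j, xi j <= xi j.+1.

Lemma bspline_left d j x : x < xi j -> bspline xi d j x = 0.
Proof.
elim: d j => [|d IH] j xj /=.
  rewrite leNgt xj /=; case: eqP => [j1|]; last by rewrite andbF.
  case: eqP => [x1|]; last by rewrite !andbF.
  by have := xi_mono j; rewrite j1 -x1; lra.
by rewrite !IH ?mulr0 ?addr0 //; apply: lt_le_trans xj (xi_mono j).
Qed.

(** The last knot itself is included only when [x < 1], because the last interval is closed at 1. *)
Lemma bspline_right d j x : xi (j + d).+1 < x \/ (xi (j + d).+1 <= x /\ x < 1) ->
  bspline xi d j x = 0.
Proof.
elim: d j => [|d IH] j xj.
  rewrite addn0 in xj; rewrite /= [x < xi j.+1]ltNge (_ : xi j.+1 <= x) /=; last by lra.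
  rewrite andbF /=; case: eqP => [j1|]; last by rewrite andbF.
  by case: eqP => [x1|]; rewrite ?andbF //; lra.
rewrite /= !IH ?mulr0 ?addr0 // ?addSn; first by move: xj; rewrite addnS.
have := xi_mono (j + d).+1; move: xj; rewrite addnS => h1 h2.
by case: h1 => [h|[h h']]; [left|right]; lra.
Qed.

(** On the first interval a single branch of the recursion survives, which leaves a pure power. *)
Lemma bspline_first d j : exists c, forall x, xi j <= x < xi j.+1 ->
  bspline xi d j x = c * (x - xi j) ^+ d.
Proof.
elim: d => [|d [c IH]].
  by exists 1 => x xj; rewrite /= xj expr0 mulr1.
exists ((xi (j + d.+1)%N - xi j)^-1 * c) => x xj /=.
rewrite (IH _ xj) [bspline xi d j.+1 x]bspline_left; last by case/andP: xj.
by rewrite mulr0 addr0 exprS; ring.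
Qed.

Lemma bspline_last d j : exists c, forall x, xi (j + d)%N <= x < xi (j + d).+1 -> x < 1 ->
  bspline xi d j x = c * (xi (j + d).+1 - x) ^+ d.
Proof.
elim: d j => [|d IH] j.
  by exists 1 => x; rewrite addn0 => xj _; rewrite /= xj expr0 mulr1.
have [c cE] := IH j.+1; rewrite !addSnnS in cE.
exists ((xi (j + d.+1).+1 - xi j.+1)^-1 * c) => x xj x1 /=.
rewrite [bspline xi d j x]bspline_right; last first.
  by right; split=> //; case/andP: xj; rewrite addnS.
by rewrite mulr0 add0r cE // exprS; ring.
Qed.

(** Only the [d+2] knots of this B-spline enter the recursion, so repeated knots elsewhere do no
    harm; [x < 1] avoids the closed last interval. *)
Lemma bspline_uniform (nu al : R) (N0 d j : nat) x : 0 < nu -> x < 1 ->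
  (forall s, (s <= d.+1)%N -> nu * xi (j + s)%N + al = (N0 + s)%:R) ->
  bspline xi d j x = cardB d (nu * x + al - N0%:R).
Proof.
move=> nu0 x1; elim: d j N0 => [|d IH] j N0 H.
  have := H 0%N isT; have := H 1%N isT; rewrite !addn0 !addn1 /= -[N0.+1%:R]natr1 => h1 h0.
  rewrite (lt_eqF x1) !andbF orbF; congr (if _ then _ else _).
  have E1 : (xi j <= x) = (nu * xi j <= nu * x) by rewrite ler_pM2l.
  have E2 : (x < xi j.+1) = (nu * x < nu * xi j.+1) by rewrite ltr_pM2l.
  by rewrite E1 E2; apply/idP/idP => /andP[]; lra.
have S1 : bspline xi d j x = cardB d (nu * x + al - N0%:R).
  by apply: IH => s sd; apply: H; lia.
have S2 : bspline xi d j.+1 x = cardB d (nu * x + al - N0.+1%:R).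
  by apply: IH => s sd; rewrite !addSnnS; apply: H; lia.
rewrite /= S1 S2.
have h0 := H 0%N isT; have h1 := H 1%N isT.
have hd := H d.+1 (leqnSn _); have hd2 := H d.+2 (leqnn _).
rewrite addn0 addn0 in h0; rewrite !addn1 in h1.
have nu1 : nu != 0 by rewrite gt_eqF.
have D0 : d.+1%:R != 0 :> R by rewrite pnatr_eq0.
have e0 : xi j = (N0%:R - al) / nu by rewrite -h0; field.
have e1 : xi j.+1 = (N0%:R + 1 - al) / nu by move: h1; rewrite -natr1 => <-; field.
have ed : xi (j + d.+1)%N = (N0%:R + d.+1%:R - al) / nu by rewrite -natrD -hd; field.
have ed2 : xi (j + d.+1).+1 = (N0%:R + d.+1%:R + 1 - al) / nu.
  by move: hd2; rewrite natrD -[d.+2%:R]natr1 addrA addnS => <-; field.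
rewrite e0 e1 ed ed2 -[N0.+1%:R]natr1 -[d.+2%:R]natr1.
have -> : nu * x + al - (N0%:R + 1) = nu * x + al - N0%:R - 1 by ring.
by congr (_ * _ + _ * _); field; rewrite nu1 ?andbT nat1r D0.
Qed.

End BSplines.

(** * Change of basis *)

Section PiecewiseGram.
Context {R : realType}.
Variables (m n : nat) (x : nat -> R).
Hypotheses (x0 : x 0 = 0) (xm : x m = 1) (x_lt : forall c, (c < m)%N -> x c < x c.+1).
Implicit Types (b : 'I_n -> R -> R) (P : 'I_n -> nat -> {poly R}).

Definition pieces b P := forall l c, (c < m)%N ->
  forall y, x c < y < x c.+1 -> b l y = (P l c).[y].

Definition piece_int (c : nat) (Q : {poly R}) : R :=
  (x c.+1 - x c) * unit_int (Q \Po ((x c)%:P + (x c.+1 - x c) *: 'X)).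

Definition piece_gram P : 'M[R]_n :=
  \matrix_(k, l) \sum_(0 <= c < m) piece_int c (P l c * P k c).

Lemma piece_intZ c a Q : piece_int c (a *: Q) = a * piece_int c Q.
Proof. by rewrite /piece_int comp_polyZ unit_intZ mulrCA. Qed.

Lemma piece_int_sum c (F : 'I_n -> {poly R}) :
  piece_int c (\sum_l F l) = \sum_l piece_int c (F l).
Proof. by rewrite /piece_int linear_sum unit_int_sum mulr_sumr. Qed.

Lemma int_pieces (f : R -> R) (P : nat -> {poly R}) :
  (forall c, (c < m)%N -> forall y, x c < y < x c.+1 -> f y = (P c).[y]) ->
  \int[lebesgue_measure]_(y in `[0, 1]) f y = \sum_(0 <= c < m) piece_int c (P c).
Proof.
move=> fP; have := @Rintegral_piecewise R m x f
  (fun c => P c \Po ((x c)%:P + (x c.+1 - x c) *: 'X)) x_lt.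
rewrite x0 xm => -> // c cm t /andP[t0 t1].
have xc : 0 < x c.+1 - x c by rewrite subr_gt0 x_lt.
rewrite horner_comp hornerD hornerC hornerZ hornerX (fP c cm) //; apply/andP; split.
  by rewrite ltrDl mulr_gt0.
by rewrite -ltrBrDl gtr_pMr.
Qed.

Lemma x_itv c : (c <= m)%N -> 0 <= x c <= 1.
Proof.
move=> cm; have mono k l : (k <= l)%N -> (l <= m)%N -> x k <= x l.
  elim: l => [|l IH]; first by rewrite leqn0 => /eqP ->.
  rewrite leq_eqVlt => /orP[/eqP -> //|kl] lm.
  by apply: le_trans (IH _ _) (ltW (x_lt lm)); lia.
by rewrite -{1}x0 -xm !mono.
Qed.

Lemma mass_pieces b P : pieces b P -> mass b = piece_gram P.
Proof.
move=> bP; apply/matrixP => k l; rewrite !mxE.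
by apply: int_pieces => c cm y yc; rewrite hornerM !(bP _ _ cm y yc).
Qed.

Lemma stiffness_pieces b P : pieces b P ->
  stiffness b = piece_gram (fun l c => (P l c)^`()).
Proof.
move=> bP; apply/matrixP => k l; rewrite !mxE.
have D j c y : (c < m)%N -> x c < y < x c.+1 -> D01 (b j) y = ((P j c)^`()).[y].
  move=> cm yc; have /andP[c0 _] := x_itv (ltnW cm); have /andP[_ c1] := x_itv cm.
  by have := D01n_piece c0 c1 (bP j c cm) 1 yc; rewrite derivn1.
by apply: int_pieces => c cm y yc; rewrite hornerM !(D _ c).
Qed.

Lemma piece_gram_comb (C : 'M[R]_n) P :
  piece_gram (fun k c => \sum_l C k l *: P l c) = C *m piece_gram P *m C^T.
Proof.
apply/matrixP => k k'; rewrite !mxE.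
transitivity (\sum_l' \sum_l C k l * C k' l' * \sum_(0 <= c < m) piece_int c (P l' c * P l c)).
  rewrite (eq_bigr (fun c => \sum_l' \sum_l C k l * C k' l' * piece_int c (P l' c * P l c))).
    rewrite exchange_big; apply: eq_bigr => l' _; rewrite exchange_big; apply: eq_bigr => l _.
    by rewrite mulr_sumr.
  move=> c _; rewrite mulr_suml piece_int_sum; apply: eq_bigr => l' _.
  rewrite mulr_sumr piece_int_sum; apply: eq_bigr => l _.
  by rewrite -scalerAl -scalerAr !piece_intZ; ring.
apply: eq_bigr => l' _; rewrite !mxE mulr_suml; apply: eq_bigr => l _.
by rewrite mxE; ring.
Qed.

Lemma pieces_comb b e P (C : 'M[R]_n) : pieces b P ->
  (forall k y, y \in `[0, 1] -> e k y = \sum_l C k l * b l y) ->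
  pieces e (fun k c => \sum_l C k l *: P l c).
Proof.
move=> bP eC k c cm y yc; have /andP[y0 y1] := yc.
have /andP[c0 _] := x_itv (ltnW cm); have /andP[_ c1] := x_itv cm.
rewrite eC; last by rewrite in_itv /=; apply/andP; split; lra.
by rewrite horner_sum; apply: eq_bigr => l _; rewrite hornerZ (bP _ _ cm).
Qed.

(** On the open pieces [D01] is the derivative of a polynomial, hence linear, without any claim
    about its values at the breakpoints. *)
Lemma mass_comb b e P (C : 'M[R]_n) : pieces b P ->
  (forall k y, y \in `[0, 1] -> e k y = \sum_l C k l * b l y) ->
  mass e = C *m mass b *m C^T /\ stiffness e = C *m stiffness b *m C^T.
Proof.
move=> bP eC; have eP := pieces_comb bP eC.
rewrite (mass_pieces bP) (mass_pieces eP) (stiffness_pieces bP) (stiffness_pieces eP).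
split; rewrite -piece_gram_comb //; congr piece_gram.
apply/funext => k; apply/funext => c; rewrite raddf_sum /=; apply: eq_bigr => l _.
by rewrite derivZ.
Qed.

End PiecewiseGram.

Lemma block_diag_entries (R : realType) (a a' r c c' : nat) (A11 : 'M[R]_(a, a'))
    (A33 : 'M[R]_(c, c')) (i : 'I_(a + (r + c))) (j : 'I_(a' + (r + c'))) :
  let M := block_mx A11 0 0 (block_mx (1%:M : 'M[R]_r) 0 0 A33) in
  [/\ (i < a)%N -> (a' <= j)%N -> M i j = 0,
      (a <= i < a + r)%N -> M i j = (j == i - a + a' :> nat)%N%:R &
      (a + r <= i)%N -> (j < a' + r)%N -> M i j = 0].
Proof.
rewrite /= !mxE; case: splitP => [i1 iE|i2 iE]; rewrite !mxE;
  case: splitP => [j1 jE|j2 jE]; rewrite ?mxE.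
- by have i1a := ltn_ord i1; have j1a := ltn_ord j1; split; lia.
- by have i1a := ltn_ord i1; split=> //; lia.
- have j1a := ltn_ord j1; split=> // h.
  by rewrite (_ : (_ == _)%N = false) //; lia.
case: splitP => [i3 i3E|i4 i4E]; rewrite !mxE; case: splitP => [j3 j3E|j4 j4E]; rewrite ?mxE.
- have i3r := ltn_ord i3; split=> [|h|]; [lia| |lia].
  by congr (_%:R); rewrite -val_eqE /=; lia.
- have i3r := ltn_ord i3; split=> [//|h|]; last lia.
  by rewrite (_ : (_ == _)%N = false) //; lia.
- by split=> //; lia.
- by split=> //; lia.
Qed.

Lemma scaled_sum_exists (R : realType) n (w : 'I_n -> R) (D : 'I_n -> {poly R}) (T : {poly R}) :
  (forall l, exists e, w l *: D l = e *: T) -> exists e, \sum_l w l *: D l = e *: T.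
Proof.
move=> /fin_all_exists[e eE]; exists (\sum_l e l).
by rewrite scaler_suml; apply: eq_bigr => l _.
Qed.

(** * Coordinates of the reference basis in a basis of the family *)

Section Family.
Context {R : realType}.
Variables (p i n : nat) (b : 'I_n -> R -> R).
Hypotheses (p0 : (0 < p)%N) (fn : (f_bound p i <= n)%N).
Local Notation e0 := (i != 1)%N.
Local Notation e1 := (i == 0)%N.
Local Notation A := (p.+2 - e0)%N.
Local Notation w := (2 * n + e0 + e1)%N.
Local Notation yc := (@ycoord R p n e0 e1).
Local Notation brk := (@break R p i n).
Local Notation m := (n_int p i n).
Local Notation r := (r_id p i n).
Local Notation D1 := (d1 p i).
Local Notation D2 := (d2 p i).
Local Notation D3 := (d3 p i).
Local Notation D4 := (d4 p i).
Local Notation E := (@ref_basis R p i n).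
Local Notation xi := (open_knot p m brk).

Let pn : (p < n)%N := f_bound_gt p0 fn.

Lemma block_sizes : [/\ (D1 + (r + D3) = n)%N, (0 < r)%N, (D2 + r + D4 = m + p)%N,
  (p <= D2 <= p.+1)%N & (p <= D4 <= p.+1)%N /\ (D2 < m)%N].
Proof.
have := f_bound_blocks p0 fn; have := pn; rewrite /r_id /n_int /d1 /d2 /d3 /d4.
by case: i => [|[|i']]; case pE: (odd p) => /=; split=> //; try split; lia.
Qed.

(** By the equation, column [k - D1 + D2] of the identity block is the B-spline whose support starts
    at [k + 1] in the coordinate [yc]. The inequalities locate the mirror images: only the first
    [D1] functions can have one at the left end, only the last [D3] at the right end. *)
Lemma block_offsets : [/\ (A./2 + D2 = 1 + D1 + p)%N, (p + D1.*2 <= n.*2)%N,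
  (p.+1 + (1 - e0) <= D1.+1.*2)%N & (p <= D3.*2 + e1)%N].
Proof.
have := pn; rewrite /d1 /d2 /d3.
by case: i => [|[|i']]; case pE: (odd p) => /=; split=> //; lia.
Qed.

(** With [D2 = p] the identity block begins with a B-spline whose first knot is the end 0, which
    must then be an integer in [yc]; likewise for the end 1 and [D4 = p]. *)
Lemma end_knots : (D2 = p -> A = 2 * A./2)%N /\ (D4 = p -> p.+2 + 2 * n + e1 = 2 * (A./2 + m))%N.
Proof.
rewrite /d2 /d4 /n_int.
by case: i => [|[|i']]; case pE: (odd p) => /=; split; lia.
Qed.

Let brk_itv c : (c <= m)%N -> 0 <= brk c <= 1.
Proof. exact: (break_itv p0 fn). Qed.

Let brk_lt c : (c < m)%N -> brk c < brk c.+1.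
Proof. exact: (break_lt p0 fn). Qed.

Let brk_mono c c' : (c <= c' <= m)%N -> brk c <= brk c'.
Proof. exact: (break_mono p0 fn). Qed.

Lemma knotE j : xi j = brk (minn (j - p) m).
Proof. by []. Qed.

Lemma knot_mono j : xi j <= xi j.+1.
Proof. by rewrite !knotE; apply: (brk_mono); lia. Qed.

Lemma break_inj k l : (k <= m)%N -> (l <= m)%N -> brk k = brk l -> k = l.
Proof.
have lt k' l' : (k' < l')%N -> (l' <= m)%N -> brk k' < brk l'.
  by move=> kl lm; apply: lt_le_trans (brk_lt (_ : k' < m)%N) (brk_mono _); lia.
move=> km lm kl; case: (ltngtP k l) => // h; first by have := lt _ _ h lm; rewrite kl ltxx.
by have := lt _ _ h km; rewrite kl ltxx.
Qed.

Lemma find_piece (x : R) : x \in `[0, 1] -> exists2 c, (c < m)%N & brk c <= x <= brk c.+1.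
Proof.
rewrite in_itv /= => /andP[x0 x1].
have H k : (k < m)%N -> x <= brk k.+1 -> exists2 c, (c < m)%N & brk c <= x <= brk c.+1.
  elim: k => [|k IH] km xk; first by exists 0%N => //; rewrite break0 x0.
  case: (lerP x (brk k.+1)) => h; first by apply: IH => //; lia.
  by exists k.+1 => //; rewrite xk ltW.
have m0 : (0 < m)%N by have := le_n_int p0 fn; have := pn; lia.
by apply: (H m.-1); rewrite ?prednK // (break_last p0 fn).
Qed.

Section Basis.
Variable P : 'I_n -> nat -> {poly R}.
Hypothesis b_space : forall l, optimal_space p i n (b l).
Hypothesis b_free : forall c : 'I_n -> R,
  (forall x, x \in `[0, 1] -> \sum_k c k * b k x = 0) -> forall k, c k = 0.
Hypothesis P_size : forall l c, (c < m)%N -> (size (P l c) <= p.+1)%N.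
Hypothesis bP : forall l c, (c < m)%N -> forall x, x \in `[brk c, brk c.+1] -> b l x = (P l c).[x].
Variable M : 'M[R]_(n, m + p).
Hypothesis bM : forall k x, x \in `[0, 1] -> b k x = \sum_j M k j * open_bspline brk j x.
Hypothesis M_first : forall (k : 'I_n) (j : 'I_(m + p)), (k < D1)%N -> (D2 <= j)%N -> M k j = 0.
Hypothesis M_mid : forall (k : 'I_n) (j : 'I_(m + p)), (D1 <= k < D1 + r)%N ->
  M k j = (j == k - D1 + D2 :> nat)%N%:R.
Hypothesis M_last : forall (k : 'I_n) (j : 'I_(m + p)), (D1 + r <= k)%N -> (j < D2 + r)%N -> M k j = 0.

Lemma piece_open (l : 'I_n) c x : (c < m)%N -> brk c < x < brk c.+1 ->
  [/\ b l x = (P l c).[x], x \in `[0, 1] & x < 1].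
Proof.
move=> cm /andP[h1 h2].
have /andP[c0 _] := brk_itv (ltnW cm); have /andP[_ c1] := brk_itv cm.
split; last by lra.
  by apply: bP => //; rewrite in_itv /= !ltW.
by rewrite in_itv /=; apply/andP; split; lra.
Qed.

Lemma comb_zero (v : 'I_n -> R) :
  (forall c, (c < m)%N -> \sum_l v l *: P l c = 0) -> forall l, v l = 0.
Proof.
move=> H; apply: b_free => x x01; have [c cm xc] := find_piece x01.
rewrite -[RHS](horner0 x) -(H c cm) horner_sum; apply: eq_bigr => l _.
by rewrite hornerZ (bP _ cm) // in_itv.
Qed.

Lemma basis_piece_jump l c : (0 < c < m)%N -> exists e, P l c - P l c.-1 = e *: ('X - (brk c)%:P) ^+ p.
Proof.
move=> /andP[c0 cm]; have cm1 : (c.-1 < m)%N by lia.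
have /andP[h0 _] := brk_itv (ltnW cm1); have /andP[_ h1] := brk_itv cm.
have l1 := brk_lt cm1; have l2 := brk_lt cm; rewrite prednK // in l1.
have [[bC _] _ _] := b_space l.
apply: (piece_jump (a := brk c.-1) (c := brk c.+1) p0 _ _ bC); rewrite ?h0 ?h1 ?l1 ?l2 ?P_size //.
- move=> x xc; have xc' : brk c.-1 < x < brk c.-1.+1 by rewrite prednK.
  by have [] := piece_open l cm1 xc'.
- by move=> x xc; have [] := piece_open l cm xc.
Qed.

Lemma comb_jump (v : 'I_n -> R) c : (0 < c < m)%N ->
  exists e, \sum_l v l *: P l c - \sum_l v l *: P l c.-1 = e *: ('X - (brk c)%:P) ^+ p.
Proof.
move=> cm; rewrite -sumrB.
under eq_bigr => l _ do rewrite -scalerBr.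
apply: scaled_sum_exists => l; have [e ->] := basis_piece_jump l cm.
by exists (v l * e); rewrite scalerA.
Qed.

Lemma bspline_piece_zero c (j : 'I_(m + p)) x : (c < m)%N -> brk c < x < brk c.+1 ->
  (c < j - p)%N \/ (j < c)%N -> open_bspline brk j x = 0.
Proof.
move=> cm /andP[xc xc1] [h|h].
  apply: bspline_left; [exact: knot_mono|rewrite knotE].
  by apply: lt_le_trans xc1 (brk_mono _); lia.
apply: bspline_right; [exact: knot_mono|rewrite knotE].
left; apply: le_lt_trans xc; apply: (brk_mono); lia.
Qed.

Lemma basis_piece_single (l : 'I_n) c (j0 : nat) (T : {poly R}) : (c < m)%N ->
  (forall j : 'I_(m + p), [\/ M l j = 0, (c < j - p)%N, (j < c)%N | j = j0 :> nat]) ->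
  (forall j : 'I_(m + p), j = j0 :> nat -> exists e, forall x, brk c < x < brk c.+1 ->
     open_bspline brk j x = e * T.[x]) ->
  exists e, P l c = e *: T.
Proof.
move=> cm Hj HT.
have bE x : brk c < x < brk c.+1 -> (P l c).[x] =
    \sum_(j < m + p | j == j0 :> nat) M l j * open_bspline brk j x.
  move=> xc; have [<- x01 _] := piece_open l cm xc.
  rewrite bM // [RHS]big_mkcond; apply: eq_bigr => j _; case: eqP => // jj0.
  case: (Hj j) => [->|h|h|//]; first by rewrite mul0r.
    by rewrite (bspline_piece_zero cm xc) ?mulr0 //; left.
  by rewrite (bspline_piece_zero cm xc) ?mulr0 //; right.
have [e eE] : exists e, forall x, brk c < x < brk c.+1 ->
    \sum_(j < m + p | j == j0 :> nat) M l j * open_bspline brk j x = e * T.[x].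
  case: (ltnP j0 (m + p)) => j0m.
    have [e eE] := HT (Ordinal j0m) erefl; exists (M l (Ordinal j0m) * e) => x xc.
    by rewrite (big_pred1 (Ordinal j0m)) ?eE ?mulrA // => j; rewrite -val_eqE.
  exists 0 => x _; rewrite big_pred0 ?mul0r // => j.
  by have := ltn_ord j; lia.
exists e; apply: (poly_eq_oo (brk_lt cm)) => x xc.
by rewrite bE // eE // hornerZ.
Qed.

Lemma basis_piece_zero (l : 'I_n) c : (c < m)%N ->
  (forall j : 'I_(m + p), [\/ M l j = 0, (c < j - p)%N | (j < c)%N]) -> P l c = 0.
Proof.
move=> cm Hj; have [||e ->] := @basis_piece_single l c (m + p) 0 cm; last by rewrite scaler0.
  by move=> j; case: (Hj j); [constructor 1|constructor 2|constructor 3].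
by move=> j jE; have := ltn_ord j; lia.
Qed.

Lemma basis_piece_first (l : 'I_n) c : (c < m)%N ->
  (forall j : 'I_(m + p), (j < c + p)%N -> M l j = 0) ->
  exists e, P l c = e *: ('X - (brk c)%:P) ^+ p.
Proof.
move=> cm Hj; apply: (basis_piece_single (j0 := c + p) cm).
  move=> j; case: (ltngtP j (c + p)) => h; [constructor 1|constructor 2|constructor 4]; first exact: Hj.
    by lia.
  by [].
move=> j jE; have [e eE] := bspline_first knot_mono p j.
exists e => x /andP[x1 x2]; rewrite horner_exp hornerXsubC.
have k1 : xi j = brk c by rewrite knotE jE addnK; congr brk; lia.
have k2 : xi j.+1 = brk c.+1 by rewrite knotE jE -addSn addnK; congr brk; lia.
by rewrite /open_bspline eE k1 ?k2 // ltW.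
Qed.

Lemma basis_piece_last (l : 'I_n) c : (c < m)%N ->
  (forall j : 'I_(m + p), (c < j)%N -> M l j = 0) ->
  exists e, P l c = e *: ('X - (brk c.+1)%:P) ^+ p.
Proof.
move=> cm Hj; apply: (basis_piece_single (j0 := c) cm).
  move=> j; case: (ltngtP j c) => h; [constructor 3|constructor 1|constructor 4] => //.
  exact: Hj.
move=> j jE; have [e eE] := bspline_last knot_mono p j.
exists (e * (-1) ^+ p) => x xc; have [_ _ x1] := piece_open l cm xc; move: xc => /andP[xc1 xc2].
have k1 : xi (j + p)%N = brk c by rewrite knotE jE addnK; congr brk; lia.
have k2 : xi (j + p).+1 = brk c.+1 by rewrite knotE jE -addSn addnK; congr brk; lia.
rewrite /open_bspline eE ?k1 ?k2 //; last by rewrite ltW.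
by rewrite horner_exp hornerXsubC -mulrA -exprMn mulN1r opprB.
Qed.

Variable C : 'M[R]_n.
Hypothesis EC : forall k x, x \in `[0, 1] -> E k x = \sum_l C k l * b l x.

Lemma ref_first_zero (k : 'I_n) x : (k < D1)%N -> x \in `[0, 1] -> brk D2 < x -> E k x = 0.
Proof.
move=> kD x01; have [dn r0 dm d2p [d4p d2m]] := block_sizes; have [off1 off2 off3 off4] := block_offsets.
rewrite -(ycoord_lt p0 fn) (ycoord_break p0 fn) ?off1; last by lia.
rewrite (ref_basisE p0 fn _ x01) /fold_fun /= => yx.
have jR : k.+1%:R <= D1%:R :> R by rewrite ler_nat.
have cR : (1 - e0)%:R <= 1 :> R by case: (e0); rewrite ?ler01 ?lexx.
move: (x01); rewrite in_itv /= => /andP[_ x1].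
rewrite (@right_image_out R p i n p0 fn) //; last by lia.
have k1 : 1 <= k.+1%:R :> R by rewrite ler1n.
move: yx; have -> : (1 + D1 + p)%:R = D1%:R + p.+1%:R :> R by rewrite -natrD; congr _%:R; lia.
move=> yx.
by rewrite !(cardB_outside p0) ?mulr0 ?addr0 //; apply/orP; right; lra.
Qed.

Lemma ref_last_zero (k : 'I_n) x : (D1 + r <= k)%N -> x \in `[0, 1] -> x < brk (D2 + r - p) -> E k x = 0.
Proof.
move=> kD x01; have [dn r0 dm d2p [d4p d2m]] := block_sizes; have [off1 off2 off3 off4] := block_offsets.
rewrite -(ycoord_lt p0 fn) (ycoord_break p0 fn); last by lia.
rewrite (_ : A./2 + (D2 + r - p) = 1 + D1 + r)%N; last by lia.
rewrite (ref_basisE p0 fn _ x01) /fold_fun /= => yx.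
move: (x01); rewrite in_itv /= => /andP[x0 _].
rewrite (@left_image_out R p i n p0 fn) //; last by lia.
have jR : (1 + D1 + r)%:R <= k.+1%:R :> R by rewrite ler_nat; lia.
have jR2 : (1 + D1 + r)%:R + k.+1%:R <= (2 * n + 1 + e1)%:R :> R.
  by rewrite -natrD ler_nat; have := ltn_ord k; lia.
by rewrite !(cardB_outside p0) ?mulr0 ?addr0 //; apply/orP; left; lra.
Qed.

Lemma knot_ycoord (c : nat) : (D2 - p <= c <= m + p - D4)%N -> yc (brk c) = (A./2 + c)%:R.
Proof.
move=> cD; have [dn r0 dm d2p [d4p d2m]] := block_sizes; have [e1E e2E] := end_knots.
case: (posnP c) => c0.
  rewrite c0 break0 ycoord0 addn0 {1}e1E; last by lia.
  by rewrite natrM; field.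
case: (ltnP c m) => cm; first by rewrite (ycoord_break p0 fn) ?c0.
have cE : c = m by lia.
rewrite cE (break_last p0 fn) ycoord1 e2E; last by lia.
by rewrite natrM; field.
Qed.

Lemma ref_mid (k : 'I_n) x : (D1 <= k < D1 + r)%N -> 0 <= x < 1 -> E k x = b k x.
Proof.
move=> kD /andP[x0 x1]; have [dn r0 dm d2p [d4p d2m]] := block_sizes; have [off1 off2 off3 off4] := block_offsets.
have x01 : x \in `[0, 1] by rewrite in_itv /= x0 ltW.
rewrite (ref_basisE p0 fn _ x01) /fold_fun /=.
rewrite (@left_image_out R p i n p0 fn) // ?(@right_image_out R p i n p0 fn) ?mulr0 ?addr0 ?ltW //; [|lia|lia].
have jm : (k - D1 + D2 < m + p)%N by lia.
rewrite bM // (bigD1 (Ordinal jm)) //= M_mid // eqxx mul1r big1 ?addr0; last first.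
  move=> j jk; rewrite M_mid // (_ : (_ == _)%N = false) ?mul0r //.
  by apply/negbTE; apply: contraNneq jk => jk; apply/eqP/val_inj.
rewrite /open_bspline (@bspline_uniform R xi (w%:R / 2) (A%:R / 2) k.+1) //.
  by rewrite divr_gt0 ?ltr0n //; lia.
move=> s sp; rewrite /= -[LHS]/(yc _) knotE (minn_idPl _); last by lia.
by rewrite knot_ycoord; [congr _%:R|]; lia.
Qed.

(* The combination of the b l with D1 <= l in the k-th reference function is
   supported in p intervals, and its jumps at their p + 1 end points are multiples
   of truncated powers, which are independent. *)
Lemma ref_coord_first (k l : 'I_n) : (k < D1)%N -> (D1 <= l)%N -> C k l = 0.
Proof.
move=> kD lD; have [dn r0 dm d2p [d4p d2m]] := block_sizes.
pose v (l : 'I_n) := if (D1 <= l)%N then C k l else 0.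
suff H : forall l, v l = 0 by have := H l; rewrite /v lD.
pose G c := \sum_l v l *: P l c.
(* To the right of [brk D2] the [b l] with [l < D1] vanish, so [G] agrees with the reference
   function, which is 0 there. *)
have Gfar c : (D2 <= c < m)%N -> G c = 0.
  move=> /andP[c1 cm]; apply: (poly_eq_oo (brk_lt cm)) => x xc.
  rewrite horner0 /G horner_sum.
  have xc01 : x \in `[0, 1] by have [_ ? _] := piece_open k cm xc.
  transitivity (E k x); last first.
    apply: ref_first_zero => //.
    by case/andP: xc => xc _; apply: le_lt_trans xc; apply: (brk_mono); lia.
  rewrite EC //; apply: eq_bigr => q _; rewrite hornerZ /v.
  have [bq _ _] := piece_open q cm xc; rewrite bq.
  case: leqP => // qD; rewrite mul0r (_ : P q c = 0) ?horner0 ?mulr0 //.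
  apply: basis_piece_zero => // j; case: (leqP D2 j) => jD; [constructor 1|constructor 3]; last by lia.
  exact: M_first.
have Mv (q : 'I_n) (j : 'I_(m + p)) : (D1 <= q)%N -> (j < D2)%N -> M q j = 0.
  move=> qD jD; case: (ltnP q (D1 + r)) => qr.
    by rewrite M_mid ?qD // (_ : (_ == _)%N = false) //; lia.
  by apply: M_last => //; lia.
have Gnear c : (c < D2 - p)%N -> G c = 0.
  move=> cD; apply: big1 => q _; rewrite /v; case: leqP => qD; last by rewrite scale0r.
  rewrite basis_piece_zero ?scaler0 //; first by lia.
  by move=> j; case: (ltnP j D2) => jD; [constructor 1; exact: Mv|constructor 2; lia].
pose c0 := (D2 - p)%N.
(* The pieces are shifted by one: [Q 0 = 0] stands for what lies left of [brk c0], where there is no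
   interval if [c0 = 0]. *)
pose Q s := if s is s'.+1 then G (c0 + s')%N else 0.
have Q0 : forall s, (s <= p.+1)%N -> Q s = 0.
  apply: (@chain_zero _ p Q (fun s => brk (c0 + s)%N)) => //.
  - move=> s s' sp s'p /break_inj H; apply: (@addnI c0); apply: H; rewrite /c0; lia.
  - by rewrite /Q /c0; apply: Gfar; lia.
  case=> [_|s sp]; rewrite /Q.
    rewrite subr0 addn0; apply: scaled_sum_exists => q; rewrite /v.
    case: leqP => qD; last by exists 0; rewrite !scale0r.
    (* On interval [c0] only the B-spline of index [D2] is left, and it is a pure power there: the
       jump from 0 has the required form even at the end of the domain. *)
    have [|j jc|e ->] := @basis_piece_first q c0; first by rewrite /c0; lia.
      by apply: Mv => //; move: jc; rewrite /c0; lia.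
    by exists (C k q * e); rewrite scalerA.
  have := @comb_jump v (c0 + s.+1); rewrite addnS /= -/(G _); apply.
  by rewrite /c0; lia.
apply: comb_zero => c cm; rewrite -/(G c).
case: (ltnP c c0) => h1; first exact: Gnear.
case: (ltnP c D2) => h2; last by apply: Gfar; rewrite h2.
have := Q0 (c - c0).+1; rewrite /Q subnKC //; apply; rewrite /c0 in h1 *; lia.
Qed.

(** The mirror of [ref_coord_first], now with the [p + 1] points from [brk (D2 + r - p)] to
    [brk (D2 + r)]. *)
Lemma ref_coord_last (k l : 'I_n) : (D1 + r <= k)%N -> (l < D1 + r)%N -> C k l = 0.
Proof.
move=> kD lD; have [dn r0 dm d2p [d4p d2m]] := block_sizes.
pose v (l : 'I_n) := if (l < D1 + r)%N then C k l else 0.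
suff H : forall l, v l = 0 by have := H l; rewrite /v lD.
pose G c := \sum_l v l *: P l c.
have Gnear c : (c < D2 + r - p)%N -> G c = 0.
  move=> cD; have cm : (c < m)%N by lia.
  apply: (poly_eq_oo (brk_lt cm)) => x xc.
  rewrite horner0 /G horner_sum.
  have xc01 : x \in `[0, 1] by have [_ ? _] := piece_open k cm xc.
  transitivity (E k x); last first.
    apply: ref_last_zero => //.
    by case/andP: xc => _ xc; apply: lt_le_trans xc _; apply: (brk_mono); lia.
  rewrite EC //; apply: eq_bigr => q _; rewrite hornerZ /v.
  have [bq _ _] := piece_open q cm xc; rewrite bq.
  case: ltnP => // qD; rewrite mul0r (_ : P q c = 0) ?horner0 ?mulr0 //.
  apply: basis_piece_zero => // j; case: (ltnP j (D2 + r)) => jD; [constructor 1|constructor 2]; last by lia.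
  exact: M_last.
have Mv (q : 'I_n) (j : 'I_(m + p)) : (q < D1 + r)%N -> (D2 + r <= j)%N -> M q j = 0.
  move=> qD jD; case: (leqP D1 q) => qr.
    by rewrite M_mid ?qD ?qr // (_ : (_ == _)%N = false) //; lia.
  by apply: M_first => //; lia.
have Gfar c : (D2 + r <= c < m)%N -> G c = 0.
  move=> /andP[cD cm]; apply: big1 => q _; rewrite /v; case: ltnP => qD; last by rewrite scale0r.
  rewrite basis_piece_zero ?scaler0 // => j.
  by case: (leqP (D2 + r) j) => jD; [constructor 1; exact: Mv|constructor 3; lia].
pose c1 := (D2 + r - p)%N.
(* Here [Q p.+1 = 0] stands for what lies right of [brk (c1 + p)], which may be the end 1. *)
pose Q s := if (s <= p)%N then G (c1.-1 + s)%N else 0.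
have Q0 : forall s, (s <= p.+1)%N -> Q s = 0.
  apply: (@chain_zero _ p Q (fun s => brk (c1 + s)%N)) => //.
  - move=> s s' sp s'p /break_inj H; apply: (@addnI c1); apply: H; rewrite /c1; lia.
  - by rewrite /Q /= addn0 Gnear // /c1; lia.
  - by rewrite /Q ltnn.
  move=> s sp; rewrite /Q sp; case: (ltnP s p) => sp'.
    have := @comb_jump v (c1 + s); rewrite -/(G _) (_ : (c1 + s).-1 = c1.-1 + s)%N; last by rewrite /c1; lia.
    rewrite (_ : (c1.-1 + s.+1 = c1 + s)%N); last by rewrite /c1; lia.
    by apply; rewrite /c1; lia.
  have -> : s = p by lia.
  rewrite sub0r -sumrN; under eq_bigr => q _ do rewrite -scaleNr.
  apply: scaled_sum_exists => q; rewrite /v.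
  case: ltnP => qD; last by exists 0; rewrite oppr0 !scale0r.
  have [|j jc|e ->] := @basis_piece_last q (c1.-1 + p)%N; first by rewrite /c1; lia.
    by apply: Mv => //; move: jc; rewrite /c1; lia.
  exists (- C k q * e); rewrite scalerA (_ : (c1.-1 + p).+1 = c1 + p)%N //.
  by rewrite /c1; lia.
apply: comb_zero => c cm; rewrite -/(G c).
case: (ltnP c c1) => h1; first exact: Gnear.
case: (ltnP c (D2 + r)) => h2; last by apply: Gfar; rewrite h2.
have := Q0 (c - c1.-1)%N; rewrite /Q subnKC; last by lia.
by rewrite ifT; [apply; rewrite /c1 in h1 *|rewrite /c1 in h1 *]; lia.
Qed.

(** For such [k] both [E k] and [b k] are the same B-spline on [0,1), and the [b l] are
    independent. *)
Lemma ref_coord_mid (k l : 'I_n) : (D1 <= k < D1 + r)%N -> C k l = (k == l)%:R.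
Proof.
move=> kD; apply/eqP; rewrite -subr_eq0; apply/eqP.
apply: (comb_zero (v := fun l => C k l - (k == l)%:R)) => c cm.
apply: (poly_eq_oo (brk_lt cm)) => x xc.
rewrite horner0 horner_sum; have [_ x01 x1] := piece_open k cm xc.
rewrite (eq_bigr (fun q => C k q * b q x - (k == q)%:R * b q x)); last first.
  by move=> q _; have [-> _ _] := piece_open q cm xc; rewrite hornerZ mulrBl.
rewrite sumrB -EC // ref_mid //; last by move: x01; rewrite in_itv /= => /andP[-> _].
rewrite (bigD1 k) //= eqxx mul1r big1 ?addr0 ?subrr // => q qk.
by rewrite eq_sym (negbTE qk) mul0r.
Qed.

End Basis.
End Family.

Lemma block_form_entries (R : realType) (p i n : nat) (M : 'M[R]_(n, n_int p i n + p)) :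
  block_form M -> forall (k : 'I_n) (j : 'I_(n_int p i n + p)),
  [/\ (k < d1 p i)%N -> (d2 p i <= j)%N -> M k j = 0,
      (d1 p i <= k < d1 p i + r_id p i n)%N -> M k j = (j == k - d1 p i + d2 p i :> nat)%N%:R &
      (d1 p i + r_id p i n <= k)%N -> (j < d2 p i + r_id p i n)%N -> M k j = 0].
Proof.
move=> [A11 [A33 [[e1 e2] ->]]] k j; rewrite castmxE.
exact: (block_diag_entries A11 A33 (cast_ord (esym e1) k) (cast_ord (esym e2) j)).
Qed.

(** * The Gram matrices of a basis of the family *)

Section Final.
Context {R : realType}.
Variables (p i n : nat).
Hypotheses (p0 : (0 < p)%N) (fn : (f_bound p i <= n)%N).
Local Notation e0 := (i != 1)%N.
Local Notation e1 := (i == 0)%N.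
Local Notation w := (2 * n + e0 + e1)%N.
Local Notation E := (@ref_basis R p i n).
Local Notation V := (@mode_mx R n e0 e1).
Local Notation ang := (@angle R n e0 e1).

Let pn : (p < n)%N := f_bound_gt p0 fn.

Let w2_gt0 : 0 < w%:R / 2 :> R.
Proof. by rewrite divr_gt0 // ltr0n; lia. Qed.

Lemma nuE : nu i n = w%:R / 2 :> R.
Proof.
rewrite /nu; case: i => [|[|i']] /=.
- have -> : (2 * n + 1 + 1 = 2 * n.+1)%N by lia.
  by rewrite natrM; field.
- by rewrite !addn0 natrM; field.
- by congr (_%:R / _); lia.
Qed.

Lemma thetaE (k : 'I_n) : theta i k = ang k.
Proof.
have n0 : n%:R != 0 :> R by rewrite pnatr_eq0; lia.
have n1 : n.+1%:R != 0 :> R by rewrite pnatr_eq0.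
rewrite /theta /angle; case: i => [|[|i']] /=.
- have -> : (2 * n + 1 + 1 = 2 * n.+1)%N by lia.
  have -> : (2 * k + 1 + 1 = 2 * k.+1)%N by lia.
  by rewrite !natrM; field; rewrite nat1r.
- by rewrite !addn0 !natrM; field.
- by rewrite !addn0 !addn1.
Qed.

Lemma angle_pair (k l : 'I_n) : (k < l)%N ->
  gsym p 1 (ang k) * gsym p 0 (ang l) < gsym p 1 (ang l) * gsym p 0 (ang k).
Proof.
move=> kl; have /andP[k0 _] := @angle_itv R _ _ e0 e1 p0 pn k (ltn_ord k).
have /andP[_ l1] := @angle_itv R _ _ e0 e1 p0 pn l (ltn_ord l).
by apply: gsym_ratio_mono => //; rewrite k0 (angle_lt _ _ p0 pn).
Qed.

Lemma spectrum_mass_ref : spectrum (mass E) =1 multiset_of (fun k : 'I_n => (nu i n)^-1 * gsym p 0 (theta i k)).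
Proof.
have H := @mass_mode R p n e0 e1 p0 pn E (ref_basisE p0 fn).
move=> a; rewrite (spectrum_eigen (mode_mx_unit e0 e1 p0 pn) H); apply: eq_card => j.
by rewrite !inE mxE nuE thetaE.
Qed.

Lemma spectrum_stiffness_ref : spectrum (stiffness E) =1 multiset_of (fun k : 'I_n => nu i n * gsym p 1 (theta i k)).
Proof.
have H := @stiffness_mode R p n e0 e1 p0 pn E (ref_basisE p0 fn).
move=> a; rewrite (spectrum_eigen (mode_mx_unit e0 e1 p0 pn) H); apply: eq_card => j.
by rewrite !inE mxE nuE thetaE.
Qed.

Variable b : 'I_n -> R -> R.
Hypothesis bF : family p i b.

Lemma family_pieces : exists P : 'I_n -> nat -> {poly R}, forall l c, (c < n_int p i n)%N ->
  (size (P l c) <= p.+1)%N /\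
  forall x, x \in `[break p i n c, break p i n c.+1] -> b l x = (P l c).[x].
Proof.
have [[bS _ _] _ _] := bF.
have piece l c : exists Q : {poly R}, (c < n_int p i n)%N -> (size Q <= p.+1)%N /\
  forall x, x \in `[break p i n c, break p i n c.+1] -> b l x = Q.[x].
  case: (ltnP c (n_int p i n)) => cm; last by exists 0.
  by have [[_ /(_ c cm)[Q QP]] _ _] := bS l; exists Q.
by exists (fun l => projT1 (choice (piece l))) => l; exact: projT2 (choice (piece l)).
Qed.

Lemma ref_basis_conj : exists C : 'M[R]_n,
  [/\ C \in unitmx, C *m C^T = 1%:M, mass E = C *m mass b *m C^T &
      stiffness E = C *m stiffness b *m C^T].
Proof.
have [[bS bfree bspan] [M [Mblk bM]] bcom] := bF.
have [P PP] := family_pieces.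
have Psize l c : (c < n_int p i n)%N -> (size (P l c) <= p.+1)%N by move=> /(PP l c)[].
have bP l c : (c < n_int p i n)%N ->
  forall x, x \in `[break p i n c, break p i n c.+1] -> b l x = (P l c).[x] by move=> /(PP l c)[].
have [c cE] := fin_all_exists (fun k => bspan _ (@ref_basis_space R p i n p0 fn k)).
pose C : 'M[R]_n := \matrix_(k, l) c k l.
have EC k x : x \in `[0, 1] -> E k x = \sum_l C k l * b l x.
  by move=> x01; rewrite cE //; apply: eq_bigr => l _; rewrite mxE.
clearbody C => {c cE}.
have M1 (k : 'I_n) (j : 'I_(n_int p i n + p)) : (k < d1 p i)%N -> (d2 p i <= j)%N -> M k j = 0.
  by have [] := block_form_entries Mblk k j.
have M2 (k : 'I_n) (j : 'I_(n_int p i n + p)) : (d1 p i <= k < d1 p i + r_id p i n)%N ->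
    M k j = (j == k - d1 p i + d2 p i :> nat)%N%:R.
  by have [] := block_form_entries Mblk k j.
have M3 (k : 'I_n) (j : 'I_(n_int p i n + p)) : (d1 p i + r_id p i n <= k)%N ->
    (j < d2 p i + r_id p i n)%N -> M k j = 0.
  by have [] := block_form_entries Mblk k j.
have C1 (k l : 'I_n) : (k < d1 p i)%N -> (d1 p i <= l)%N -> C k l = 0.
  exact: (ref_coord_first p0 fn bS bfree Psize bP bM M1 M2 M3 EC).
have C2 (k l : 'I_n) : (d1 p i <= k < d1 p i + r_id p i n)%N -> C k l = (k == l)%:R.
  exact: (ref_coord_mid p0 fn bfree bP bM M2 EC).
have C3 (k l : 'I_n) : (d1 p i + r_id p i n <= k)%N -> (l < d1 p i + r_id p i n)%N -> C k l = 0.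
  exact: (ref_coord_last p0 fn bS bfree Psize bP bM M1 M2 M3 EC).
have bpieces : pieces (n_int p i n) (break p i n) b P.
  by move=> l k km x /andP[x0 x1]; apply: bP => //; rewrite in_itv /= !ltW.
have [ME KE] := mass_comb (break0 p i n) (break_last p0 fn) (break_lt p0 fn) bpieces EC.
exists C.
have MK : mass b *m stiffness b = stiffness b *m mass b by apply/eqP; rewrite -subr_eq0 bcom.
have Hm := @mass_mode R p n e0 e1 p0 pn E (ref_basisE p0 fn).
have Hk := @stiffness_mode R p n e0 e1 p0 pn E (ref_basisE p0 fn).
have [|j l|Cu CT] := conj_commute (mode_mx_unit e0 e1 p0 pn) Hm Hk (tridiag_mode_mx e0 e1 p0 pn) _ _ ME KE MK.
- by move=> j; rewrite mxE mulf_neq0 ?invr_eq0 // gt_eqF //; exact: gsym0_gt0.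
- rewrite !mxE => jl; apply: val_inj => /=.
  (* The scalings of the two spectra are inverse to each other and cancel in the products. *)
  have {}jl : gsym p 0 (ang j) * gsym p 1 (ang l) = gsym p 1 (ang j) * gsym p 0 (ang l).
    have w2n : w%:R / 2 != 0 :> R by rewrite gt_eqF.
    by move: jl; rewrite mulrACA mulVf // mul1r mulrACA mulfV // mul1r.
  by case: (ltngtP j l) => [jl'|lj|//]; [have := angle_pair jl'|have := angle_pair lj];
    rewrite -jl mulrC ltxx.
(* The middle columns are those of the identity as well, since the first and the last rows of [C]
   stay in their own blocks. *)
have C2' (k l : 'I_n) : (d1 p i <= k < d1 p i + r_id p i n)%N -> C l k = (k == l)%:R.
  move=> km; case: (ltnP l (d1 p i)) => l1.
    by rewrite C1 1?[k == l](_ : _ = false) //; [apply/eqP => kl; rewrite kl in km|]; lia.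
  case: (ltnP l (d1 p i + r_id p i n)) => l2; first by rewrite C2 ?l1 // eq_sym.
  by rewrite C3 1?[k == l](_ : _ = false) //; [apply/eqP => kl; rewrite kl in km|]; lia.
split=> //; have [dn r0 _ _ _] := @block_sizes p i n p0 fn.
apply: (commute_tridiag_block (a := d1 p i) (b := d1 p i + r_id p i n) _ CT) => [|k l km|k l km|k l kd ld].
- lia.
- by rewrite mxE (bigD1 k) //= C2 // eqxx mul1r big1 ?addr0 ?mxE ?C2' // => q qk;
    rewrite C2 // eq_sym (negbTE qk) mul0r.
- by rewrite mxE (bigD1 k) //= mxE [C k k]C2 // eqxx mulr1 big1 ?addr0 ?C2' // => q qk;
    rewrite mxE [C k q]C2 // eq_sym (negbTE qk) mulr0.
- split; rewrite mxE big1 // => q _; rewrite mxE; case: (ltnP q (d1 p i)) => qd.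
  + by rewrite [C l q]C3 ?mulr0 //; lia.
  + by rewrite [C k q]C1 ?mul0r //; lia.
  + by rewrite [C l q]C3 ?mul0r //; lia.
  + by rewrite [C k q]C1 ?mulr0 //; lia.
Qed.

Lemma family_char_poly : char_poly (mass b) = char_poly (mass E) /\
  char_poly (stiffness b) = char_poly (stiffness E).
Proof.
have [C [Cu CC -> ->]] := ref_basis_conj.
have CtC := mulmx1C CC.
by split; apply/esym/(char_poly_conj Cu); rewrite -mulmxA CtC mulmx1.
Qed.

End Final.

Theorem corollary2 (R : realType) (p : nat) (i : 'I_3) (n : nat)
    (b : 'I_n -> R -> R) :
  (1 <= p)%N -> (f_bound p i <= n)%N -> family p i b ->
  [/\ spectrum (mass b) =1 spectrum (mass (ref_basis p i (n := n))),
      spectrum (stiffness b) =1 spectrum (stiffness (ref_basis p i (n := n))) &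
      outlier_free p i b].
Proof.
move=> p0 fn bF; have [cM cK] := family_char_poly p0 fn bF.
have eM : spectrum (mass b) =1 spectrum (mass (ref_basis p i (n := n))).
  by move=> a; exact: (congr1 (mup a) cM).
have eK : spectrum (stiffness b) =1 spectrum (stiffness (ref_basis p i (n := n))).
  by move=> a; exact: (congr1 (mup a) cK).
split; [exact: eM|exact: eK|split; first by case: bF].
- by move=> a; rewrite eM; exact: (spectrum_mass_ref p0 fn a).
- by move=> a; rewrite eK; exact: (spectrum_stiffness_ref p0 fn a).
Qed.
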